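(* Let $N\ge 1$ and let $u\in H^1(\mathbb{R}^N)\setminus\mathcal{M}$ satisfy $Q(u)=Q$. Then $u$ decays exponentially fast as $|x|\to\infty$, namely there exists $C>0$ such that $|u(x)|\le Ce^{-|x|}$ for (almost) every $x\in\mathbb{R}^N$. In particular, $v:=u/\gamma$ belongs to $H^1(\mathbb{R}^N,d\gamma)$ and $Q_\gamma(v)=Q$.
   Context: All functions are real-valued, $N\ge1$, and $s^2\log s^2:=0$ at $s=0$. Euclidean setting. Let $\mathcal{M}:=\{a e^{-\frac{\pi}{2}|x-b|^2}: a\in\mathbb{R},\, b\in\mathbb{R}^N\}$. For $u\in H^1(\mathbb{R}^N)$ let $$\delta[u]:=\int_{\mathbb{R}^N}|\nabla u|^2\,dx-\pi\int_{\mathbb{R}^N}u^2\log\frac{u^2}{\|u\|_{L^2(\mathbb{R}^N)}^2}\,dx-N\pi\int_{\mathbb{R}^N}u^2\,dx\in[0,+\infty]$$ (equal to $+\infty$ when the entropy integral is $-\infty$), $d(u,\mathcal{M}):=\inf_{w\in\mathcal{M}}\|u-w\|_{L^2(\mathbb{R}^N)}$, and, for $u\in H^1(\mathbb{R}^N)\setminus\mathcal{M}$, $Q(u):=\delta[u]/d(u,\mathcal{M})^2$. Gaussian setting. Let $\gamma(x):=e^{-\frac{\pi}{2}|x|^2}$ and $d\gamma:=\gamma(x)^2dx$ (a probability measure), $\mathcal{M}_\gamma:=\{a e^{b\cdot x}: a\in\mathbb{R},\,b\in\mathbb{R}^N\}$. For $v\in H^1(\mathbb{R}^N,d\gamma)$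 let $$\delta_\gamma[v]:=\int_{\mathbb{R}^N}|\nabla v|^2\,d\gamma-\pi\int_{\mathbb{R}^N}v^2\log\frac{v^2}{\|v\|_{L^2(\mathbb{R}^N,d\gamma)}^2}\,d\gamma,\qquad d_\gamma(v,\mathcal{M}_\gamma):=\inf_{w\in\mathcal{M}_\gamma}\|v-w\|_{L^2(\mathbb{R}^N,d\gamma)},$$ and, for $v\notin\mathcal{M}_\gamma$, $Q_\gamma(v):=\delta_\gamma[v]/d_\gamma(v,\mathcal{M}_\gamma)^2$. The sharp stability constant is $$Q:=\inf_{v\in H^1(\mathbb{R}^N,d\gamma)\setminus\mathcal{M}_\gamma}Q_\gamma(v)=\inf_{u\in H^1(\mathbb{R}^N)\setminus\mathcal{M}}Q(u);$$ the equality of the two infima and the fact that $Q>0$ are known. *)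

(* Defs.v *)
From HB Require Import structures.
From mathcomp Require Import all_boot all_order all_algebra.
From mathcomp Require Import all_classical all_reals all_analysis.
From mathcomp Require Import measurable_realfun.

Set Implicit Arguments.
Unset Strict Implicit.
Unset Printing Implicit Defensive.
Import Order.TTheory GRing.Theory Num.Theory.
Import numFieldNormedType.Exports.

Local Open Scope classical_set_scope.
Local Open Scope ring_scope.

(* R^N is 'rV[R]_N. Its library norm is the sup norm, which is used here only
   through the topology and the derivatives it induces; enorm is the Euclidean
   norm. *)
Definition dotr (R : realType) (N : nat) (x y : 'rV[R]_N) : R :=
  \sum_(i < N) x 0 i * y 0 i.

Definition enorm (R : realType) (N : nat) (x : 'rV[R]_N) : R :=
  Num.sqrt (dotr x x).

(* The sigma-algebra generated by the coordinates, i.e. the Borel one. *)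
Section measurable_row.
Context {R : realType} (N : nat).

Let coord : 'I_N -> 'rV[R]_N -> R := fun i x => x 0 i.

Let row_set0 : g_sigma_preimage coord set0.
Proof. exact: sigma_algebra0. Qed.

Let row_setC A : g_sigma_preimage coord A -> g_sigma_preimage coord (~` A).
Proof. exact: sigma_algebraC. Qed.

Let row_bigcup (F : (set 'rV[R]_N)^nat) :
  (forall i, g_sigma_preimage coord (F i)) ->
  g_sigma_preimage coord (\bigcup_i (F i)).
Proof. exact: sigma_algebra_bigcup. Qed.

HB.instance Definition _ := @isMeasurable.Build default_measure_display
  'rV[R]_N (g_sigma_preimage coord) row_set0 row_setC row_bigcup.

Lemma measurable_row_coord (i : 'I_N) :
  measurable_fun [set: 'rV[R]_N] (fun x : 'rV[R]_N => x 0 i).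
Proof.
move=> _ Y mY; rewrite setTI; apply: sub_sigma_algebra => /=.
rewrite -bigcup_seq/=; exists i => /=; first by rewrite mem_index_enum.
by exists Y => //; rewrite setTI.
Qed.

Lemma measurable_fun_rowP d (T : measurableType d) (f : T -> 'rV[R]_N) :
  (forall i, measurable_fun [set: T] (fun t => f t 0 i)) ->
  measurable_fun [set: T] f.
Proof.
move=> mf _ Y mY; rewrite setTI.
have : g_sigma_preimage (fun i => coord i \o f) (f @^-1` Y).
  rewrite g_sigma_preimage_comp.
  by exists Y => //; rewrite setTI.
apply: smallest_sub; first exact: sigma_algebra_measurable.
rewrite -bigcup_seq => A [/= i _ [B mB <-]].
by apply: mf.
Qed.

End measurable_row.

Section lebesgue_row.
Context {R : realType}.

Definition cons_row (N : nat) (x : R * 'rV[R]_N) : 'rV[R]_N.+1 :=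
  \row_(i < N.+1) (if unlift ord0 i is Some j then x.2 0 j else x.1).

Definition uncons_row (N : nat) (x : 'rV[R]_N.+1) : R * 'rV[R]_N :=
  (x 0 ord0, \row_(i < N) x 0 (lift ord0 i)).

Lemma cons_rowK N : cancel (@cons_row N) (@uncons_row N).
Proof.
move=> [a x]; rewrite /uncons_row /cons_row !mxE unlift_none /=; congr pair.
by apply/rowP => i; rewrite !mxE liftK.
Qed.

Lemma uncons_rowK N : cancel (@uncons_row N) (@cons_row N).
Proof.
move=> x; apply/rowP => i; rewrite !mxE.
by case: unliftP => [j ->|->] //=; rewrite mxE.
Qed.

Lemma measurable_cons_row N : measurable_fun setT (@cons_row N).
Proof.
apply: measurable_fun_rowP => i.
rewrite /cons_row; under eq_fun do rewrite mxE.
case: (unlift ord0 i) => [j|]; last exact: measurable_fst.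
apply: (@measurableT_comp _ _ _ _ _ _ (fun x : 'rV[R]_N => x 0 j)) => //.
exact: measurable_row_coord.
Qed.

Lemma measurable_uncons_row N : measurable_fun setT (@uncons_row N).
Proof.
apply/measurable_fun_pairP; split; first exact: measurable_row_coord.
apply: measurable_fun_rowP => i.
rewrite /uncons_row; under eq_fun do rewrite mxE.
exact: measurable_row_coord.
Qed.

Section cons_measure.
Context (N : nat) (mu : {sigma_finite_measure set 'rV[R]_N -> \bar R}).

Definition cons_measure : set 'rV[R]_N.+1 -> \bar R :=
  pushforward ((@lebesgue_measure R) \x mu)%E (@cons_row N).

Let cons_measure0 : cons_measure set0 = 0%E.
Proof. by rewrite /cons_measure /pushforward preimage_set0 measure0. Qed.

Let cons_measure_ge0 A : (0 <= cons_measure A)%E.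
Proof. by rewrite /cons_measure /pushforward; exact: measure_ge0. Qed.

Let cons_measure_sigma_additive : semi_sigma_additive cons_measure.
Proof.
move=> F mF tF mUF; rewrite /cons_measure /pushforward preimage_bigcup.
have mcons A : measurable A -> measurable (@cons_row N @^-1` A).
  by move=> mA; rewrite -[X in measurable X]setTI; exact: measurable_cons_row.
apply: measure_semi_sigma_additive.
- by move=> n; exact: mcons.
- apply/trivIsetP => /= i j _ _ ij; rewrite -preimage_setI.
  by move/trivIsetP : tF => /(_ _ _ _ _ ij) ->//; rewrite preimage_set0.
- by rewrite -preimage_bigcup; exact: mcons.
Qed.

HB.instance Definition _ := isMeasure.Build _ _ _ cons_measure
  cons_measure0 cons_measure_ge0 cons_measure_sigma_additive.

Let cons_measure_sigma_finite : sigma_finite setT cons_measure.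
Proof.
have /sigma_finiteP[F [TF ndF Foo]] := sigma_finiteT (@lebesgue_measure R).
have /sigma_finiteP[G [TG ndG Goo]] := sigma_finiteT mu.
exists (fun k => @uncons_row N @^-1` (F k `*` G k)).
  rewrite -preimage_bigcup (_ : \bigcup_k (F k `*` G k) = setT).
    by rewrite preimage_setT.
  apply/seteqP; split=> // -[a x] _.
  have [k _ Fka] : (\bigcup_k F k) a by rewrite -TF.
  have [l _ Glx] : (\bigcup_k G k) x by rewrite -TG.
  exists (maxn k l) => //; split => /=.
    by move: a Fka; exact/subsetPset/ndF/leq_maxl.
  by move: x Glx; exact/subsetPset/ndG/leq_maxr.
move=> k; have [mF Fk] := Foo k; have [mG Gk] := Goo k; split.
  rewrite -[X in measurable X]setTI; apply: measurable_uncons_row => //.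
  exact: measurableX.
rewrite /cons_measure /pushforward -comp_preimage.
rewrite (_ : @uncons_row N \o @cons_row N = id); last first.
  by apply/funext => x; exact: cons_rowK.
by rewrite preimage_id product_measure1E// lte_mul_pinfty// ge0_fin_numE.
Qed.

HB.instance Definition _ := Measure_isSigmaFinite.Build _ _ _ cons_measure
  cons_measure_sigma_finite.

End cons_measure.

(* Lebesgue measure on R^N, as the N-fold product of lebesgue_measure. *)
Fixpoint lebesgue_row (N : nat) :
    {sigma_finite_measure set 'rV[R]_N -> \bar R} :=
  match N with
  | 0 => \d_(0 : 'rV[R]_0)
  | N'.+1 => cons_measure (lebesgue_row N')
  end.

End lebesgue_row.

Section gaussian.
Context {R : realType} (N : nat).
Implicit Types (x b : 'rV[R]_N).

(* The density of the Gaussian probability measure is gam ^+ 2. *)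
Definition gam x : R := expR (- (pi / 2) * enorm x ^+ 2).

Lemma measurable_dotr_self : measurable_fun setT (fun x => dotr x x).
Proof.
apply: measurable_sum => i; apply: measurable_funM; exact: measurable_row_coord.
Qed.

Lemma enorm_sqr x : enorm x ^+ 2 = dotr x x.
Proof.
by rewrite sqr_sqrtr// sumr_ge0// => i _; rewrite -expr2 sqr_ge0.
Qed.

Lemma measurable_gam : measurable_fun setT gam.
Proof.
rewrite /gam; under eq_fun do rewrite enorm_sqr.
apply: measurableT_comp => //; apply: measurable_funM => //.
exact: measurable_dotr_self.
Qed.

Definition gauss_measure : set 'rV[R]_N -> \bar R :=
  fun A => (\int[lebesgue_row N]_(x in A) (gam x ^+ 2)%:E)%E.

Let gauss_measure0 : gauss_measure set0 = 0%E.
Proof. by rewrite /gauss_measure integral_set0. Qed.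

Let gauss_measure_ge0 A : (0 <= gauss_measure A)%E.
Proof. by apply: integral_ge0 => x _; rewrite lee_fin sqr_ge0. Qed.

Let gauss_measure_sigma_additive : semi_sigma_additive gauss_measure.
Proof.
move=> F mF tF mUF; rewrite /gauss_measure ge0_integral_bigcup//=.
- apply: is_cvg_ereal_nneg_natsum_cond => n _ _.
  by apply: integral_ge0 => x _; rewrite lee_fin sqr_ge0.
- apply/measurable_EFinP/measurable_funTS/measurable_funX.
  exact: measurable_gam.
- by move=> x _; rewrite lee_fin sqr_ge0.
Qed.

HB.instance Definition _ := isMeasure.Build _ _ _ gauss_measure
  gauss_measure0 gauss_measure_ge0 gauss_measure_sigma_additive.

End gaussian.

Section sobolev.
Context {R : realType} (N : nat).
Implicit Types (f u phi : 'rV[R]_N -> R) (g : 'rV[R]_N -> 'rV[R]_N).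
Implicit Types (mu : {measure set 'rV[R]_N -> \bar R}).

Definition basis_vec (i : 'I_N) : 'rV[R]_N := delta_mx 0 i.

(* f has continuous partial derivatives of all orders up to k. *)
Fixpoint Ck (k : nat) f : Prop :=
  match k with
  | 0 => continuous f
  | k'.+1 => continuous f /\
      forall i, (forall x, derivable f x (basis_vec i)) /\
                Ck k' (fun x => 'D_(basis_vec i) f x)
  end.

Definition test_function phi : Prop :=
  (forall k, Ck k phi) /\ compact (closure [set x | phi x != 0]).

Definition loc_integrable f : Prop :=
  measurable_fun setT f /\
  forall K : set 'rV[R]_N, compact K ->
    (lebesgue_row N).-integrable K (EFin \o f).

Definition is_weak_gradient u g : Prop :=
  [/\ loc_integrable u,
      forall i, loc_integrable (fun x => g x 0 i) &
      forall phi i, test_function phi ->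
        (\int[lebesgue_row N]_x (u x * 'D_(basis_vec i) phi x)%:E =
         - \int[lebesgue_row N]_x (g x 0 i * phi x)%:E)%E].

(* Some weak gradient of u; it is unique up to Lebesgue-null sets. *)
Definition weak_gradient u : 'rV[R]_N -> 'rV[R]_N :=
  xget (fun=> 0) (is_weak_gradient u).

(* The space H^1(R^N, dmu), by representatives. The weak gradient is always
   the distributional one, i.e. taken with respect to Lebesgue measure. *)
Definition H1 mu u : Prop :=
  u \in Lfun mu 2%:E /\
  exists2 g, is_weak_gradient u g &
    forall i, (fun x => g x 0 i) \in Lfun mu 2%:E.

Definition dirichlet mu u : \bar R :=
  (\int[mu]_x (enorm (weak_gradient u x) ^+ 2)%:E)%E.

(* ln 0 = 0 in the library, so the integrand is 0 where u is 0. On H^1 the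
   positive part of the integrand has a finite integral, so that the value is
   -oo when the integral of the negative part diverges. *)
Definition entropy mu u : \bar R :=
  (\int[mu]_x
     (u x ^+ 2 * ln (u x ^+ 2 / fine ('N[mu]_2%:E[EFin \o u]) ^+ 2))%:E)%E.

(* Membership in a family of functions, as classes modulo null sets. *)
Definition ae_in mu (M : set ('rV[R]_N -> R)) u : Prop :=
  exists2 w, M w & ae_eq mu setT u w.

Definition L2dist mu u (M : set ('rV[R]_N -> R)) : \bar R :=
  ereal_inf [set ('N[mu]_2%:E[EFin \o (fun x => (u x - w x)%R)])%E | w in M].

Definition Gaussians : set ('rV[R]_N -> R) :=
  [set w | exists a b,
     w = fun x => a * expR (- (pi / 2) * enorm (x - b) ^+ 2)].

Definition Exponentials : set ('rV[R]_N -> R) :=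
  [set w | exists a b, w = fun x => a * expR (dotr b x)].

Definition deficit u : \bar R :=
  (dirichlet (lebesgue_row N) u - pi%:E * entropy (lebesgue_row N) u
   - (N%:R * pi)%:E * \int[lebesgue_row N]_x (u x ^+ 2)%:E)%E.

Definition gdeficit u : \bar R :=
  (dirichlet (@gauss_measure R N) u
   - pi%:E * entropy (@gauss_measure R N) u)%E.

Definition stab_quotient u : \bar R :=
  (deficit u / L2dist (lebesgue_row N) u Gaussians ^+ 2)%E.

Definition gstab_quotient u : \bar R :=
  (gdeficit u / L2dist (@gauss_measure R N) u Exponentials ^+ 2)%E.

End sobolev.

(* The infimum in the Gaussian setting. *)
Definition sharp_constant (R : realType) (N : nat) : \bar R :=
  ereal_inf [set gstab_quotient v | v in [set v : 'rV[R]_N -> R |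
    H1 (@gauss_measure R N) v /\
    ~ ae_in (@gauss_measure R N) (@Exponentials R N) v]].

(* Main.v *)
Require Import Defs.
From HB Require Import structures.
From mathcomp Require Import all_boot all_order all_algebra.
From mathcomp Require Import all_classical all_reals all_analysis.
From mathcomp Require Import measurable_realfun ring lra.

Set Implicit Arguments.
Unset Strict Implicit.
Unset Printing Implicit Defensive.
Import Order.TTheory GRing.Theory Num.Theory.
Import numFieldNormedType.Exports.

Local Open Scope classical_set_scope.
Local Open Scope ring_scope.

(* Let h(s) = s^2 ln s^2 and truncate the minimiser u at the height of the wide
   Gaussian phi = k exp(-al |x|^2), k >= 1, al <= 1/2: u' = sgn(u) min(|u|, phi).
   Since u' decays, u'/gam is a competitor in the Gaussian problem, so that
   delta[u'] >= Q d(u')^2, while delta[u] = Q d(u)^2.  With w = (|u| - phi)^+,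
   the gradient terms differ by the energy of w up to the integral of
   w Delta(phi), the entropies by the integral of h(w) + 2 w phi ln phi^2 up to
   O(w^2 + w phi), and the squared distances by O(w^2 + w phi).  The logarithmic
   Sobolev inequality absorbs h(w) when a, the integral of w^2, is small, and
   2 pi ln phi^2 is negative far out, so that
       (energy of w) / 2 + a <= Lam * (integral of w phi over {phi >= c0})
   with Lam of order 1 + ln k and c0 independent of k when al is small.  De
   Giorgi's iteration along the heights K (2 - 2^-m) then shows that w vanishes
   for k = 2 K as soon as the integral of ((|u| - K)^+)^2 is smaller than a
   power of 1 / ln K; it is so for K large, because the weak-type estimate makes
   it decay like a power of K.  Hence |u| <= 2 K exp(-al |x|^2) for some al > 0. *)

(** * Smooth functions *)

(** The quotient of [u] cannot be compared directly with the Gaussian infimum: [u / gam] lies in the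
    Gaussian Sobolev space only if every [x_i * u] is in L2, which is part of what has to be shown.
    Truncations have these moments, so they alone serve as competitors, and the moment condition is
    carried along in each comparison. The order of the choices matters. The smallness required by
    the iteration depends on [Lam], but not on [al] itself. Hence [K] and [Lam] are fixed in terms
    of the constant barrier [K], and only then is [al] sent to zero: the excess over the wide
    Gaussian converges to the excess over [K]. Sobolev embeddings are replaced by a Faber-Krahn
    inequality obtained by averaging over translations. It has the same form in every dimension,
    gives the weak-type estimate through Chebyshev's inequality, and, summed over dyadic heights,
    the logarithmic Sobolev inequality. Any Gaussian rate suffices at the end: it dominates
    [exp (- |x|)] and provides the missing moments of [u]. *)

Section smooth.
Context {R : realType} (N : nat).
Implicit Types (f g p : 'rV[R]_N -> R).

Definition smooth f := forall k, Ck k f.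

Lemma CkW k f : Ck k.+1 f -> Ck k f.
Proof.
elim: k f => [f []//|k IH f [cf df]]; split=> // i.
by have [d1 d2] := df i; split=> //; apply: IH.
Qed.

Lemma CkD k f g : Ck k f -> Ck k g -> Ck k (fun x => f x + g x).
Proof.
elim: k f g => [f g cf cg x|k IH f g [cf df] [cg dg]].
  exact: (continuousD (cf x) (cg x)).
split=> [x|i]; first exact: (continuousD (cf x) (cg x)).
have [df1 df2] := df i; have [dg1 dg2] := dg i; split=> [x|].
  exact: (derivableD (df1 x) (dg1 x)).
rewrite (_ : 'D_(basis_vec i) _ = (fun x => 'D_(basis_vec i) f x + 'D_(basis_vec i) g x)).
  exact: IH.
by apply/funext => x; rewrite -deriveD.
Qed.

Lemma CkM k f g : Ck k f -> Ck k g -> Ck k (fun x => f x * g x).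
Proof.
elim: k f g => [f g cf cg x|k IH f g Cf Cg].
  exact: (continuousM (cf x) (cg x)).
have [cf df] := Cf; have [cg dg] := Cg.
split=> [x|i]; first exact: (continuousM (cf x) (cg x)).
have [df1 df2] := df i; have [dg1 dg2] := dg i; split=> [x|].
  exact: (derivableM (df1 x) (dg1 x)).
rewrite (_ : 'D_(basis_vec i) _ = (fun x => f x * 'D_(basis_vec i) g x +
    g x * 'D_(basis_vec i) f x)).
  apply: CkD.
    by apply: IH; [exact: CkW Cf|].
  by apply: IH; [exact: CkW Cg|].
by apply/funext => x; rewrite -deriveM.
Qed.

Lemma Ck_cst k (c : R) : Ck k (fun _ : 'rV[R]_N => c).
Proof.
elim: k c => [c x|k IH c]; first exact: cst_continuous.
split=> [x|i]; first exact: cst_continuous.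
split=> [x|]; first exact: derivable_cst.
rewrite (_ : 'D_(basis_vec i) _ = fun=> 0); first exact: IH.
by apply/funext => x; rewrite derive_cst.
Qed.

Lemma is_derive_coord (i : 'I_N) (x v : 'rV[R]_N) :
  is_derive x v (fun y : 'rV[R]_N => y 0 i) (v 0 i).
Proof.
apply: DeriveDef; first exact/diff_derivable/differentiable_coord.
apply: cvg_lim => //; apply: (@cvg_trans _ ((fun=> v 0 i) @ (0 : R)^')); last exact: cvg_cst.
apply: near_eq_cvg; near=> h.
rewrite /= mxE mxE addrK /GRing.scale /= mulrA mulVf ?mul1r//.
by near: h; exact: nbhs_dnbhs_neq.
Unshelve. all: by end_near. Qed.

Lemma smooth_coord (i : 'I_N) : smooth (fun x : 'rV[R]_N => x 0 i).
Proof.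
case=> [|k]; first exact: coord_continuous.
split=> [|j]; first exact: coord_continuous.
split=> [x|]; first by case: (is_derive_coord i x (basis_vec j)).
rewrite (_ : 'D_(basis_vec j) _ = fun=> basis_vec j 0 i); first exact: Ck_cst.
by apply/funext => x; rewrite (@derive_val _ _ _ _ _ _ _ (is_derive_coord i x _)).
Qed.

Lemma smoothD f g : smooth f -> smooth g -> smooth (fun x => f x + g x).
Proof. by move=> sf sg k; apply: CkD. Qed.

Lemma smoothM f g : smooth f -> smooth g -> smooth (fun x => f x * g x).
Proof. by move=> sf sg k; apply: CkM. Qed.

Lemma smooth_cst (c : R) : smooth (fun=> c).
Proof. by move=> k; exact: Ck_cst. Qed.

Lemma smoothZ (c : R) f : smooth f -> smooth (fun x => c * f x).
Proof. by move=> sf; apply: smoothM => //; exact: smooth_cst. Qed.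

Lemma smooth_sum I (s : seq I) (F : I -> 'rV[R]_N -> R) :
  (forall i, smooth (F i)) -> smooth (fun x => \sum_(i <- s) F i x).
Proof.
move=> sF; elim: s => [|a s IH].
  rewrite (_ : (fun x => _) = fun=> 0); first exact: smooth_cst.
  by apply/funext => x; rewrite big_nil.
rewrite (_ : (fun x => _) = fun x => F a x + \sum_(i <- s) F i x).
  exact: smoothD.
by apply/funext => x; rewrite big_cons.
Qed.

Lemma smooth_dotr_self : smooth (fun x : 'rV[R]_N => dotr x x).
Proof. by apply: smooth_sum => i; apply: smoothM; exact: smooth_coord. Qed.

Lemma smooth_derivable f i : smooth f -> forall x, derivable f x (basis_vec i).
Proof. by move=> /(_ 1%N) [_ /(_ i)[]]. Qed.

Lemma smooth_derive f i : smooth f -> smooth (fun x => 'D_(basis_vec i) f x).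
Proof. by move=> sf k; case: (sf k.+1) => _ /(_ i)[]. Qed.

Lemma smooth_continuous f : smooth f -> continuous f.
Proof. by move=> /(_ 0%N). Qed.

(** Reduces directional derivatives to derivatives in one real variable, where the chain rule is
    available. *)
Lemma is_derive_line f (x v : 'rV[R]_N) (t d : R) :
  is_derive (t *: v + x) v f d <->
  is_derive t (1 : R) (fun s : R => f (s *: v + x)) d.
Proof.
rewrite (_ : is_derive t 1 _ d <-> derivable (fun s : R => f (s *: v + x)) t 1 /\ 'D_1 (fun s : R => f (s *: v + x)) t = d); last first.
  by split=> [[]//|[]]; exact: DeriveDef.
rewrite (_ : is_derive _ v f d <-> derivable f (t *: v + x) v /\ 'D_v f (t *: v + x) = d); last first.
  by split=> [[]//|[]]; exact: DeriveDef.
rewrite /derivable /derive.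
rewrite (_ : (fun h => _) = (fun h => h^-1 *: (((fun s : R => f (s *: v + x)) \o shift t) (h *: 1) - f (t *: v + x)))) //.
apply/funext => h /=; congr (_ *: (f _ - _)).
by rewrite addrA -scalerDl /GRing.scale/= mulr1.
Qed.

Lemma is_derive_comp_real (h : R -> R) p (x v : 'rV[R]_N) (a b : R) :
  is_derive (p x) (1 : R) h a -> is_derive x v p b ->
  is_derive x v (fun y => h (p y)) (a * b).
Proof.
move=> hh hp; have -> : x = 0 *: v + x by rewrite scale0r add0r.
apply/is_derive_line.
have E : (fun s : R => p (s *: v + x)) 0 = p x by rewrite scale0r add0r.
have := @is_derive1_comp _ h (fun s : R => p (s *: v + x)) 0 a b.
rewrite /= E; apply=> //.
by apply/is_derive_line; rewrite scale0r add0r.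
Qed.

(** The whole sequence of derivatives is given as data: the derivative of [F n] composed with [p] is
    [F n.+1] composed with [p] times a smooth factor, so that the induction in [smooth_comp] treats
    all [n] at once. *)
Definition smooth1 (h : R -> R) := exists F : nat -> R -> R,
  F 0%N = h /\ forall n (x : R), is_derive x (1 : R) (F n) (F n.+1 x).

Lemma smooth_comp (h : R -> R) p :
  smooth1 h -> smooth p -> smooth (fun x => h (p x)).
Proof.
move=> [F [<- dF]] sp.
have cF n : continuous (F n).
  move=> x; apply/differentiable_continuous/derivable1_diffP.
  by case: (dF n x).
have cFp n : continuous (fun x => F n (p x)).
  move=> x; apply: (@continuous_comp _ _ _ p (F n) x); last exact: cF.
  by have := smooth_continuous sp; exact.
suff H k n : Ck k (fun x => F n (p x)) by move=> k; exact: (H k 0%N).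
elim: k n => [n|k IH n]; first exact: cFp.
have D i (x : 'rV[R]_N) : is_derive x (basis_vec i) (fun y => F n (p y))
    (F n.+1 (p x) * 'D_(basis_vec i) p x).
  by apply: (@is_derive_comp_real (F n) p); exact/derivableP/smooth_derivable.
split=> [x|i]; first exact: cFp.
split=> [x|]; first by case: (D i x).
rewrite (_ : 'D_(basis_vec i) _ = (fun x => F n.+1 (p x) * 'D_(basis_vec i) p x)).
  by apply: CkM; [exact: IH|exact: smooth_derive].
by apply/funext => x; case: (D i x).
Qed.

Lemma smooth1_expR : smooth1 (@expR R).
Proof. by exists (fun=> @expR R); split=> // n x; exact: is_derive_expR. Qed.

Lemma smooth_expR p : smooth p -> smooth (fun x => expR (p x)).
Proof. by apply: smooth_comp; exact: smooth1_expR. Qed.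

Lemma is_derive_shiftv f (v x z : 'rV[R]_N) :
  derivable f (x + z) v -> is_derive x v (fun y => f (y + z)) ('D_v f (x + z)).
Proof.
move=> df.
have H : is_derive (0 : R) (1 : R) (fun s : R => f (s *: v + x + z)) ('D_v f (x + z)).
  rewrite (_ : (fun s : R => _) = (fun s : R => f (s *: v + (x + z)))).
    by apply/(is_derive_line f (x + z) v 0); rewrite scale0r add0r; exact/derivableP.
  by apply/funext => s; rewrite addrA.
have := (is_derive_line (fun y => f (y + z)) x v 0 ('D_v f (x + z))).2 H.
by rewrite scale0r add0r.
Qed.

Lemma Ck_shift k f (z : 'rV[R]_N) : Ck k f -> Ck k (fun x => f (x + z)).
Proof.
have cs (g : 'rV[R]_N -> R) : continuous g ->
    continuous (fun x : 'rV[R]_N => g (x + z)).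
  move=> cg x; apply: (@continuous_comp _ _ _ (fun y : 'rV[R]_N => y + z) g); last exact: cg.
  exact: (@cvgD R 'rV[R]_N 'rV[R]_N (nbhs x) _ id (fun=> z) x z cvg_id (cvg_cst z)).
elim: k f => [f|k IH f [cf df]]; first exact: cs.
have D i (x : 'rV[R]_N) : is_derive x (basis_vec i) (fun y => f (y + z))
    ('D_(basis_vec i) f (x + z)).
  by apply: is_derive_shiftv; case: (df i).
split=> [|i]; first exact: cs.
split=> [x|]; first by case: (D i x).
rewrite (_ : 'D_(basis_vec i) _ = (fun x => 'D_(basis_vec i) f (x + z))).
  by apply: (IH ('D_(basis_vec i) f)); case: (df i).
by apply/funext => x; case: (D i x).
Qed.

Lemma derive_shiftv f i (x z : 'rV[R]_N) : smooth f ->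
  'D_(basis_vec i) (fun y => f (y + z)) x = 'D_(basis_vec i) f (x + z).
Proof.
move=> sf.
have df : derivable f (x + z) (basis_vec i) by exact: smooth_derivable.
by case: (is_derive_shiftv df).
Qed.

End smooth.

(** * Test functions *)

Section flat.
Context {R : realType}.
Implicit Types (p : {poly R}) (x : R).

Lemma exprn_expRN_le (n : nat) x : 0 <= x -> x ^+ n * expR (- x) <= n`!%:R.
Proof.
move=> x0; rewrite expRN ler_pdivrMr ?expR_gt0//.
case: n => [|n]; first by rewrite expr0 fact0 mul1r -expR0 ler_expR.
rewrite -ler_pdivrMl ?ltr0n ?fact_gt0// mulrC.
by apply: le_trans (expR_ge1Dxn n x0); rewrite lerDr.
Qed.

Lemma horner_expRN_bounded p :
  exists2 C, 0 < C & forall x, 0 <= x -> `|p.[x]| * expR (- x) <= C.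
Proof.
exists (1 + \sum_(i < size p) `|p`_i| * i`!%:R) => [|x x0].
  by rewrite ltr_pwDl// sumr_ge0// => i _; rewrite mulr_ge0.
rewrite horner_coef ler_wpDl//.
apply: (@le_trans _ _ ((\sum_(i < size p) `|p`_i| * x ^+ i) * expR (- x))).
  rewrite ler_wpM2r ?expR_ge0// (le_trans (ler_norm_sum _ _ _))//.
  by apply: ler_sum => i _; rewrite normrM (ger0_norm (exprn_ge0 _ x0)).
rewrite mulr_suml; apply: ler_sum => i _.
by rewrite -mulrA ler_wpM2l// exprn_expRN_le.
Qed.

(* The derivatives of [exp (- 1 / x)] extended by [0] to [x <= 0] all have this form. *)
Definition flat p x := if 0 < x then p.[x^-1] * expR (- x^-1) else 0.

(** For [x > 0] this is the chain rule for [y = 1 / x], whose derivative is [- y^2]. At 0 the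
    boundedness of [y^2 p(y) exp (- y)] on [y >= 0] gives [|flat p x| <= C x^2], so the difference
    quotient tends to 0. *)
Lemma is_derive_flat p x :
  is_derive x (1 : R) (flat p) (flat ('X^2 * (p - p^`())) x).
Proof.
have [x0|x0|->] := ltgtP x 0.
- rewrite {2}/flat (lt_gtF x0).
  apply: (@near_eq_is_derive _ _ _ (cst 0)).
  by near=> y; rewrite /flat/= ltNge ltW//=; near: y; exact: lt_nbhsl.
- rewrite {2}/flat x0.
  apply: (@near_eq_is_derive R R R (fun y : R => p.[y^-1] * expR (- y^-1))).
    by near=> y; rewrite /flat; have -> : 0 < y by near: y; exact: lt_nbhsr.
  have dV : is_derive x (1 : R) (fun y : R => y^-1) (- x^-2).
    have := @is_deriveV R id x 1 1 (lt0r_neq0 x0) (is_derive_id _ _).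
    by move=> H; apply: is_derive_eq; rewrite /GRing.scale/= mulr1.
  have d1 := @is_derive1_comp _ (horner p) (fun y : R => y^-1) x _ _
    (is_derive_poly p x^-1) dV.
  have d2 : is_derive x (1 : R) (fun y : R => expR (- y^-1)) (expR (- x^-1) * x^-2).
    have dN : is_derive x (1 : R) (fun y : R => - y^-1) (x^-2).
      by apply: is_derive_eq (is_deriveN dV) _; rewrite opprK.
    exact: (@is_derive1_comp _ (@expR R) (fun y : R => - y^-1) x _ _ _ dN).
  apply: is_derive_eq (is_deriveM d1 d2) _.
  rewrite /GRing.scale/= !hornerE /=; field.
  by rewrite gt_eqF.
- have [C C0 HC] := horner_expRN_bounded ('X^2 * p).
  have Fle y : `|flat p y| <= C * y ^+ 2.
    rewrite /flat; case: ifPn => y0; last by rewrite normr0 mulr_ge0 ?sqr_ge0// ltW.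
    have yV : 0 <= y^-1 by rewrite invr_ge0 ltW.
    rewrite normrM (ger0_norm (expR_ge0 _)).
    have E : `|('X^2 * p).[y^-1]| = (y ^+ 2)^-1 * `|p.[y^-1]|.
      by rewrite !hornerE normrM ger0_norm ?exprn_ge0// exprVn.
    rewrite [leRHS]mulrC -ler_pdivrMl ?exprn_gt0// mulrA -E.
    exact: HC.
  rewrite {2}/flat ltxx.
  have H : (fun h : R => h^-1 *: ((flat p \o shift 0) (h *: (1 : R)) - flat p 0)) @ 0^' --> 0.
    apply/cvgrPdist_lt => e e0; near=> h.
    have h0 : h != 0 by near: h; exact: nbhs_dnbhs_neq.
    rewrite /= /flat ltxx subr0 sub0r normrN addr0 [h *: 1]mulr1 -/(flat p h).
    rewrite normrM normfV ltr_pdivrMl ?normr_gt0//.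
    apply: (le_lt_trans (Fle h)).
    rewrite -(@real_normK _ h) ?num_real// expr2 mulrCA ltr_pM2l ?normr_gt0//.
    rewrite -ltr_pdivlMl//.
    near: h; apply: (@dnbhs0_lt _ _ (C^-1 * e)).
    by rewrite mulr_gt0 ?invr_gt0.
  by apply: DeriveDef; [apply/cvg_ex; exists 0|exact: cvg_lim].
Unshelve. all: by end_near. Qed.

Lemma smooth1_flat p : smooth1 (flat p).
Proof.
exists (fun n => flat (iter n (fun q => 'X^2 * (q - q^`())) p)).
by split=> // n x; exact: is_derive_flat.
Qed.

Definition flat1 : R -> R := flat 1.

Lemma smooth1_flat1 : smooth1 flat1. Proof. exact: smooth1_flat. Qed.

Lemma flat1E x : flat1 x = if 0 < x then expR (- x^-1) else 0.
Proof. by rewrite /flat1 /flat hornerE mul1r. Qed.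

Lemma flat1_gt0 x : (0 < flat1 x) = (0 < x).
Proof. by rewrite flat1E; case: ifPn => //; rewrite ?expR_gt0// ltxx. Qed.

Lemma flat1_ge0 x : 0 <= flat1 x.
Proof. by rewrite flat1E; case: ifPn => // _; rewrite expR_ge0. Qed.

Lemma is_derive_flat1 x : is_derive x (1 : R) flat1 (flat ('X^2) x).
Proof.
have := is_derive_flat 1 x.
by rewrite derivC subr0 mulr1.
Qed.

Lemma flatX2_bounded : exists2 C, 0 < C & forall x, `|flat ('X^2) x| <= C.
Proof.
have [C C0 HC] := horner_expRN_bounded 'X^2.
exists C => // x; rewrite /flat; case: ifPn => [x0|]; last by rewrite normr0 ltW.
by rewrite normrM (ger0_norm (expR_ge0 _)) HC// invr_ge0 ltW.
Qed.

End flat.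

Section test_functions.
Context {R : realType} (N : nat).
Implicit Types (f g p : 'rV[R]_N -> R) (x : 'rV[R]_N).

Definition boxM (M : R) : set 'rV[R]_N := [set x | forall i, `|x 0 i| <= M].

Lemma compact_boxM M : compact (boxM M).
Proof.
rewrite (_ : boxM M = [set v | forall i, `[- M, M]%classic (v ord0 i)]).
  by apply: (@rV_compact _  _ (fun=> `[- M, M]%classic)) => _; exact: segment_compact.
by apply/seteqP; split=> x /= H i; have := H i; rewrite ler_norml in_itv/=.
Qed.

Lemma compact_sub_boxM (K : set 'rV[R]_N) : compact K ->
  exists2 M, 0 < M & K `<=` boxM M.
Proof.
move=> /compact_bounded[M [Mreal HM]].
exists (`|M| + 1) => [|x Kx i]; first by rewrite ltr_wpDl.
have H : `|x| <= `|M| + 1 by apply: HM => //; rewrite (le_lt_trans (ler_norm M))// ltrDl.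
apply: le_trans H.
rewrite [leRHS]/Num.norm /= mx_normrE; apply/bigmax_geP; right => /=.
by exists (0, i).
Qed.

Definition supported_in (M : R) f := forall x, f x != 0 -> boxM M x.

Lemma test_functionP f :
  test_function f <-> smooth f /\ exists2 M, 0 < M & supported_in M f.
Proof.
split=> [[sf /compact_sub_boxM[M M0 HM]]|[sf [M M0 HM]]].
  by split=> //; exists M => // x fx; apply/HM/subset_closure.
split=> //; apply: (@subclosed_compact _ _ (boxM M)).
- exact: closed_closure.
- exact: compact_boxM.
- have cl : closed (boxM M) by apply: compact_closed; [exact: norm_hausdorff|exact: compact_boxM].
  by rewrite (closure_id (boxM M)).1//; apply: closure_subset => x /= fx; exact: HM.
Qed.

Lemma test_smooth f : test_function f -> smooth f.
Proof. by move=> /test_functionP[]. Qed.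

Lemma test_continuous f : test_function f -> continuous f.
Proof. by move=> /test_smooth/smooth_continuous. Qed.

Lemma test_dominated f g : test_function f -> smooth g ->
  (forall x, f x = 0 -> g x = 0) -> test_function g.
Proof.
move=> /test_functionP[sf [M M0 HM]] sg fg.
apply/test_functionP; split=> //; exists M => // x gx; apply: HM.
by apply: contra_neq gx => /fg.
Qed.

Lemma testMr f g : test_function f -> smooth g -> test_function (fun x => f x * g x).
Proof.
move=> tf sg; apply: (test_dominated tf) => [|x ->]; last by rewrite mul0r.
by apply: smoothM => //; exact: test_smooth.
Qed.

Lemma testZ c f : test_function f -> test_function (fun x => c * f x).
Proof.
move=> tf; apply: (test_dominated tf) => [|x ->]; last by rewrite mulr0.
by apply: smoothZ => //; exact: test_smooth.
Qed.

Lemma testD f g : test_function f -> test_function g ->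
  test_function (fun x => f x + g x).
Proof.
move=> /test_functionP[sf [M M0 HM]] /test_functionP[sg [L L0 HL]].
apply/test_functionP; split; first exact: smoothD.
exists (M + L) => [|x]; first by rewrite addr_gt0.
have [fx|fx _ i] := eqVneq (f x) 0.
  rewrite fx add0r => /HL H i; apply: le_trans (H i) _.
  by rewrite lerDr ltW.
by apply: le_trans (HM _ fx i) _; rewrite lerDl ltW.
Qed.

Lemma test_shift f z : test_function f -> test_function (fun x => f (x + z)).
Proof.
move=> /test_functionP[sf [M M0 HM]]; apply/test_functionP; split.
  by move=> k; exact: Ck_shift.
have [L L0 HL] : exists2 L, 0 < L & boxM L z.
  by have [L L0 HL] := compact_sub_boxM (@compact_set1 _ z); exists L => //; exact: HL.
exists (M + L) => [|x /HM H i]; first by rewrite addr_gt0.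
have -> : x 0 i = (x + z) 0 i - z 0 i by rewrite mxE addrK.
by rewrite (le_trans (ler_normB _ _))// lerD.
Qed.

(** The complement of a closed box is open, so [f] vanishes near each of its points and the
    derivative has its support in the same box. *)
Lemma test_derive f i : test_function f ->
  test_function (fun x => 'D_(basis_vec i) f x).
Proof.
move=> /test_functionP[sf [M M0 HM]]; apply/test_functionP; split.
  exact: smooth_derive.
exists M => // x Dx j; rewrite leNgt; apply/negP => xj.
move/eqP : Dx; apply.
rewrite -[RHS](derive_cst (0 : R) x (basis_vec i)).
apply: near_eq_derive.
have : \forall y \near x, M < `|(y : 'rV[R]_N) 0 j|.
  have : {for x, continuous (fun y : 'rV[R]_N => `|y 0 j|)}.
    apply: (@continuous_comp _ _ _ (fun y : 'rV[R]_N => y 0 j) (fun t : R => `|t|)).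
      exact: coord_continuous.
    exact: norm_continuous.
  by move=> /cvgr_gt; apply.
apply: filterS => y yj; apply/eqP; apply: contraTT yj => /HM/(_ j).
by rewrite -leNgt.
Qed.

Lemma continuous_bounded_boxM f M : continuous f ->
  exists2 B, 0 < B & forall x, boxM M x -> `|f x| <= B.
Proof.
move=> cf.
have : compact (f @` boxM M).
  by apply: continuous_compact; [exact: continuous_subspaceT|exact: compact_boxM].
move=> /compact_bounded[B [Breal HB]].
exists (`|B| + 1) => [|x Mx]; first by rewrite ltr_wpDl.
apply: HB; last by exists x.
by rewrite (le_lt_trans (ler_norm B))// ltrDl.
Qed.

Lemma test_bounded f : test_function f ->
  exists2 B, 0 < B & forall x, `|f x| <= B.
Proof.
move=> /test_functionP[sf [M M0 HM]].
have [B B0 HB] := continuous_bounded_boxM M (smooth_continuous sf).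
exists B => // x; have [->|/HM/HB//] := eqVneq (f x) 0.
by rewrite normr0 ltW.
Qed.

(** Positive exactly in the ball of Euclidean radius [r^(-1/2)]; the squared norm keeps it smooth at
    the origin. *)
Definition ballbump (r : R) x := flat1 (1 - r * dotr x x).

Lemma dotr_ge0 x : 0 <= dotr x x.
Proof. by apply: sumr_ge0 => i _; rewrite -expr2 sqr_ge0. Qed.

Lemma coord_dotr_le x i : x 0 i ^+ 2 <= dotr x x.
Proof.
rewrite /dotr (bigD1 i)//= -expr2 lerDl sumr_ge0// => j _.
by rewrite -expr2 sqr_ge0.
Qed.

Lemma smooth_bump r : smooth (ballbump r).
Proof.
apply: smooth_comp; first exact: smooth1_flat1.
rewrite (_ : (fun x => _) = (fun x => 1 + (- r) * dotr x x)).
  by apply: smoothD; [exact: smooth_cst|apply: smoothZ; exact: smooth_dotr_self].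
by apply/funext => x; rewrite mulNr.
Qed.

Lemma bump_gt0 r x : (0 < ballbump r x) = (r * dotr x x < 1).
Proof. by rewrite /ballbump flat1_gt0 subr_gt0. Qed.

Lemma test_bump r : 0 < r -> test_function (ballbump r).
Proof.
move=> r0; apply/test_functionP; split; first exact: smooth_bump.
exists (1 + r^-1) => [|x fx i]; first by rewrite addr_gt0// invr_gt0.
have := bump_gt0 r x; rewrite lt_neqAle eq_sym fx flat1_ge0 => /esym.
rewrite -ltr_pdivlMl// mulr1 => H.
have := le_lt_trans (coord_dotr_le x i) H.
have : 0 < r^-1 by rewrite invr_gt0.
move: (r^-1) (x 0 i) => s y s0 ys.
by rewrite ler_norml; apply/andP; split; nra.
Qed.

(** As [c] grows these test functions tend to the indicator of [B > 0] when [B >= 0], without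
    enlarging the support. *)
Lemma test_saturate B c : test_function B -> test_function (fun x => 1 - expR (- (c * B x))).
Proof.
move=> tB; apply: (test_dominated tB) => [|x ->]; last first.
  by rewrite mulr0 oppr0 expR0 subrr.
rewrite (_ : (fun x => _) = (fun x => 1 + (- 1) * expR ((- c) * B x))).
  apply: smoothD; first exact: smooth_cst.
  by apply/smoothZ/smooth_expR/smoothZ; exact: test_smooth.
by apply/funext => x; rewrite mulN1r mulNr.
Qed.

End test_functions.
Arguments ballbump {R N} r x.
Arguments boxM {R N} M.

(** * Integrable and square-integrable functions *)

Section integrals.
Context d (T : measurableType d) (R : realType) (mu : {measure set T -> \bar R}).
Implicit Types (f g h : T -> R).

Local Notation L1 f := (mu.-integrable [set: T] (EFin \o f)).

Lemma eq_L1 f g : f =1 g -> L1 f -> L1 g.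
Proof. by move=> /funext ->. Qed.

Lemma L1_meas f : L1 f -> measurable_fun setT f.
Proof. by move=> /integrableP[/measurable_EFinP]. Qed.

Lemma L1_le f g : measurable_fun setT f -> L1 g -> (forall x, `|f x| <= g x) -> L1 f.
Proof.
move=> mf ig fg; apply: (le_integrable measurableT) ig; first exact/measurable_EFinP.
by move=> x _; rewrite /= lee_fin (le_trans (fg x))// ler_norm.
Qed.

Lemma L1_norm f : L1 f -> L1 (fun x => `|f x|).
Proof. by move=> /integrable_norm; apply. Qed.

Lemma L1D f g : L1 f -> L1 g -> L1 (fun x => f x + g x).
Proof. by move=> If Ig; have := integrableD measurableT If Ig; apply: eq_integrable. Qed.

Lemma L1N f : L1 f -> L1 (fun x => - f x).
Proof. by move=> If; have := integrableN If; apply: eq_integrable. Qed.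

Lemma L1B f g : L1 f -> L1 g -> L1 (fun x => f x - g x).
Proof. by move=> If Ig; apply: L1D => //; exact: L1N. Qed.

Lemma L1Z c f : L1 f -> L1 (fun x => c * f x).
Proof. by move=> If; have := integrableZl measurableT c If; apply: eq_integrable. Qed.

Lemma L1Zr c f : L1 f -> L1 (fun x => f x * c).
Proof. by move=> /(L1Z c); apply: eq_integrable => // x _ /=; rewrite mulrC. Qed.

Lemma L1_0 : L1 (fun=> 0).
Proof. exact: integrable0. Qed.

Lemma L1_sum I (s : seq I) (F : I -> T -> R) :
  (forall i, L1 (F i)) -> L1 (fun x => \sum_(i <- s) F i x).
Proof.
move=> IF; elim: s => [|a s IH].
  by apply: (eq_L1 _ L1_0) => x; rewrite big_nil.
by apply: (eq_L1 _ (L1D (IF a) IH)) => x; rewrite big_cons.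
Qed.

Lemma L1_ge0P f : measurable_fun setT f -> (forall x, 0 <= f x) ->
  (\int[mu]_x (f x)%:E < +oo)%E <-> L1 f.
Proof.
move=> mf f0; split=> [H|/integrableP[_]].
  apply/integrableP; split; first exact/measurable_EFinP.
  by under eq_integral => x _ do rewrite /= ger0_norm//.
by under eq_integral => x _ do rewrite /= ger0_norm//.
Qed.

Lemma EFin_Rint f : L1 f -> (\int[mu]_x f x)%:E = (\int[mu]_x (f x)%:E)%E.
Proof. by move=> If; rewrite fineK//; exact: integrable_fin_num. Qed.

Lemma eq_Rint f g : f =1 g -> \int[mu]_x f x = \int[mu]_x g x.
Proof. by move=> /funext ->. Qed.

Lemma RintD f g : L1 f -> L1 g ->
  \int[mu]_x (f x + g x) = \int[mu]_x f x + \int[mu]_x g x.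
Proof. by move=> If Ig; rewrite RintegralD. Qed.

Lemma RintB f g : L1 f -> L1 g ->
  \int[mu]_x (f x - g x) = \int[mu]_x f x - \int[mu]_x g x.
Proof. by move=> If Ig; rewrite RintegralB. Qed.

Lemma RintZ c f : L1 f -> \int[mu]_x (c * f x) = c * \int[mu]_x f x.
Proof. by move=> If; rewrite RintegralZl. Qed.

Lemma RintZr c f : L1 f -> \int[mu]_x (f x * c) = \int[mu]_x f x * c.
Proof. by move=> If; rewrite RintegralZr. Qed.

Lemma RintN f : L1 f -> \int[mu]_x (- f x) = - \int[mu]_x f x.
Proof.
move=> If; rewrite -mulN1r -RintZ//; apply: eq_Rint => x.
by rewrite mulN1r.
Qed.

Lemma Rint_zero : \int[mu]_x (0 : R) = 0.
Proof. by rewrite /Rintegral integral0. Qed.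

Lemma Rint_sum I (s : seq I) (F : I -> T -> R) : (forall i, L1 (F i)) ->
  \int[mu]_x (\sum_(i <- s) F i x) = \sum_(i <- s) \int[mu]_x F i x.
Proof.
move=> IF; elim: s => [|a s IH].
  by rewrite big_nil -[RHS]Rint_zero; apply: eq_Rint => x; rewrite big_nil.
rewrite big_cons -IH -RintD//; last exact: L1_sum.
by apply: eq_Rint => x; rewrite big_cons.
Qed.

Lemma Rint_le f g : L1 f -> L1 g -> (forall x, f x <= g x) ->
  \int[mu]_x f x <= \int[mu]_x g x.
Proof. by move=> If Ig fg; apply: le_Rintegral. Qed.

Lemma Rint_ge0 f : (forall x, 0 <= f x) -> 0 <= \int[mu]_x f x.
Proof. by move=> f0; apply: Rintegral_ge0 => x _. Qed.

Lemma Rint_norm f : L1 f -> `|\int[mu]_x f x| <= \int[mu]_x `|f x|.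
Proof. by move=> If; exact: le_normr_Rintegral. Qed.

Lemma Rint_dct (F : nat -> T -> R) f g :
  (forall n, measurable_fun setT (F n)) -> measurable_fun setT f ->
  (forall x, F ^~ x @ \oo --> f x) -> L1 g ->
  (forall n x, `|F n x| <= g x) ->
  L1 f /\ (fun n => \int[mu]_x F n x) @ \oo --> \int[mu]_x f x.
Proof.
move=> mF mf Ff ig Fg.
have EF x : (fun n => (F n x)%:E) @ \oo --> (f x)%:E.
  by apply: cvg_EFin; [exact: nearW|exact: Ff].
have [If _ H] := @dominated_convergence d T R mu setT measurableT
  (fun n => EFin \o F n) (EFin \o f) (EFin \o g)
  (fun n => (measurable_EFinP _ _).2 (mF n)) ((measurable_EFinP _ _).2 mf)
  (aeW _ (fun x _ => EF x)) ig
  (aeW _ (fun x n _ => Fg n x)).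
split=> //; apply: fine_cvg; rewrite EFin_Rint//.
Qed.

Lemma L1_ae f g : measurable_fun setT g -> L1 f ->
  {ae mu, forall x, f x = g x} -> L1 g.
Proof.
move=> mg If fg.
have [mf fi] := integrableP _ _ _ If.
apply/integrableP; split; first exact/measurable_EFinP.
rewrite (_ : (\int[mu]_x _ = \int[mu]_x `|(EFin \o f) x|)%E)//.
apply: ae_eq_integral => //.
- by apply: measurableT_comp => //; exact/measurable_EFinP.
- by apply: measurableT_comp.
- by apply: filterS fg => x /= -> .
Qed.

Lemma Rint_ae f g : measurable_fun setT f -> measurable_fun setT g ->
  {ae mu, forall x, f x = g x} -> \int[mu]_x f x = \int[mu]_x g x.
Proof.
move=> mf mg fg; rewrite /Rintegral (@ae_eq_integral _ _ _ mu setT (EFin \o g))//.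
- exact/measurable_EFinP.
- exact/measurable_EFinP.
- by apply: filterS fg => x /= -> .
Qed.

Lemma Rint_eq0_ae f : L1 f -> (forall x, 0 <= f x) -> \int[mu]_x f x = 0 ->
  {ae mu, forall x, f x = 0}.
Proof.
move=> If f0 H.
have mE : measurable_fun setT (EFin \o f) by exact/measurable_EFinP/L1_meas.
have [+ _] := ae_eq_integral_abs mu measurableT mE.
have -> : (\int[mu]_x `|(EFin \o f) x| = 0)%E.
  under eq_integral => x _ do rewrite /= ger0_norm//.
  by rewrite -EFin_Rint// H.
by move=> /(_ erefl); apply: filterS => x /(_ I) /= [].
Qed.

Definition L2 f := measurable_fun setT f /\ L1 (fun x => f x ^+ 2).

Lemma L2_meas f : L2 f -> measurable_fun setT f.
Proof. by case. Qed.

Lemma L2_sq f : L2 f -> L1 (fun x => f x ^+ 2).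
Proof. by case. Qed.

Lemma eq_L2 f g : f =1 g -> L2 f -> L2 g.
Proof. by move=> /funext ->. Qed.

Lemma L2M f g : L2 f -> L2 g -> L1 (fun x => f x * g x).
Proof.
move=> [mf If] [mg Ig]; apply: (L1_le _ (L1D If Ig)); first exact: measurable_funM.
move=> x /=; rewrite ler_norml; apply/andP; split; nra.
Qed.

Lemma L2_le f g : measurable_fun setT f -> L2 g -> (forall x, `|f x| <= `|g x|) -> L2 f.
Proof.
move=> mf [mg Ig] fg; split=> //; apply: (L1_le _ Ig); first exact: measurable_funX.
by move=> x; rewrite ger0_norm ?sqr_ge0// -[leLHS]real_normK ?num_real// -[leRHS]real_normK ?num_real// lerXn2r ?nnegrE.
Qed.

Lemma L2D f g : L2 f -> L2 g -> L2 (fun x => f x + g x).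
Proof.
move=> [mf If] [mg Ig]; split; first exact: measurable_funD.
apply: (L1_le _ (L1D (L1Z 2 If) (L1Z 2 Ig))).
  by apply: measurable_funX; exact: measurable_funD.
by move=> x; rewrite ger0_norm ?sqr_ge0//=; have := sqr_ge0 (f x - g x); nra.
Qed.

Lemma L2Z c f : L2 f -> L2 (fun x => c * f x).
Proof.
move=> [mf If]; split; first exact: measurable_funM.
by apply: (eq_L1 _ (L1Z (c ^+ 2) If)) => x; rewrite exprMn.
Qed.

Lemma L2N f : L2 f -> L2 (fun x => - f x).
Proof. by move=> /(L2Z (-1)); apply: eq_L2 => x; rewrite mulN1r. Qed.

Lemma L2B f g : L2 f -> L2 g -> L2 (fun x => f x - g x).
Proof. by move=> f2 g2; apply: L2D => //; exact: L2N. Qed.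

Lemma L2_0 : L2 (fun=> 0).
Proof. by split=> //; apply: (eq_L1 _ L1_0) => x; rewrite expr0n. Qed.

Lemma L2_sum I (s : seq I) (F : I -> T -> R) :
  (forall i, L2 (F i)) -> L2 (fun x => \sum_(i <- s) F i x).
Proof.
move=> IF; elim: s => [|a s IH].
  by apply: (eq_L2 _ L2_0) => x /=; rewrite big_nil.
by apply: (eq_L2 _ (L2D (IF a) IH)) => x /=; rewrite big_cons.
Qed.

Lemma L2_bounded_mul f (b : T -> R) (C : R) : L2 f -> measurable_fun setT b -> (forall x, `|b x| <= C) ->
  L2 (fun x => b x * f x).
Proof.
move=> f2 mb bC; apply: (L2_le _ (L2Z C f2)).
  by apply: measurable_funM => //; exact: L2_meas.
move=> x; rewrite !normrM ler_wpM2r//.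
by rewrite (le_trans (bC x))// ler_norm.
Qed.

Lemma L1_bounded_mul f (b : T -> R) (C : R) : L1 f -> measurable_fun setT b -> (forall x, `|b x| <= C) ->
  L1 (fun x => b x * f x).
Proof.
move=> f1 mb bC; apply: (L1_le _ (L1Z C (L1_norm f1))).
  by apply: measurable_funM => //; exact: L1_meas.
by move=> x; rewrite normrM ler_wpM2r.
Qed.

Lemma Rint_CS f g : L2 f -> L2 g ->
  (\int[mu]_x (f x * g x)) ^+ 2 <= (\int[mu]_x f x ^+ 2) * (\int[mu]_x g x ^+ 2).
Proof.
move=> f2 g2; have fg := L2M f2 g2.
set a := \int[mu]_x f x ^+ 2; set b := \int[mu]_x g x ^+ 2; set c := \int[mu]_x _.
have a0 : 0 <= a by apply: Rint_ge0 => x; exact: sqr_ge0.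
have b0 : 0 <= b by apply: Rint_ge0 => x; exact: sqr_ge0.
(* The integral of [(s f - t g)^2], as a quadratic form in [(s, t)]; the inequality is its value at
   [(c, a)]. *)
have H s t : 0 <= s ^+ 2 * a + t ^+ 2 * b - 2 * s * t * c.
  have -> : s ^+ 2 * a + t ^+ 2 * b - 2 * s * t * c =
      \int[mu]_x (s ^+ 2 * f x ^+ 2 + t ^+ 2 * g x ^+ 2 - 2 * s * t * (f x * g x)).
    have f3 := L1Z (s ^+ 2) (L2_sq f2); have g3 := L1Z (t ^+ 2) (L2_sq g2).
    rewrite RintB; [|exact: L1D|exact: L1Z].
    by rewrite RintD// !RintZ//; exact: L2_sq.
  apply: Rint_ge0 => x.
  rewrite [leRHS](_ : _ = (s * f x - t * g x) ^+ 2) ?sqr_ge0//; ring.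
(* If [a = 0] the form is affine in [s], and the choice [s = (b + 1) / c] would make it negative
   unless [c = 0]. *)
have [a00|a00] := eqVneq a 0.
  rewrite a00 mul0r; have [->|c0] := eqVneq c 0; first by rewrite expr0n.
  have := H ((b + 1) / c) 1; rewrite a00 mulr0 add0r expr1n mul1r mulr1.
  by rewrite mulrA divfK// subr_ge0; lra.
have := H c a.
have -> : c ^+ 2 * a + a ^+ 2 * b - 2 * c * a * c = a * (a * b - c ^+ 2) by ring.
by rewrite pmulr_rge0 ?subr_ge0// lt_neqAle eq_sym a00.
Qed.

End integrals.

(** * Integration against a measure given by a density *)

Section density.
Context d (T : measurableType d) (R : realType) (mu : {measure set T -> \bar R}).
Context (f : T -> R) (mf : measurable_fun setT f) (f0 : forall x, 0 <= f x).

Import HBNNSimple.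

(** The identity passes from indicators to simple functions by linearity and to nonnegative
    functions by monotone convergence. *)
Lemma ge0_integral_density (nu : {measure set T -> \bar R}) (g : T -> \bar R) :
  (forall A, measurable A -> nu A = \int[mu]_(x in A) (f x)%:E)%E ->
  measurable_fun setT g -> (forall x, 0 <= g x)%E ->
  (\int[nu]_x g x = \int[mu]_x (g x * (f x)%:E))%E.
Proof.
move=> nuE mg g0.
have mEf : measurable_fun setT (EFin \o f) by exact/measurable_EFinP.
have Hind (E : set T) : measurable E ->
    (\int[nu]_x (\1_E x)%:E = \int[mu]_x ((\1_E x)%:E * (f x)%:E))%E.
  move=> mE; rewrite integral_indic// setIT nuE// [LHS]integral_mkcond.
  apply: eq_integral => x _; rewrite patchE indicE.
  by case: ifPn => xE; rewrite ?mul1e ?mul0e.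
have Hnn (h : {nnsfun T >-> R}) :
    (\int[nu]_x (h x)%:E = \int[mu]_x ((h x)%:E * (f x)%:E))%E.
  under [LHS]eq_integral do rewrite fimfunE -fsumEFin//.
  rewrite [LHS]ge0_integral_fsum//; last 2 first.
    - by move=> r; exact/measurable_EFinP/measurableT_comp.
    - by move=> n x _; rewrite EFinM nnfun_muleindic_ge0.
  under [RHS]eq_integral.
    move=> x xD; rewrite fimfunE -fsumEFin// muleC ge0_mule_fsumr; last first.
      by move=> r; rewrite EFinM nnfun_muleindic_ge0.
    over.
  rewrite [RHS]ge0_integral_fsum//; last 2 first.
    - move=> r; apply: emeasurable_funM => //.
      by apply/measurable_EFinP; do 2 apply/measurableT_comp => //.
    - move=> r x _; rewrite mule_ge0 ?lee_fin//.
      by have := nnfun_muleindic_ge0 h r x; rewrite -EFinM lee_fin.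
  apply: eq_fsbigr => r _.
  under [RHS]eq_integral do rewrite EFinM muleCA.
  rewrite integralZl_indic_nnsfun//= Hind//.
  have [r0|r0] := leP 0%R r.
    rewrite -ge0_integralZl//; last 2 first.
    - apply: emeasurable_funM => //.
      by apply/measurable_EFinP/measurable_indic.
    - by move=> x _; rewrite mule_ge0// lee_fin.
    by apply: eq_integral => x _; rewrite [((f x)%:E * _)%E]muleC.
  (* A nonnegative simple function takes no negative value, so both sides vanish. *)
  rewrite preimage_nnfun0// [LHS](_ : _ = 0)%E; last first.
    by under eq_integral do rewrite indic0 mul0e; rewrite integral0 mule0.
  by under eq_integral do rewrite indic0 mule0 mule0; rewrite integral0.
pose h_ := nnsfun_approx measurableT mg.
have cvh x : (fun n => (h_ n x)%:E) @ \oo --> g x by exact: cvg_nnsfun_approx.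
have ndh x : {homo (fun n => (h_ n x)%:E) : m n / (m <= n)%N >-> (m <= n)%E}.
  by move=> m n mn; rewrite lee_fin; exact/lefP/nd_nnsfun_approx.
transitivity (limn (fun n => \int[nu]_x (h_ n x)%:E)%E).
  rewrite -monotone_convergence//=.
  - by apply: eq_integral => x _; apply/esym/cvg_lim => //.
  - by move=> n; exact/measurable_EFinP/measurable_funTS.
  - by move=> n x _; rewrite lee_fin.
transitivity (limn (fun n => \int[mu]_x ((h_ n x)%:E * (f x)%:E))%E).
  by apply: congr_lim; apply/funext => n; exact: Hnn.
rewrite -monotone_convergence//=.
- apply: eq_integral => x _; apply/cvg_lim => //.
  rewrite (_ : (fun n => _) = (fun n => (f x)%:E * (h_ n x)%:E)%E).
    by rewrite muleC; apply: cvgeZl.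
  by apply/funext => n; rewrite muleC.
- by move=> n; apply: emeasurable_funM => //; exact/measurable_EFinP/measurable_funTS.
- by move=> n x _; rewrite mule_ge0// lee_fin.
- by move=> x _ m n mn; rewrite lee_wpmul2r ?lee_fin//; exact/lefP/nd_nnsfun_approx.
Qed.

End density.

(** * Lebesgue measure on row vectors *)

Section row_measurable.
Context {R : realType} (N : nat).
Implicit Types (x y z : 'rV[R]_N).

Lemma measurable_row_ball x (r : R) : measurable [set y : 'rV[R]_N | forall i, `|x 0 i - y 0 i| < r].
Proof.
rewrite (_ : [set y | _] = \bigcap_(i in [set: 'I_N]) [set y : 'rV[R]_N | `|x 0 i - y 0 i| < r]).
  apply: fin_bigcap_measurable => [|i _]; first exact: finite_finset.
  have mf : measurable_fun setT (fun y : 'rV[R]_N => `|x 0 i - y 0 i|).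
    apply: measurableT_comp => //; apply: measurable_funB => //.
    exact: measurable_row_coord.
  have := mf measurableT `]-oo, r[%classic; rewrite setTI.
  rewrite (_ : _ @^-1` _ = [set y : 'rV[R]_N | `|x 0 i - y 0 i| < r]); first by apply.
  by apply/seteqP; split=> y /=; rewrite in_itv.
apply/seteqP; split=> y /= H; first by move=> i _; exact: H.
by move=> i; exact: H.
Qed.

(** An open set is the union of the boxes with rational centre and radius that it contains, and
    these are countably many. *)
Lemma measurable_row_open (U : set 'rV[R]_N) : open U -> measurable U.
Proof.
move=> oU.
pose B (q : 'rV[rat]_N * rat) := [set y : 'rV[R]_N | forall i, `|ratr (q.1 0 i) - y 0 i| < ratr q.2].
pose F n := if unpickle n is Some q then if `[< B q `<=` U >] then B q else set0 else set0.
have -> : U = \bigcup_n F n.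
  apply/seteqP; split=> [x Ux|x [n _]]; last first.
    by rewrite /F; case: unpickle => // q; case: ifPn => // /asboolP; apply.
  move: oU; rewrite openE => /(_ _ Ux) /nbhs_ballP[e /= e0 eU].
  (* A centre within [e / 4] of [x] and a radius between [e / 4] and [e / 2] give a box that
     contains [x] and stays in the ball of radius [e]. *)
  have e4 : e / 4 < e / 2 by lra.
  have [r /[!in_itv]/= /andP[r1 r2]] := rat_in_itvoo e4.
  have Hq i : exists q : rat, `|ratr q - x 0 i| < e / 4.
    have xe : x 0 i - e / 4 < x 0 i + e / 4 by lra.
    have [q /[!in_itv]/= /andP[q1 q2]] := rat_in_itvoo xe.
    by exists q; rewrite ltr_norml; apply/andP; split; lra.
  have [q Hq'] := choice Hq.
  exists (pickle (\row_i q i, r)) => //.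
  rewrite /F pickleK; case: ifPn => [_ i|/asboolP]; first by rewrite /= mxE (lt_trans (Hq' i)).
  move=> H; exfalso; apply: H => y By; apply: eU; split=> // j i; rewrite (ord1 j).
  rewrite -ball_normE /ball_ /=.
  have := By i; rewrite /= mxE => Byi.
  rewrite (le_lt_trans (ler_distD (ratr (q i)) _ _))//.
  by rewrite distrC; have := Hq' i; lra.
apply: bigcup_measurable => n _; rewrite /F; case: unpickle => // q.
case: ifPn => // _.
have := measurable_row_ball (\row_i ratr (q.1 0 i)) (ratr q.2).
by congr (measurable _); apply/seteqP; split=> y /= H i; have := H i; rewrite mxE.
Qed.

Lemma measurable_row_closed (U : set 'rV[R]_N) : closed U -> measurable U.
Proof.
by move=> cU; rewrite -(setCK U); apply: measurableC; apply: measurable_row_open; exact: closed_openC.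
Qed.

Lemma measurable_row_compact (U : set 'rV[R]_N) : compact U -> measurable U.
Proof.
move=> cU; apply: measurable_row_closed; exact: compact_closed (@norm_hausdorff _ _) cU.
Qed.

Lemma measurable_row_continuous (f : 'rV[R]_N -> R) :
  continuous f -> measurable_fun setT f.
Proof.
move=> /continuousP cf; apply: (measurability _ (RGenOpens.measurableE R)).
move=> _ [_ [a [b ->] <-]]; rewrite setTI; apply: measurable_row_open.
exact/cf/interval_open.
Qed.

Lemma measurable_row_shift z : measurable_fun setT (fun x : 'rV[R]_N => x + z).
Proof.
apply: measurable_fun_rowP => i; under eq_fun do rewrite mxE.
by apply: measurable_funD => //; exact: measurable_row_coord.
Qed.

Lemma measurable_row_add :
  measurable_fun setT (fun p : 'rV[R]_N * 'rV[R]_N => p.1 + p.2).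
Proof.
apply: measurable_fun_rowP => i; under eq_fun do rewrite mxE.
apply: measurable_funD.
  apply: (@measurableT_comp _ _ _ _ _ _ (fun x : 'rV[R]_N => x 0 i)) => //.
  exact: measurable_row_coord.
apply: (@measurableT_comp _ _ _ _ _ _ (fun x : 'rV[R]_N => x 0 i)) => //.
exact: measurable_row_coord.
Qed.

End row_measurable.

(** * Translation invariance and the volume of cubes *)

Section row_lebesgue.
Context {R : realType}.
Local Notation leb := (@lebesgue_measure R).

Let shiftR (z : R) : measurableTypeR R -> measurableTypeR R := fun x => x + z.

Let measurable_shiftR z : measurable_fun setT (shiftR z).
Proof. by apply: measurable_funD. Qed.

(** Both measures agree on half-open intervals, which determine Lebesgue measure. *)
Lemma lebesgue_measure_shift (z : R) (A : set (measurableTypeR R)) : measurable A ->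
  pushforward leb (shiftR z) A = leb A.
Proof.
move=> mA; apply/esym.
have mz := measurable_shiftR z.
apply: lebesgue_measure_unique => //= _ [[a b]] _ <-.
rewrite /pushforward (_ : _ @^-1` _ = `]a - z, b - z]%classic).
  rewrite !lebesgue_measure_itv/= !lte_fin ltrD2r.
  by case: ifPn => // _; rewrite -!EFinD; congr EFin; ring.
by apply/seteqP; split=> x /=; rewrite !in_itv/= ltrBlDr lerBrDr.
Qed.

Lemma integral_shift1 (f : R -> \bar R) (z : R) : measurable_fun setT f ->
  (forall x, 0 <= f x)%E ->
  (\int[leb]_x f (x + z)%R = \int[leb]_x f x)%E.
Proof.
move=> mf f0.
have := @ge0_integral_pushforward _ _ (measurableTypeR R) (measurableTypeR R) R
   (shiftR z) (measurable_shiftR z) leb setT f measurableT mf (fun x _ => f0 x).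
rewrite preimage_setT => <-.
by apply: eq_measure_integral => //= A mA _; exact: lebesgue_measure_shift.
Qed.

Lemma integral_cons (N : nat) (f : 'rV[R]_N.+1 -> \bar R) :
  measurable_fun setT f -> (forall x, 0 <= f x)%E ->
  (\int[lebesgue_row N.+1]_x f x =
   \int[leb]_a \int[lebesgue_row N]_x f (cons_row (a, x)))%E.
Proof.
move=> mf f0.
transitivity (\int[leb \x lebesgue_row N]_p f (cons_row p))%E.
  have := @ge0_integral_pushforward _ _ (measurableTypeR R * 'rV[R]_N)%type _ R
    (@cons_row R N) (measurable_cons_row (N := N)) (leb \x lebesgue_row N)%E setT f measurableT mf (fun x _ => f0 x).
  by rewrite preimage_setT => <-.
rewrite fubini_tonelli1//.
by apply: measurableT_comp => //; exact: measurable_cons_row.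
Qed.

Lemma cons_rowD N (p q : R * 'rV[R]_N) :
  cons_row p + cons_row q = cons_row (p.1 + q.1, p.2 + q.2).
Proof.
apply/rowP => i; rewrite !mxE; case: unliftP => [j _|_] //=.
by rewrite mxE.
Qed.

(** Induction on the dimension: Tonelli's theorem splits off one coordinate, which is translated
    separately. *)
Lemma integral_shift (N : nat) (f : 'rV[R]_N -> \bar R) (z : 'rV[R]_N) :
  measurable_fun setT f -> (forall x, 0 <= f x)%E ->
  (\int[lebesgue_row N]_x f (x + z)%R = \int[lebesgue_row N]_x f x)%E.
Proof.
elim: N f z => [f z mf f0|N IH f z mf f0].
  by apply: eq_integral => x _; congr f; apply/rowP => -[].
have mfz : measurable_fun setT (fun x : 'rV[R]_N.+1 => f (x + z)).
  by apply: (@measurableT_comp _ _ _ _ _ _ f) => //; exact: measurable_row_shift.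
rewrite (integral_cons mf f0) (integral_cons mfz (fun x => f0 (x + z))).
have [a0 [x0 ->]] : exists a x, z = cons_row (a, x).
  by exists (uncons_row z).1, (uncons_row z).2; rewrite -surjective_pairing uncons_rowK.
under eq_integral => a _.
  under eq_integral do rewrite cons_rowD.
  rewrite (IH (fun x => f (cons_row (a + a0, x))))//=; last first.
    apply: measurableT_comp => //; apply: measurableT_comp; first exact: measurable_cons_row.
    exact: measurable_pair1.
  over.
rewrite (integral_shift1 (f := fun a => (\int[lebesgue_row N]_x f (cons_row (a, x)))%E))//.
  have mg : measurable_fun setT (fun p : R * 'rV[R]_N => f (cons_row p)).
    by apply: measurableT_comp => //; exact: measurable_cons_row.
  exact: (@measurable_fun_fubini_tonelli_F _ _ _ _ _ (lebesgue_row N) (fun p => f (cons_row p))).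
by move=> a; apply: integral_ge0.
Qed.

(** Serves as the set of translation vectors over which the Faber-Krahn inequality averages. *)
Definition cube (N : nat) (e : R) : set 'rV[R]_N :=
  [set z : 'rV[R]_N | forall i, 0 <= z 0 i <= e].
Arguments cube : clear implicits.

Lemma measurable_cube N e : measurable (cube N e).
Proof.
rewrite (_ : cube N e = \bigcap_(i in [set: 'I_N]) [set z : 'rV[R]_N | 0 <= z 0 i <= e]); last first.
  by apply/seteqP; split=> z /= H i; [move=> _|]; exact: H.
apply: fin_bigcap_measurable => [|i _]; first exact: finite_finset.
rewrite (_ : [set z | _] = setT `&` (fun z : 'rV[R]_N => z 0 i) @^-1` `[0, e]%classic).
  exact: measurable_row_coord.
by rewrite setTI; apply/seteqP; split=> z /=; rewrite in_itv.
Qed.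

Lemma lebesgue_cube N e : 0 <= e -> lebesgue_row N (cube N e) = (e ^+ N)%:E.
Proof.
move=> e0; elim: N => [|N IH].
  rewrite (_ : cube 0 e = setT); last by apply/seteqP; split => // z _ [].
  by rewrite /= diracE in_setT expr0.
rewrite -(setIT (cube _ _)) -integral_indic//; last exact: measurable_cube.
rewrite integral_cons//; last first.
  by apply/measurable_EFinP/measurable_indic; exact: measurable_cube.
have mN : measurable_fun setT (fun x : 'rV[R]_N => (\1_(cube N e) x : R)%:E).
  by apply/measurable_EFinP/measurable_indic; exact: measurable_cube.
transitivity (\int[leb]_a ((\1_`[0, e]%classic a)%:E * (e ^+ N)%:E))%E.
  apply: eq_integral => a _.
  transitivity (\int[lebesgue_row N]_x ((\1_`[0, e]%classic a)%:E * (\1_(cube N e) x)%:E))%E.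
    apply: eq_integral => x _; rewrite -EFinM !indicE; congr EFin.
    rewrite -natrM mulnb; congr (_%:R); congr nat_of_bool; apply/idP/andP.
      rewrite inE /cube /= => H; split; rewrite inE/= ?in_itv/=.
        by have := H ord0; rewrite mxE unlift_none.
      by move=> i; have := H (lift ord0 i); rewrite mxE liftK.
    rewrite !inE /cube /= in_itv/= => -[H1 H2] i; rewrite mxE.
    by case: unliftP => [j|].
  rewrite ge0_integralZl// integral_indic ?setIT//; last exact: measurable_cube.
  by congr (_ * _)%E; exact: IH.
rewrite /= ge0_integralZr//; last 2 first.
- by apply/measurable_EFinP/measurable_indic.
- by rewrite lee_fin exprn_ge0.
rewrite integral_indic//= setIT lebesgue_measure_itv/= lte_fin exprS EFinM.
by case: ltgtP e0 => // [e0 _|<- _]; rewrite ?oppr0 ?adde0// !mul0e.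
Qed.

End row_lebesgue.
Arguments cube {R} N e.

(** * Locally integrable functions *)

Section local_integrability.
Context {R : realType} (N : nat).
Local Notation mu := (@lebesgue_row R N).
Local Notation L1 f := (mu.-integrable [set: 'rV[R]_N] (EFin \o f)).
Implicit Types (f g k psi B : 'rV[R]_N -> R) (x : 'rV[R]_N).

Lemma measurable_boxM M : measurable (@boxM R N M).
Proof. by apply: measurable_row_compact; exact: compact_boxM. Qed.

Lemma test_measurable psi : test_function psi -> measurable_fun setT psi.
Proof. by move=> /test_continuous; exact: measurable_row_continuous. Qed.

Lemma smooth_measurable f : smooth f -> measurable_fun setT f.
Proof. by move=> /smooth_continuous; exact: measurable_row_continuous. Qed.

Lemma boxM_finite M : (mu (@boxM R N M) < +oo)%E.
Proof.
have [M0|M0] := ltP M 0.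
  (* In dimension 0 the box is the whole one-point space even for negative [M]; otherwise it is
     empty. *)
  case: (posnP N) => [N0|Npos].
    have -> : boxM M = cube N 0.
      by apply/seteqP; split=> x _ i; have := ltn_ord i; rewrite [X in (_ < X)%N]N0.
    by have := @lebesgue_cube R N 0 (lexx _); move=> /= ->; rewrite ltry.
  rewrite (_ : boxM M = set0) ?measure0 ?ltry//.
  apply/seteqP; split=> x //= /(_ (Ordinal Npos)) H.
  by have := le_lt_trans (le_trans (normr_ge0 _) H) M0; rewrite ltxx.
have mb := measurable_boxM M.
rewrite -(setIT (boxM M)) -integral_indic//.
have -> : (\int[mu]_x (\1_(boxM M) x)%:E = \int[mu]_x (\1_(cube N (M + M)) (x + const_mx M))%:E)%E.
  apply: eq_integral => x _; congr EFin; rewrite !indicE; congr (_%:R); congr nat_of_bool.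
  apply/idP/idP; rewrite !inE /boxM /cube /= => H i; have := H i; rewrite !mxE;
    rewrite ler_norml => /andP[H1 H2]; apply/andP; split; lra.
rewrite (integral_shift (f := fun x => (\1_(cube N (M + M)) x)%:E))//; last first.
  by apply/measurable_EFinP/measurable_indic; exact: measurable_cube.
rewrite integral_indic//; last exact: measurable_cube.
rewrite setIT; have /= -> := @lebesgue_cube R N (M + M) (addr_ge0 M0 M0).
by rewrite ltry.
Qed.

Lemma L1_boxM M : L1 (\1_(@boxM R N M)).
Proof.
have mb := measurable_boxM M.
apply/L1_ge0P; [exact/measurable_indic|by move=> x; rewrite indicE|].
by rewrite integral_indic// setIT boxM_finite.
Qed.

Lemma loc_integrableP f : loc_integrable f <->
  measurable_fun setT f /\ forall M, L1 (fun x => f x * \1_(@boxM R N M) x).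
Proof.
split=> [[mf lf]|[mf lf]].
  split=> // M.
  have := lf _ (@compact_boxM R N M).
  move=> /(integrable_mkcond _ (measurable_boxM M)).1; apply: eq_integrable => // x _ /=.
  by rewrite patchE indicE; case: ifPn => _; rewrite ?mulr1 ?mulr0.
split=> // K cK; have [M _ KM] := compact_sub_boxM cK.
have mK := measurable_row_compact cK.
apply: (integrableS (measurable_boxM M)) => //.
apply/(integrable_mkcond _ (measurable_boxM M)); move: (lf M); apply: eq_integrable => // x _ /=.
by rewrite patchE indicE; case: ifPn => _; rewrite ?mulr1 ?mulr0.
Qed.

Lemma locint_meas f : loc_integrable f -> measurable_fun setT f.
Proof. by case. Qed.

Lemma locint_boxM f M : loc_integrable f -> L1 (fun x => f x * \1_(@boxM R N M) x).
Proof. by move=> /loc_integrableP[]. Qed.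

Lemma locint_mul_supp f g M C : loc_integrable f -> measurable_fun setT g ->
  (forall x, `|g x| <= C) -> supported_in M g -> L1 (fun x => f x * g x).
Proof.
move=> lf mg gC gM.
apply: (L1_le _ (L1Z C (L1_norm (locint_boxM M lf)))).
  by apply: measurable_funM => //; exact: locint_meas.
move=> x; rewrite !normrM indicE mulrC.
have [gx|gx] := eqVneq (g x) 0; first by rewrite gx normr0 mul0r mulr_ge0// (le_trans (normr_ge0 _) (gC x)).
by rewrite mem_set ?normr1 ?mulr1; [rewrite ler_wpM2r|exact: gM].
Qed.

Lemma locint_test f psi : loc_integrable f -> test_function psi -> L1 (fun x => f x * psi x).
Proof.
move=> lf tpsi; have [C C0 HC] := test_bounded tpsi.
have [_ [M M0 HM]] := (test_functionP _).1 tpsi.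
by apply: (locint_mul_supp (M := M) (C := C)) => //; exact: test_measurable.
Qed.

Lemma L2_locint f : L2 mu f -> loc_integrable f.
Proof.
move=> [mf If]; apply/loc_integrableP; split=> // M.
apply: (L1_le _ (L1D If (L1_boxM M))).
  by apply: measurable_funM => //; apply/measurable_indic; exact: measurable_boxM.
move=> x /=; rewrite normrM indicE; case: (x \in _); rewrite ?normr1 ?normr0 ?mulr1 ?mulr0 ?addr0 ?sqr_ge0//.
rewrite -(@real_normK _ (f x)) ?num_real//; have := sqr_ge0 (`|f x| - 1); rewrite [true%:R]/=; have := normr_ge0 (f x); nra.
Qed.

Lemma L1_locint f : L1 f -> loc_integrable f.
Proof.
move=> If; apply/loc_integrableP; split=> [|M]; first exact: L1_meas If.
apply: (L1_le _ (L1_norm If)).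
  apply: measurable_funM; first exact: L1_meas If.
  by apply/measurable_indic; exact: measurable_boxM.
by move=> x; rewrite normrM indicE; case: (x \in _); rewrite ?normr1 ?normr0 ?mulr1 ?mulr0.
Qed.

Lemma locintD f g : loc_integrable f -> loc_integrable g -> loc_integrable (fun x => f x + g x).
Proof.
move=> /loc_integrableP[mf If] /loc_integrableP[mg Ig]; apply/loc_integrableP.
split=> [|M]; first exact: measurable_funD.
by apply: (eq_L1 _ (L1D (If M) (Ig M))) => x; rewrite mulrDl.
Qed.

Lemma locint_continuousM f g : loc_integrable f -> continuous g ->
  loc_integrable (fun x => g x * f x).
Proof.
move=> lf cg; have [mf If] := (loc_integrableP f).1 lf; apply/loc_integrableP.
have mg := measurable_row_continuous cg.
split=> [|M]; first exact: measurable_funM.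
have [C C0 HC] := continuous_bounded_boxM M cg.
apply: (L1_le _ (L1Z C (L1_norm (If M)))).
  apply: measurable_funM; first exact: measurable_funM.
  by apply/measurable_indic; exact: measurable_boxM.
move=> x; rewrite !normrM indicE.
have [Mx|Mx] := boolP (x \in _); last by rewrite normr0 !mulr0.
by rewrite normr1 !mulr1 ler_wpM2r// HC//; move: Mx; rewrite inE.
Qed.

Lemma locintZ c f : loc_integrable f -> loc_integrable (fun x => c * f x).
Proof. by move=> lf; apply: locint_continuousM => //; exact: cst_continuous. Qed.

Lemma locintB f g : loc_integrable f -> loc_integrable g -> loc_integrable (fun x => f x - g x).
Proof.
move=> lf /(locintZ (-1)) lg; have := locintD lf lg.
by congr loc_integrable; apply/funext => x; rewrite mulN1r.
Qed.

Lemma L2_test psi : test_function psi -> L2 mu psi.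
Proof.
move=> tpsi; split; first exact: test_measurable.
have l1 : loc_integrable psi.
  have lone : loc_integrable (fun _ : 'rV[R]_N => 1).
    apply/loc_integrableP; split=> // M.
    by apply: (eq_L1 _ (L1_boxM M)) => x; rewrite mul1r.
  have := locint_continuousM lone (test_continuous tpsi).
  by congr loc_integrable; apply/funext => x; rewrite mulr1.
by apply: (eq_L1 _ (locint_test l1 tpsi)) => x; rewrite expr2.
Qed.

(** A pi-system generating the Borel sets, each of whose members is described by a test function; it
    lifts statements about test functions to measurable sets. *)
Definition test_sets : set (set 'rV[R]_N) :=
  [set A | exists B, [/\ test_function B, forall x, 0 <= B x & A = [set x | 0 < B x]]].

Lemma setI_test_sets : setI_closed test_sets.
Proof.
move=> _ _ [B [tB B0 ->]] [C [tC C0 ->]].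
exists (fun x => B x * C x); split; first by apply: testMr => //; exact: test_smooth.
  by move=> x; rewrite mulr_ge0.
apply/seteqP; split=> x /=; first by move=> [b c]; rewrite mulr_gt0.
move=> H; have b0 : B x != 0 by apply: contraTneq H => ->; rewrite mul0r ltxx.
have c0 : C x != 0 by apply: contraTneq H => ->; rewrite mulr0 ltxx.
by rewrite !lt_neqAle B0 C0 !andbT !(eq_sym 0) b0 c0.
Qed.

(** Balls of squared radius [n.+1]. They exhaust the space and localise functions that are only
    locally integrable. *)
Definition bumps n : set 'rV[R]_N := [set x | 0 < ballbump (n.+1%:R^-1) x].

Lemma bumps_test n : test_sets (bumps n).
Proof.
exists (ballbump (n.+1%:R^-1)); split=> //; first by apply: test_bump; rewrite invr_gt0.
by move=> x; exact: flat1_ge0.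
Qed.

Lemma bumps_cover x : \forall n \near \oo, bumps n x.
Proof.
near=> n; rewrite /bumps /= bump_gt0 ltr_pdivrMl// mulr1.
rewrite (@lt_le_trans _ _ n%:R)//; last by rewrite ler_nat.
near: n; exact: nbhs_infty_gtr.
Unshelve. all: by end_near. Qed.

Lemma measurable_test_setsE : @measurable _ 'rV[R]_N = <<s test_sets >>.
Proof.
apply/seteqP; split.
  apply: smallest_sub; first exact: smallest_sigma_algebra.
  rewrite -bigcup_seq => _ [i _ [Y mY <-]].
  have H : @measurable_fun _ _ (g_sigma_algebraType test_sets) R setT (fun x : 'rV[R]_N => x 0 i).
    apply: (measurability _ (RGenOpens.measurableE R)) => _ [_ [a [b ->]] <-].
    (* A slab [a < x_i < b] is not the positivity set of a compactly supported function, but it is a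
       countable union of such sets, one for each ball. *)
    rewrite setTI (_ : _ @^-1` _ = \bigcup_n [set x : 'rV[R]_N |
        0 < ballbump (n.+1%:R^-1) x * (flat1 (x 0 i - a) * flat1 (b - x 0 i))]); last first.
      apply/seteqP; split=> x /=.
        rewrite in_itv/= => /andP[ax xb].
        have [n _ /(_ n)Hn] := bumps_cover x; exists n => //=.
        have Hb : bumps n x by apply: Hn => /=.
        by apply: mulr_gt0; [exact: Hb|rewrite mulr_gt0// flat1_gt0 subr_gt0].
      move=> [n _ /= H]; rewrite in_itv/=; apply/andP; split.
        rewrite -subr_gt0 -flat1_gt0 lt_neqAle eq_sym flat1_ge0 andbT.
        by apply: contraTneq H => ->; rewrite mul0r mulr0 ltxx.
      rewrite -subr_gt0 -flat1_gt0 lt_neqAle eq_sym flat1_ge0 andbT.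
      by apply: contraTneq H => ->; rewrite !mulr0 ltxx.
    apply: bigcup_measurable => n _; apply: sub_sigma_algebra.
    exists (fun x : 'rV[R]_N => ballbump (n.+1%:R^-1) x * (flat1 (x 0 i - a) * flat1 (b - x 0 i))).
    split=> //.
      apply: testMr; first by apply: test_bump; rewrite invr_gt0.
      apply: smoothM; apply: smooth_comp; try exact: smooth1_flat1.
        by apply: smoothD; [exact: smooth_coord|exact: smooth_cst].
      rewrite (_ : (fun x => _) = (fun x => b + (-1) * x 0 i)).
        by apply: smoothD; [exact: smooth_cst|apply: smoothZ; exact: smooth_coord].
      by apply/funext => x; rewrite mulN1r.
    by move=> x; rewrite !mulr_ge0 ?flat1_ge0.
  exact: H.
apply: smallest_sub; first exact: sigma_algebra_measurable.
move=> _ [B [tB B0 ->]].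
rewrite (_ : [set x | _] = B @^-1` `]0, +oo[%classic).
  by rewrite -[X in measurable X]setTI; exact: test_measurable.
by apply/seteqP; split=> x /=; rewrite in_itv/= andbT.
Qed.

Lemma measurable_bumps n : measurable (bumps n).
Proof. by rewrite measurable_test_setsE; apply: sub_sigma_algebra; exact: bumps_test. Qed.

(* Dynkin's theorem for the pi-system of the sets [{B > 0}]. *)
Lemma test_sets_ind (P : set_system 'rV[R]_N) :
  P setT -> test_sets `<=` P ->
  (forall A, measurable A -> P A -> P (~` A)) ->
  (forall F : (set 'rV[R]_N)^nat, (forall n, measurable (F n)) -> trivIset setT F ->
    (forall n, P (F n)) -> P (\bigcup_k F k)) ->
  forall A, measurable A -> P A.
Proof.
move=> PT PG PC PU A; rewrite measurable_test_setsE => mA.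
apply: (@dynkin_induction _ _ test_sets P measurable_test_setsE) => //.
exact: setI_test_sets.
Qed.

Lemma indic_trivIset_cvg (T : Type) (F : (set T)^nat) (x : T) : trivIset setT F ->
  (fun m => \sum_(j < m) (\1_(F j) x : R)) @ \oo --> (\1_(\bigcup_k F k) x : R).
Proof.
move=> tF; have [[j0 _ Fx]|nF] := pselect ((\bigcup_k F k) x).
  rewrite indicE mem_set; last by exists j0.
  apply: cvg_near_cst; near=> m.
  have jm : (j0 < m)%N by near: m; exact: nbhs_infty_gt.
  rewrite (bigD1 (Ordinal jm))//= indicE mem_set// big1 ?addr0// => i ij.
  rewrite indicE memNset// => Fi; move/eqP: ij; apply; apply/val_inj => /=.
  by apply: tF => //; exists x.
rewrite indicE memNset//; apply: cvg_near_cst; apply: nearW => m.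
by rewrite big1// => i _; rewrite indicE memNset// => Fi; apply: nF; exists i.
Unshelve. all: by end_near. Qed.

Lemma sum_indic_trivIset_bounded (T : Type) (F : (set T)^nat) (x : T) m : trivIset setT F ->
  0 <= \sum_(j < m) (\1_(F j) x : R) <= 1.
Proof.
move=> tF; rewrite sumr_ge0//=; have [[j Fj]|nF] := pselect (exists j : 'I_m, F j x).
  rewrite (bigD1 j)//= indicE mem_set// big1 ?addr0// => i ij.
  rewrite indicE memNset// => Fi; move/eqP: ij; apply; apply/val_inj => /=.
  by apply: tF => //; exists x.
by rewrite big1// => i _; rewrite indicE memNset// => Fi; apply: nF; exists i.
Qed.

End local_integrability.

(** * Uniqueness of weak derivatives *)

Section fundamental_lemma.
Context {R : realType} (N : nat).
Local Notation mu := (@lebesgue_row R N).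
Local Notation L1 f := (mu.-integrable [set: 'rV[R]_N] (EFin \o f)).
Local Notation L2 := (L2 mu).
Implicit Types (f g k psi B : 'rV[R]_N -> R) (x : 'rV[R]_N).

Lemma indic01 (T : Type) (A : set T) (x : T) : 0 <= (\1_A x : R) <= 1.
Proof. by rewrite indicE; case: (x \in A); rewrite ?lexx ?ler01. Qed.

Lemma bumps_supported n : exists M, supported_in M (\1_(@bumps R N n) : _ -> R).
Proof.
have n0 : 0 < n.+1%:R^-1 :> R by rewrite invr_gt0.
have [_ [M M0 HM]] := (test_functionP _).1 (@test_bump R N _ n0).
exists M => x; rewrite indicE; case: (boolP (x \in _)) => [|_]; last by rewrite eqxx.
by rewrite inE => /lt0r_neq0 /HM.
Qed.

Lemma L1_mul_bumps k n A : loc_integrable k -> measurable A ->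
  L1 (fun x => k x * (\1_A x * \1_(@bumps R N n) x)).
Proof.
move=> lk mA; have [M HM] := bumps_supported n.
apply: (locint_mul_supp (M := M) (C := 1)) => //.
- by apply: measurable_funM; apply: measurable_indic => //; exact: measurable_bumps.
- move=> x; have /andP[a0 a1] := indic01 A x; have /andP[b0 b1] := indic01 (bumps n) x.
  by rewrite ger0_norm ?mulr_ge0// mulr_ile1.
- by move=> x; rewrite mulf_eq0 negb_or => /andP[_ /HM].
Qed.

Lemma saturate_cvg (b : R) : 0 <= b ->
  (fun m : nat => 1 - expR (- (m%:R * b))) @ \oo --> (if 0 < b then 1 else 0 : R).
Proof.
move=> b0; case: ifPn => [{}b0|]; last first.
  rewrite -leNgt => b0'; have -> : b = 0 by apply/eqP; rewrite eq_le b0 b0'.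
  by under eq_fun do rewrite mulr0 oppr0 expR0 subrr; exact: cvg_cst.
apply/cvgrPdist_le => e e0; near=> m.
rewrite opprB addrC subrK ger0_norm ?expR_ge0// expRN.
rewrite invf_ple ?posrE ?expR_gt0// (le_trans _ (expR_ge1Dx _))//.
rewrite ler_wpDl// -ler_pdivrMr//.
by near: m; exact: nbhs_infty_ger.
Unshelve. all: by end_near. Qed.

Lemma cvg_cst_eq (a b : R) : (fun _ : nat => a) @ \oo --> b -> b = a.
Proof. by move/cvg_lim => <-//; rewrite lim_cst. Qed.

(** The functions [1 - exp (- m B)] turn the hypothesis into the vanishing of the integral of [k]
    over [B > 0]. Dynkin's theorem extends this to every measurable set inside a fixed ball, in
    particular to the parts where [k > 0] and [k < 0]. *)
Lemma fundamental_lemma k : loc_integrable k ->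
  (forall psi, test_function psi -> \int[mu]_x (k x * psi x) = 0) ->
  {ae mu, forall x, k x = 0}.
Proof.
move=> lk Hk; have mk := locint_meas lk.
have HB B : test_function B -> (forall x, 0 <= B x) ->
    \int[mu]_x (k x * (if 0 < B x then 1 else 0)) = 0.
  move=> tB B0; have [M M0 HM] := ((test_functionP _).1 tB).2.
  have t m : test_function (fun x => 1 - expR (- (m%:R * B x))) by exact: test_saturate.
  have bE m x : 0 <= 1 - expR (- (m%:R * B x)) <= 1.
    by rewrite subr_ge0 expR_le1 oppr_le0 mulr_ge0//= lerBlDr lerDl expR_ge0.
  have mi : measurable_fun setT (fun x => if 0 < B x then 1 else 0 : R).
    apply: measurable_fun_if => //.
      by apply: measurable_fun_ltr => //; exact: test_measurable.
  have cv x : (fun m : nat => k x * (1 - expR (- (m%:R * B x)))) @ \oo -->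
      k x * (if 0 < B x then 1 else 0).
    by apply: cvgMr; exact: saturate_cvg.
  have le (m : nat) x : `|k x * (1 - expR (- (m%:R * B x)))| <= `|k x * \1_(boxM M) x|.
    rewrite !normrM ler_wpM2l// indicE.
    have [Bx|Bx] := eqVneq (B x) 0; first by rewrite Bx mulr0 oppr0 expR0 subrr normr0.
    by rewrite mem_set ?normr1; [have /andP[b0 b1] := bE m x; rewrite ger0_norm|exact: HM].
  have [_] := Rint_dct (fun m => measurable_funM mk (test_measurable (t m)))
    (measurable_funM mk mi) cv (L1_norm (locint_boxM M lk)) le.
  under eq_fun do rewrite Hk//.
  by move/cvg_cst_eq.
have HP n A : measurable A -> \int[mu]_x (k x * (\1_A x * \1_(bumps n) x)) = 0.
  move: A; apply: test_sets_ind.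
  - rewrite -[RHS](HB (ballbump (n.+1%:R^-1))).
    + apply: eq_Rint => x; rewrite indicT mul1r indicE.
      have -> : (x \in bumps n) = (0 < ballbump n.+1%:R^-1 x) by apply/idP/idP; rewrite inE.
      by case: ifP.
    + by apply: test_bump; rewrite invr_gt0.
    + by move=> x; exact: flat1_ge0.
  - move=> _ [B [tB B0 ->]].
    rewrite -[RHS](HB (fun x => B x * ballbump (n.+1%:R^-1) x)).
    + apply: eq_Rint => x; rewrite !indicE -natrM mulnb; congr (_ * _).
      have b0 := flat1_ge0 (1 - n.+1%:R^-1 * dotr x x).
      have -> : (0 < B x * ballbump n.+1%:R^-1 x) = (0 < B x) && (0 < ballbump n.+1%:R^-1 x).
        have := B0 x; rewrite le_eqVlt => /orP[/eqP<-|Bx]; first by rewrite mul0r ltxx.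
        by rewrite pmulr_rgt0// Bx.
      have -> : (x \in [set x0 | 0 < B x0]) = (0 < B x) by apply/idP/idP; rewrite inE.
      have -> : (x \in bumps n) = (0 < ballbump n.+1%:R^-1 x) by apply/idP/idP; rewrite inE.
      by case: (_ && _).
    + apply: testMr => //; exact: smooth_bump.
    + by move=> x; rewrite mulr_ge0// flat1_ge0.
  - move=> A mA HA.
    transitivity (\int[mu]_x (k x * (\1_setT x * \1_(bumps n) x) - k x * (\1_A x * \1_(bumps n) x))).
      apply: eq_Rint => x; rewrite indicT !indicE in_setC.
      by case: (x \in A); rewrite ?mul0r ?mul1r ?mulr0 ?subrr ?subr0.
    rewrite RintB ?HA ?subr0; [|exact: L1_mul_bumps|exact: L1_mul_bumps].
    rewrite -[RHS](HB (ballbump (n.+1%:R^-1))).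
    + apply: eq_Rint => x; rewrite indicT mul1r indicE.
      have -> : (x \in bumps n) = (0 < ballbump n.+1%:R^-1 x) by apply/idP/idP; rewrite inE.
      by case: ifP.
    + by apply: test_bump; rewrite invr_gt0.
    + by move=> x; exact: flat1_ge0.
  - move=> F mF tF HF.
    have cv x : (fun m => \sum_(j < m) (k x * (\1_(F j) x * \1_(bumps n) x))) @ \oo -->
        k x * (\1_(\bigcup_j F j) x * \1_(bumps n) x).
      under eq_fun do rewrite -mulr_sumr -mulr_suml.
      by apply: cvgMr; apply: cvgMl; exact: indic_trivIset_cvg.
    have le m x : `|\sum_(j < m) (k x * (\1_(F j) x * \1_(bumps n) x))| <=
        `|k x * (\1_setT x * \1_(bumps n) x)|.
      rewrite -mulr_sumr -mulr_suml !normrM ler_wpM2l// ler_wpM2r// indicT normr1.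
      by have /andP[s0 s1] := @sum_indic_trivIset_bounded R _ F x m tF; rewrite ger0_norm.
    have mU := L1_meas (L1_mul_bumps n lk (bigcup_measurable (fun j _ => mF j))).
    have mS m : measurable_fun setT (fun x => \sum_(j < m) (k x * (\1_(F j) x * \1_(bumps n) x))).
      by apply: measurable_sum => j; apply: L1_meas; exact: L1_mul_bumps.
    have [_] := Rint_dct mS (mU _) cv (L1_norm (L1_mul_bumps n lk measurableT)) le.
    under eq_fun do (rewrite Rint_sum; [|by move=> j; exact: L1_mul_bumps]).
    under eq_fun do rewrite big1//.
    by move/cvg_cst_eq.
have Hn n : {ae mu, forall x, bumps n x -> k x = 0}.
  have mp : measurable [set x | 0 < k x].
    rewrite (_ : [set x | _] = setT `&` k @^-1` `]0, +oo[%classic); first exact: mk.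
    by rewrite setTI; apply/seteqP; split=> x /=; rewrite in_itv/= andbT.
  have mq : measurable [set x | k x < 0].
    rewrite (_ : [set x | _] = setT `&` k @^-1` `]-oo, 0[%classic); first exact: mk.
    by rewrite setTI; apply/seteqP; split=> x /=; rewrite in_itv/=.
  have Hp := HP n _ mp; have Hq := HP n _ mq.
  have p0 x : 0 <= k x * (\1_[set x | 0 < k x] x * \1_(bumps n) x).
    rewrite !indicE; have [|] := boolP (x \in [set x | 0 < k x]).
      by rewrite inE /= => kx; apply: mulr_ge0; [exact: ltW|rewrite mul1r ler0n].
    by rewrite mul0r mulr0.
  have q0 x : 0 <= - (k x * (\1_[set x | k x < 0] x * \1_(bumps n) x)).
    rewrite !indicE; have [|] := boolP (x \in [set x | k x < 0]).
      by rewrite inE /= => kx; rewrite -mulNr; apply: mulr_ge0; [rewrite oppr_ge0 ltW|rewrite mul1r ler0n].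
    by rewrite mul0r mulr0 oppr0.
  have Lp := L1_mul_bumps n lk mp; have Lq := L1_mul_bumps n lk mq.
  have := Rint_eq0_ae (L1N Lq) q0; rewrite RintN// Hq oppr0 => /(_ erefl).
  have := Rint_eq0_ae Lp p0 Hp.
  apply: filterS2 => x + + bx; rewrite !indicE (mem_set bx) !mulr1.
  have [kx _|kx|->//] := ltgtP (k x) 0.
    by rewrite (mem_set (_ : [set x | k x < 0] x))// mulr1 => /eqP; rewrite oppr_eq0 => /eqP.
  by rewrite (mem_set (_ : [set x | 0 < k x] x))// mulr1.
have : {ae mu, forall x, forall n, bumps n x -> k x = 0} by apply/ae_foralln.
apply: filterS => x Hx; have [n _ /(_ n)Hb] := bumps_cover x.
by apply: (Hx n); apply: Hb => /=.
Qed.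

(** One coordinate of [is_weak_gradient], with real integrals: they agree with the extended ones
    since a locally integrable function times a test function is integrable. *)
Definition weak_partial (i : 'I_N) f g := [/\ loc_integrable f, loc_integrable g &
  forall psi, test_function psi ->
    \int[mu]_x (f x * 'D_(basis_vec i) psi x) = - \int[mu]_x (g x * psi x)].

Lemma weak_gradientP f (g : 'rV[R]_N -> 'rV[R]_N) :
  is_weak_gradient f g <->
  loc_integrable f /\ forall i, weak_partial i f (fun x => g x 0 i).
Proof.
split=> [[lf lg H]|[lf H]].
  split=> // i; split=> // psi tpsi; have := H psi i tpsi.
  rewrite -EFin_Rint; last exact: locint_test (test_derive i tpsi).
  by rewrite -EFin_Rint; [move=> E; apply: EFin_inj; rewrite E|exact: locint_test].
split=> // [i|psi i tpsi]; first by case: (H i).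
have [_ lg /(_ _ tpsi) E] := H i.
rewrite -EFin_Rint; last exact: locint_test (test_derive i tpsi).
by rewrite -EFin_Rint ?E//; exact: locint_test.
Qed.

Lemma weak_partial_unique i f g g' : weak_partial i f g -> weak_partial i f g' ->
  {ae mu, forall x, g x = g' x}.
Proof.
move=> [_ lg Hg] [_ lg' Hg'].
have : {ae mu, forall x, g x - g' x = 0}.
  apply: fundamental_lemma => [|psi tpsi]; first exact: locintB.
  transitivity (\int[mu]_x (g x * psi x - g' x * psi x)).
    by apply: eq_Rint => x; rewrite mulrBl.
  rewrite RintB; [|exact: locint_test|exact: locint_test].
  by apply/eqP; rewrite subr_eq0 -eqr_opp -Hg// -Hg'.
by apply: filterS => x /eqP; rewrite subr_eq0 => /eqP.
Qed.

End fundamental_lemma.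

(** * Density of test functions in L2 *)

Section L2_density.
Context {R : realType} (N : nat).
Local Notation mu := (@lebesgue_row R N).
Local Notation L1 f := (mu.-integrable [set: 'rV[R]_N] (EFin \o f)).
Local Notation L2 := (L2 mu).
Implicit Types (f g k psi B : 'rV[R]_N -> R) (x : 'rV[R]_N).

Lemma Rint_sqD_le f g : L2 f -> L2 g ->
  \int[mu]_x (f x + g x) ^+ 2 <= 2 * \int[mu]_x f x ^+ 2 + 2 * \int[mu]_x g x ^+ 2.
Proof.
move=> f2 g2; have f1 := L2_sq f2; have g1 := L2_sq g2.
rewrite -!RintZ// -RintD; [|exact: L1Z|exact: L1Z].
apply: Rint_le => [||x]; first exact: L2_sq (L2D f2 g2).
  by apply: L1D; exact: L1Z.
by have := sqr_ge0 (f x - g x); nra.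
Qed.

Lemma L2_dct (F : nat -> 'rV[R]_N -> R) f :
  (forall n, measurable_fun setT (F n)) -> L2 f ->
  (forall x, F ^~ x @ \oo --> f x) -> (forall n x, `|F n x| <= `|f x|) ->
  (fun n => \int[mu]_x (F n x - f x) ^+ 2) @ \oo --> 0.
Proof.
move=> mF f2 Ff Fle.
have cv x : (fun n => (F n x - f x) ^+ 2) @ \oo --> (0 : R).
  have -> : (0 : R) = (f x - f x) * (f x - f x) by rewrite subrr mulr0.
  under eq_fun do rewrite expr2.
  by apply: cvgM; apply: cvgB => //; exact: cvg_cst.
have le n x : `|(F n x - f x) ^+ 2| <= 4 * f x ^+ 2.
  rewrite ger0_norm ?sqr_ge0//.
  have := Fle n x; rewrite -(@real_normK _ (f x)) ?num_real//.
  rewrite ler_norml => /andP[].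
  have : f x <= `|f x| by exact: ler_norm.
  have : - f x <= `|f x| by rewrite -normrN ler_norm.
  by move: (F n x) (f x) (`|f x|) => a b c; nra.
have [_] := Rint_dct (fun n => measurable_funX 2 (measurable_funB (mF n) (L2_meas f2)))
   (measurable_cst (0 : R)) cv (L1Z 4 (L2_sq f2)) le.
by rewrite Rint_zero.
Qed.

Definition test_approx f := forall e, 0 < e ->
  exists2 psi, test_function psi & \int[mu]_x (f x - psi x) ^+ 2 < e.

Lemma test_approxD f g : L2 f -> L2 g -> test_approx f -> test_approx g ->
  test_approx (fun x => f x + g x).
Proof.
move=> f2 g2 Af Ag e e0.
have e4 : 0 < e / 4 by rewrite divr_gt0.
have [p tp Hp] := Af _ e4; have [q tq Hq] := Ag _ e4.
exists (fun x => p x + q x); first exact: testD.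
have := Rint_sqD_le (L2B f2 (L2_test tp)) (L2B g2 (L2_test tq)).
rewrite (_ : \int[mu]_x _ = \int[mu]_x (f x + g x - (p x + q x)) ^+ 2); last first.
  by apply: eq_Rint => x; congr (_ ^+ 2); ring.
by move/le_lt_trans; apply; lra.
Qed.

Lemma test_approxZ c f : L2 f -> test_approx f -> test_approx (fun x => c * f x).
Proof.
move=> f2 Af e e0.
have c1 : 0 < c ^+ 2 + 1 by have := sqr_ge0 c; lra.
have [p tp Hp] := Af _ (divr_gt0 e0 c1).
exists (fun x => c * p x); first exact: testZ.
rewrite (_ : \int[mu]_x _ = c ^+ 2 * \int[mu]_x (f x - p x) ^+ 2); last first.
  rewrite -RintZ; last exact: L2_sq (L2B f2 (L2_test tp)).
  by apply: eq_Rint => x; rewrite -mulrBr exprMn.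
move: Hp; rewrite ltr_pdivlMr//.
have : 0 <= \int[mu]_x (f x - p x) ^+ 2 by apply: Rint_ge0 => x; exact: sqr_ge0.
move: (\int[mu]_x _) => a a0; have := sqr_ge0 c; nra.
Qed.

Lemma test_approx_lim (F : nat -> 'rV[R]_N -> R) f : (forall n, L2 (F n)) -> L2 f ->
  (fun n => \int[mu]_x (F n x - f x) ^+ 2) @ \oo --> 0 ->
  (forall n, test_approx (F n)) -> test_approx f.
Proof.
move=> F2 f2 /cvgrPdist_lt cF AF e e0.
have e4 : 0 < e / 4 by rewrite divr_gt0.
have [n _ /(_ n (leqnn n))/=] := cF _ e4.
rewrite sub0r normrN ger0_norm; last by apply: Rint_ge0 => x; exact: sqr_ge0.
move=> Hn; have [p tp Hp] := AF n _ e4; exists p => //.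
have := Rint_sqD_le (L2B f2 (F2 n)) (L2B (F2 n) (L2_test tp)).
rewrite (_ : \int[mu]_x _ = \int[mu]_x (f x - p x) ^+ 2); last first.
  by apply: eq_Rint => x; congr (_ ^+ 2); ring.
rewrite (_ : \int[mu]_x (f x - F n x) ^+ 2 = \int[mu]_x (F n x - f x) ^+ 2); last first.
  by apply: eq_Rint => x; ring.
by move/le_lt_trans; apply; lra.
Qed.

Lemma test_approx_sum I (s : seq I) (F : I -> 'rV[R]_N -> R) :
  (forall i, L2 (F i)) -> (forall i, test_approx (F i)) ->
  test_approx (fun x => \sum_(i <- s) F i x).
Proof.
move=> F2 AF; elim: s => [|a s IH].
  move=> e e0; exists (fun=> 0).
    have t := @test_bump R N 1 ltr01; apply: (test_dominated t) => //; exact: smooth_cst.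
  rewrite (_ : \int[mu]_x _ = 0)//; rewrite -[RHS](Rint_zero mu); apply: eq_Rint => x.
  by rewrite big_nil subrr expr0n.
have := test_approxD (F2 a) (L2_sum s F2) (AF a) IH.
by congr test_approx; apply/funext => x; rewrite big_cons.
Qed.

Lemma L2_indic_bumps n A : measurable A -> L2 (fun x => \1_A x * \1_(@bumps R N n) x).
Proof.
move=> mA; split.
  by apply: measurable_funM; apply: measurable_indic => //; exact: measurable_bumps.
have one : loc_integrable (fun _ : 'rV[R]_N => 1).
  by apply/loc_integrableP; split=> // M; apply: (eq_L1 _ (@L1_boxM R N M)) => x; rewrite mul1r.
apply: (eq_L1 _ (L1_mul_bumps n one mA)) => x.
by rewrite mul1r !indicE; do 2 case: (_ \in _); rewrite ?mulr0 ?mul0r ?mulr1 ?expr0n ?expr1n.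
Qed.

(** The saturations [1 - exp (- m B)] converge pointwise to the indicator and stay below it, so
    dominated convergence applies. *)
Lemma test_approx_test_set A : @test_sets R N A -> test_approx (\1_A).
Proof.
move=> [B [tB B0 ->]] e e0; have [M M0 HM] := ((test_functionP _).1 tB).2.
pose p (m : nat) x := 1 - expR (- (m%:R * B x)).
have t m : test_function (p m) by exact: test_saturate.
have bE m x : 0 <= p m x <= 1.
  by rewrite subr_ge0 expR_le1 oppr_le0 mulr_ge0//= lerBlDr lerDl expR_ge0.
have indE x : \1_[set x | 0 < B x] x = (if 0 < B x then 1 else 0) :> R.
  by rewrite indicE; case: ifPn => [Bx|/negP Bx]; [rewrite mem_set|rewrite memNset].
have mi : measurable_fun setT (\1_[set x | 0 < B x] : _ -> R).
  apply: measurable_indic; rewrite measurable_test_setsE; apply: sub_sigma_algebra.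
  by exists B.
have i2 : L2 (\1_[set x | 0 < B x]).
  split=> //; apply: (L1_le _ (@L1_boxM R N M)); first exact: measurable_funX.
  move=> x; rewrite indE indicE.
  case: ifPn => [/lt0r_neq0/HM Mx|_]; last by rewrite expr0n normr0.
  by rewrite mem_set// expr1n normr1.
have cv x : p ^~ x @ \oo --> (\1_[set x | 0 < B x] x : R).
  by rewrite indE; exact: saturate_cvg.
have le m x : `|p m x| <= `|\1_[set x | 0 < B x] x : R|.
  rewrite indE; case: ifPn => [_|]; first by rewrite normr1; have /andP[b0 b1] := bE m x; rewrite ger0_norm.
  rewrite lt_neqAle B0 andbT negbK => /eqP Bx.
  by rewrite /p -Bx mulr0 oppr0 expR0 subrr.
have /cvgrPdist_lt/(_ e e0)[n _ /(_ n (leqnn n))/=] := L2_dct (fun m => test_measurable (t m)) i2 cv le.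
rewrite sub0r normrN ger0_norm; last by apply: Rint_ge0 => x; exact: sqr_ge0.
move=> H; exists (p n) => //; apply: le_lt_trans H.
by rewrite le_eqVlt; apply/orP; left; apply/eqP; apply: eq_Rint => x; ring.
Qed.

(** Dynkin's theorem again: complements are taken inside the ball [bumps n], and a disjoint union is
    the L2 limit of its finite partial unions. *)
Lemma test_approx_indic n A : measurable A -> test_approx (fun x => \1_A x * \1_(@bumps R N n) x).
Proof.
have indI (B C : set 'rV[R]_N) x : \1_B x * \1_C x = \1_(B `&` C) x :> R.
  by rewrite !indicE in_setI -natrM mulnb.
have HT : test_approx (fun x => \1_setT x * \1_(@bumps R N n) x).
  have := test_approx_test_set (@bumps_test R N n).
  by congr test_approx; apply/funext => x; rewrite indicT mul1r.
move: A; apply: test_sets_ind => //.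
- move=> A tA; have := test_approx_test_set (setI_test_sets tA (@bumps_test R N n)).
  by congr test_approx; apply/funext => x; rewrite indI.
- move=> A mA HA.
  have := test_approxD (L2_indic_bumps n measurableT) (L2Z (-1) (L2_indic_bumps n mA)) HT
    (test_approxZ (-1) (L2_indic_bumps n mA) HA).
  congr test_approx; apply/funext => x; rewrite indicT !indicE in_setC.
  by case: (x \in A); rewrite /=; ring.
- move=> F mF tF HF.
  have mU : measurable (\bigcup_k F k) by exact: bigcup_measurable.
  have F2 m : L2 (fun x => \sum_(j < m) (\1_(F j) x * \1_(bumps n) x)).
    by apply: L2_sum => j; exact: L2_indic_bumps.
  apply: (@test_approx_lim (fun m x => \sum_(j < m) (\1_(F j) x * \1_(bumps n) x))) => //.
  + exact: L2_indic_bumps.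
  + apply: L2_dct => [m||x|m x]; [exact: L2_meas|exact: L2_indic_bumps| |].
      under eq_fun do rewrite -mulr_suml.
      by apply: cvgMl; exact: indic_trivIset_cvg.
    rewrite -mulr_suml !normrM ler_wpM2r//.
    have /andP[s0 s1] := @sum_indic_trivIset_bounded R _ F x m tF.
    rewrite ger0_norm// indicE; have [xU|xU] := boolP (x \in _).
      by rewrite normr1.
    rewrite big1 ?normr0// => j _; rewrite indicE memNset// => Fx.
    by move/negP: xU; apply; rewrite inE; exists j.
  + by move=> m; apply: test_approx_sum => j; [exact: L2_indic_bumps|exact: HF].
Qed.

Import HBNNSimple.

(** The simple functions increasing to [f] are cut off at [bumps n]. They remain below [f], hence in
    L2, and are finite combinations of the indicators treated above. *)
Lemma test_approx_ge0 f : L2 f -> (forall x, 0 <= f x) -> test_approx f.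
Proof.
move=> f2 f0; have mf : measurable_fun setT (EFin \o f).
  by apply/measurable_EFinP; exact: L2_meas f2.
pose h := nnsfun_approx measurableT mf.
have cvh x : (fun n => h n x) @ \oo --> f x.
  have := @cvg_nnsfun_approx _ _ _ _ measurableT _ mf (fun x _ => f0 x) x Logic.I.
  by move/fine_cvgP => [].
have hle n x : h n x <= f x.
  have ndh : nondecreasing_seq (fun n => h n x).
    by move=> a b ab; exact/lefP/nd_nnsfun_approx.
  by have := nondecreasing_cvgn_le ndh (cvgP _ (cvh x)) n; rewrite (cvg_lim _ (cvh x)).
have h0 n x : 0 <= h n x by [].
have F2 n : L2 (fun x => h n x * \1_(@bumps R N n) x).
  apply: (L2_le _ f2).
    by apply: measurable_funM; [by []|apply: measurable_indic; exact: measurable_bumps].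
  move=> x; have /andP[i0 i1] := @indic01 R _ (bumps n) x.
  by rewrite !ger0_norm ?mulr_ge0//; apply: le_trans (hle n x); rewrite ler_piMr.
apply: (@test_approx_lim (fun n x => h n x * \1_(@bumps R N n) x)) => //.
- apply: L2_dct => [n||x|n x]; [exact: L2_meas|by []| |].
    apply: cvg_trans (cvh x); apply: near_eq_cvg.
    have [n0 _ Hb] := bumps_cover x; exists n0 => // n /= /Hb bx.
    by rewrite indicE mem_set// mulr1.
  have /andP[i0 i1] := @indic01 R _ (bumps n) x.
  by rewrite !ger0_norm ?mulr_ge0//; apply: le_trans (hle n x); rewrite ler_piMr.
- move=> n.
  have mhr r : measurable (h n @^-1` [set r]) by exact: measurable_sfunP.
  have := @test_approx_sum _ (finmap.enum_fset (fset_set (range (h n))))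
    (fun r x => r * (\1_(h n @^-1` [set r]) x * \1_(@bumps R N n) x))
    (fun r => L2Z r (L2_indic_bumps n (mhr r)))
    (fun r => test_approxZ r (L2_indic_bumps n (mhr r)) (test_approx_indic n (mhr r))).
  congr test_approx; apply/funext => x.
  rewrite [in RHS]fimfunE fsbig_finite//= mulr_suml.
  by apply: eq_bigr => r _; rewrite mulrA.
Qed.

Theorem test_dense f : L2 f -> test_approx f.
Proof.
move=> f2; have mf := L2_meas f2.
have p2 : L2 (fun x => Num.max (f x) 0).
  apply: (L2_le _ f2) => [|x]; first exact: measurable_maxr.
  by case: (leP (f x) 0) => // fx; rewrite normr0.
have q2 : L2 (fun x => Num.max (- f x) 0).
  apply: (L2_le _ f2) => [|x]; first by apply: measurable_maxr => //; exact: measurableT_comp.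
  by case: (leP (- f x) 0) => // fx; rewrite ?normr0 ?normrN.
have max0 (a : R) : 0 <= Num.max a 0 by rewrite le_max lexx orbT.
have Ap := test_approx_ge0 p2 (fun x => max0 _).
have Aq := test_approx_ge0 q2 (fun x => max0 _).
have := test_approxD p2 (L2Z (-1) q2) Ap (test_approxZ (-1) q2 Aq).
congr test_approx; apply/funext => x.
case: (leP (f x) 0) => fx; case: (leP (- f x) 0) => fx'; lra.
Qed.

End L2_density.

(** * Translations and the chain rule *)

Section translations.
Context {R : realType} (N : nat).
Local Notation mu := (@lebesgue_row R N).
Local Notation L1 f := (mu.-integrable [set: 'rV[R]_N] (EFin \o f)).
Local Notation L2 := (L2 mu).
Implicit Types (f g k psi : 'rV[R]_N -> R) (x z : 'rV[R]_N).

Lemma measurable_shift f z : measurable_fun setT f ->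
  measurable_fun setT (fun x : 'rV[R]_N => f (x + z)).
Proof.
by move=> mf; apply: (@measurableT_comp _ _ _ _ _ _ f) => //; exact: measurable_row_shift.
Qed.

Lemma L1_shift f z : L1 f -> L1 (fun x => f (x + z)).
Proof.
move=> /integrableP[/measurable_EFinP mf fi]; apply/integrableP; split.
  by apply/measurable_EFinP; exact: measurable_shift.
rewrite (integral_shift (f := fun x => `|(f x)%:E|)%E)//.
by apply: measurableT_comp => //; exact/measurable_EFinP.
Qed.

(** Invariance is known for nonnegative integrands, and [f] is the difference of [|f| + f] and
    [|f|]. *)
Lemma Rint_shift f z : L1 f -> \int[mu]_x f (x + z) = \int[mu]_x f x.
Proof.
have H h : (forall x, 0 <= h x) -> L1 h -> \int[mu]_x h (x + z) = \int[mu]_x h x.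
  move=> h0 Ih; rewrite /Rintegral (integral_shift (f := fun x => (h x)%:E))//.
  by apply/measurable_EFinP; exact: L1_meas Ih.
move=> If; have In := L1_norm If; have Is := L1D In If.
have E : \int[mu]_x f x = \int[mu]_x (`|f x| + f x) - \int[mu]_x `|f x|.
  by rewrite -RintB//; apply: eq_Rint => x; ring.
rewrite E -(H _ _ Is) -?(H _ _ In)//; last first.
  by move=> x; rewrite -lerBlDr sub0r -normrN ler_norm.
rewrite -RintB; [|exact: (L1_shift z Is)|exact: (L1_shift z In)].
by apply: eq_Rint => x; ring.
Qed.

Lemma L2_shift f z : L2 f -> L2 (fun x => f (x + z)).
Proof.
by move=> [mf If]; split; [exact: measurable_shift|exact: (L1_shift z If)].
Qed.

Lemma locint_shift k z : loc_integrable k -> loc_integrable (fun x => k (x + z)).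
Proof.
move=> lk; apply/loc_integrableP; split=> [|M].
  by apply: measurable_shift; exact: locint_meas.
have [L L0 HL] : exists2 L, 0 < L & boxM L z.
  by have [L L0 HL] := compact_sub_boxM (@compact_set1 _ z); exists L => //; exact: HL.
apply: (L1_le _ (L1_norm (L1_shift z (locint_boxM (M + L) lk)))).
  apply: measurable_funM; first by apply: measurable_shift; exact: locint_meas.
  by apply: measurable_indic; exact: measurable_boxM.
move=> x; rewrite !normrM ler_wpM2l// !indicE.
have [Mx|_] := boolP (x \in boxM M); last by rewrite normr0.
rewrite (@mem_set _ (boxM (M + L)))// => i; rewrite mxE.
rewrite (le_trans (ler_normD _ _))// lerD//.
by move: Mx; rewrite inE => /(_ i).
Qed.

Lemma locint_test_shift k psi z : loc_integrable k -> test_function psi ->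
  L1 (fun x => k x * psi (x + z)).
Proof. by move=> lk /(test_shift z); exact: locint_test. Qed.

Local Notation e_ i := (basis_vec i : 'rV[R]_N).

Lemma is_derive_test_integral i k psi (a : R) : loc_integrable k -> test_function psi ->
  is_derive a (1 : R) (fun h : R => \int[mu]_x (k x * psi (x + h *: e_ i)))
    (\int[mu]_x (k x * 'D_(e_ i) psi (x + a *: e_ i))).
Proof.
move=> lk tpsi; have mk := locint_meas lk.
pose F (h : R) x := k x * psi (x + h *: e_ i).
have dF h x : is_derive h (1 : R) (F ^~ x) (k x * 'D_(e_ i) psi (x + h *: e_ i)).
  have H : is_derive h (1 : R) (fun t : R => psi (t *: e_ i + x)) ('D_(e_ i) psi (h *: e_ i + x)).
    by apply/is_derive_line; apply/derivableP/smooth_derivable; exact: test_smooth.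
  rewrite [x + _]addrC.
  have := @is_deriveZ _ _ _ (fun t : R => psi (t *: e_ i + x)) (k x) h 1 _ H.
  by congr is_derive; apply/funext => t; rewrite /F [x + _]addrC.
have [C C0 HC] := test_bounded (test_derive i tpsi).
have [_ [M M0 HM]] := (test_functionP _).1 (test_derive i tpsi).
(* A box containing the supports of all translates with [|h - a| < 1], which makes the majorant [G]
   independent of [h]. *)
pose M' := M + (`|a| + 1).
pose G x := C * `|k x * \1_(boxM M') x|.
have G0 x : 0 <= G x by rewrite mulr_ge0// ltW.
have IG : L1 G by apply/L1Z/L1_norm/locint_boxM.
have au : (a - 1 < a < a + 1) by lra.
have Ia : [set` `]a - 1, a + 1[] a by rewrite /= in_itv/=.
have IF h : [set` `]a - 1, a + 1[] h -> L1 (F h) by move=> _; exact: locint_test_shift.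
have dF1 h x : [set` `]a - 1, a + 1[] h -> [set: 'rV[R]_N] x -> derivable (F ^~ x) h 1.
  by move=> _ _; case: (dF h x).
have GF h x : [set` `]a - 1, a + 1[] h -> [set: 'rV[R]_N] x -> `|partial1of2 F h x| <= G x.
  rewrite /= in_itv/= => /andP[h1 h2] _.
  rewrite partial1of2E (@derive_val _ _ _ _ _ _ _ (dF h x)) /G !normrM mulrA [C * _]mulrC -mulrA ler_wpM2l//.
  rewrite indicE.
  have [->|Dx] := eqVneq ('D_(e_ i) psi (x + h *: e_ i)) 0.
    by rewrite normr0 mulr_ge0// ltW.
  rewrite mem_set ?normr1 ?mulr1// => j.
  have -> : x 0 j = (x + h *: e_ i) 0 j - h * e_ i 0 j by rewrite !mxE addrK.
  rewrite (le_trans (ler_normB _ _))// lerD//; first exact: HM.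
  rewrite normrM mxE /=.
  have h3 : `|h| <= `|a| + 1.
    rewrite (_ : h = a + (h - a)); last by ring.
    by rewrite (le_trans (ler_normD _ _))// lerD2l ler_norml; apply/andP; split; lra.
  by case: (_ == _); rewrite ?normr1 ?normr0 ?mulr1 ?mulr0// addr_ge0.
have := cvg_differentiation_under_integral measurableT Ia IF dF1 G0 IG GF.
have DE : \int[mu]_x partial1of2 F a x = \int[mu]_x (k x * 'D_(e_ i) psi (x + a *: e_ i)).
  by apply: eq_Rint => x; rewrite partial1of2E (@derive_val _ _ _ _ _ _ _ (dF a x)).
rewrite DE => H.
have E : (fun h : R => h^-1 *: (((fun h : R => \int[mu]_x F h x) \o shift a) (h *: (1 : R)) -
   \int[mu]_x F a x)) = (fun h : R => h^-1 *: (\int[mu]_x F (h + a) x - \int[mu]_x F a x)).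
  by apply/funext => h; rewrite /= [h *: 1]mulr1.
apply: DeriveDef; first by apply/cvg_ex; eexists; rewrite E; exact: H.
by apply: cvg_lim => //; rewrite E; exact: H.
Qed.

(** Duality for the L2 norm: it is enough to test with functions [psi] close to [k] itself. *)
Lemma Rint_dual_bound k (M : R) : L2 k -> 0 <= M ->
  (forall psi, test_function psi ->
    (\int[mu]_x (k x * psi x)) ^+ 2 <= M * \int[mu]_x psi x ^+ 2) ->
  \int[mu]_x k x ^+ 2 <= M.
Proof.
move=> k2 M0 H; apply/ler_addgt0Pr => e e0.
have [psi tpsi Hpsi] := test_dense k2 e0.
have p2 := L2_test tpsi; have := H _ tpsi.
have kp := L2M k2 p2; have k1 := L2_sq k2; have p1 := L2_sq p2.
have E : \int[mu]_x (k x - psi x) ^+ 2 =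
    \int[mu]_x k x ^+ 2 - 2 * \int[mu]_x (k x * psi x) + \int[mu]_x psi x ^+ 2.
  rewrite -RintZ// -RintB//; last exact: L1Z.
  rewrite -RintD//; last by apply: L1B => //; exact: L1Z.
  by apply: eq_Rint => x; ring.
move: Hpsi; rewrite E.
have a0 : 0 <= \int[mu]_x k x ^+ 2 by apply: Rint_ge0 => x; exact: sqr_ge0.
have b0 : 0 <= \int[mu]_x psi x ^+ 2 by apply: Rint_ge0 => x; exact: sqr_ge0.
move: (\int[mu]_x k x ^+ 2) (\int[mu]_x (k x * psi x)) (\int[mu]_x psi x ^+ 2) a0 b0.
move=> a c b a0 b0 H1 H2.
rewrite leNgt; apply/negP => H3.
have [b00|bpos] : b = 0 \/ 0 < b by move: b0; rewrite le_eqVlt => /orP[/eqP|]; [left|right].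
  have c0 : c = 0 by apply/eqP; rewrite -sqrf_eq0; apply/eqP; have := sqr_ge0 c; nra.
  by nra.
have h4 : (a + b - e) < 2 * c by lra.
have h5 : 0 < a - e by lra.
have h6 : (a + b - e) ^+ 2 < (2 * c) ^+ 2 by rewrite ltr_sqr ?nnegrE; lra.
(* If [M < a - e], then [(a + b - e)^2 < 4 c^2 <= 4 M b <= 4 (a - e) b], whereas
   [(a + b - e)^2 - 4 (a - e) b] is the square [(a - e - b)^2]. *)
have := sqr_ge0 ((a - e) - b).
nra.
Qed.

(** * Difference quotients and the chain rule *)

Section weak_derivative.
Context (i : 'I_N) (f g : 'rV[R]_N -> R).
Context (f2 : L2 f) (g2 : L2 g) (fg : weak_partial i f g).

(** The translation is moved onto [psi]. The resulting function [H] of the shift is differentiable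
    with derivative given by [g], so the mean value theorem and the Cauchy-Schwarz inequality
    conclude. *)
Lemma weak_partial_translation_dual psi (h : R) : test_function psi ->
  (\int[mu]_x ((f (x + h *: e_ i) - f x) * psi x)) ^+ 2 <=
  (h ^+ 2 * \int[mu]_x g x ^+ 2) * \int[mu]_x psi x ^+ 2.
Proof.
move=> tpsi; have lf := L2_locint f2; have p2 := L2_test tpsi.
pose H (s : R) := \int[mu]_x (f x * psi (x + s *: e_ i)).
have dH s : is_derive s (1 : R) H (- \int[mu]_x (g x * psi (x + s *: e_ i))).
  have [_ _ E] := fg; rewrite -E; last exact: (test_shift (s *: e_ i) tpsi).
  have -> : \int[mu]_x (f x * 'D_(e_ i) (fun y => psi (y + s *: e_ i)) x) =
      \int[mu]_x (f x * 'D_(e_ i) psi (x + s *: e_ i)).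
    by apply: eq_Rint => x; rewrite derive_shiftv//; exact: test_smooth.
  exact: is_derive_test_integral.
have E : \int[mu]_x ((f (x + h *: e_ i) - f x) * psi x) = H (- h) - H 0.
  transitivity (\int[mu]_x (f (x + h *: e_ i) * psi x - f x * psi x)).
    by apply: eq_Rint => x; rewrite mulrBl.
  rewrite RintB; [|exact: (L2M (L2_shift _ f2) p2)|exact: L2M]; congr (_ - _); last first.
    by apply: eq_Rint => x; rewrite scale0r addr0.
  rewrite /H -[RHS](Rint_shift (h *: e_ i) (locint_test_shift (- h *: e_ i) lf tpsi)).
  by apply: eq_Rint => x; rewrite scaleNr addrK.
have Hb s : (- \int[mu]_x (g x * psi (x + s *: e_ i))) ^+ 2 <=
    (\int[mu]_x g x ^+ 2) * \int[mu]_x psi x ^+ 2.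
  rewrite sqrrN (le_trans (Rint_CS g2 (L2_shift (s *: e_ i) p2)))//.
  by rewrite (Rint_shift (f := fun x => psi x ^+ 2))//; exact: L2_sq.
have cH : continuous H.
  by move=> s; apply/differentiable_continuous/derivable1_diffP; case: (dH s).
rewrite E; have [h0|h0] := leP 0 h.
  rewrite -[leLHS]sqrrN opprB.
  have [||c _ ->] := @MVT_segment R H _ (- h) 0 _ (fun s _ => dH s).
  - by rewrite oppr_le0.
  - exact: continuous_subspaceT.
  by rewrite sub0r opprK exprMn mulrC -mulrA ler_wpM2l ?sqr_ge0//; exact: Hb.
have [||c _ ->] := @MVT_segment R H _ 0 (- h) _ (fun s _ => dH s).
- by rewrite oppr_ge0 ltW.
- exact: continuous_subspaceT.
by rewrite subr0 exprMn (sqrrN h) mulrC -mulrA ler_wpM2l ?sqr_ge0//; exact: Hb.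
Qed.

Lemma weak_partial_translation (h : R) :
  \int[mu]_x (f (x + h *: e_ i) - f x) ^+ 2 <= h ^+ 2 * \int[mu]_x g x ^+ 2.
Proof.
apply: Rint_dual_bound; first by apply: L2B => //; exact: (L2_shift _ f2).
  by rewrite mulr_ge0 ?sqr_ge0//; apply: Rint_ge0 => x; exact: sqr_ge0.
by move=> psi; exact: weak_partial_translation_dual.
Qed.

Let hn (n : nat) : R := n.+1%:R^-1.
Let D n x := (hn n)^-1 * (f (x + hn n *: e_ i) - f x).

Let hn0 n : 0 < hn n. Proof. by rewrite invr_gt0. Qed.

Let D2 n : L2 (D n).
Proof. by apply: L2Z; apply: L2B => //; exact: (L2_shift _ f2). Qed.

Let D_bound n : \int[mu]_x D n x ^+ 2 <= \int[mu]_x g x ^+ 2.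
Proof.
have := weak_partial_translation (hn n).
rewrite -ler_pdivrMl ?exprn_gt0//; apply: le_trans.
rewrite -RintZ; last by apply: L2_sq; apply: L2B => //; exact: (L2_shift _ f2).
by rewrite le_eqVlt; apply/orP; left; apply/eqP; apply: eq_Rint => x; rewrite /D exprMn exprVn.
Qed.

(** After the translation is moved onto [psi], this is a difference quotient at 0 of a
    differentiable function, with steps [- hn n]. Local integrability of [k] suffices. *)
Lemma test_integral_quotient k psi : loc_integrable k -> test_function psi ->
  (fun n => (hn n)^-1 * \int[mu]_x ((k (x + hn n *: e_ i) - k x) * psi x)) @ \oo -->
  - \int[mu]_x (k x * 'D_(e_ i) psi x).
Proof.
move=> lk tpsi; pose H (s : R) := \int[mu]_x (k x * psi (x + s *: e_ i)).
have dH := is_derive_test_integral i 0 lk tpsi.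
have E n : (hn n)^-1 * \int[mu]_x ((k (x + hn n *: e_ i) - k x) * psi x) =
    - ((- hn n)^-1 * (H (- hn n) - H 0)).
  rewrite invrN mulNr opprK; congr (_ * _).
  transitivity (\int[mu]_x (k (x + hn n *: e_ i) * psi x - k x * psi x)).
    by apply: eq_Rint => x; rewrite mulrBl.
  rewrite RintB; [|by apply: locint_test => //; exact: locint_shift|exact: locint_test].
  congr (_ - _); last by apply: eq_Rint => x; rewrite scale0r addr0.
  rewrite /H -[RHS](Rint_shift (hn n *: e_ i) (locint_test_shift (- hn n *: e_ i) lk tpsi)).
  by apply: eq_Rint => x; rewrite scaleNr addrK.
under eq_fun do rewrite E.
apply: cvgN.
have dd : derivable H 0 1 by case: dH.
have vd : 'D_1 H 0 = \int[mu]_x (k x * 'D_(e_ i) psi x).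
  by case: dH => _ ->; apply: eq_Rint => x; rewrite scale0r addr0.
rewrite -vd.
have hc : (fun n => - hn n) @ \oo --> (0 : R)^'.
  have c0 : (fun n => - hn n) @ \oo --> (0 : R).
    by rewrite -oppr0; apply: cvgN; exact: cvg_harmonic.
  move=> A [e /= e0 eA]; have [n0 _ Hn] := (cvgrPdist_lt _ _).1 c0 _ e0.
  exists n0 => // n n0n; apply: eA; first exact: Hn.
  by rewrite oppr_eq0 gt_eqF.
have dc : (fun h : R => h^-1 *: ((H \o shift 0) (h *: (1 : R)) - H 0)) @ (0 : R)^' --> 'D_1 H 0.
  exact: dd.
have := cvg_comp _ _ hc dc; apply: cvg_trans; apply: near_eq_cvg; apply: nearW => n.
by rewrite /= addr0 [_ *: 1]mulr1.
Qed.

(** Weak convergence in L2 of the difference quotients [D n] to [g]: it holds against test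
    functions, and their density together with the uniform bound [D_bound] extends it to [Psi]. *)
Lemma weak_partial_quotient Psi : L2 Psi ->
  (fun n => \int[mu]_x (D n x * Psi x)) @ \oo --> \int[mu]_x (g x * Psi x).
Proof.
move=> P2; have [lf _ Hfg] := fg.
set G := \int[mu]_x g x ^+ 2.
have G0 : 0 <= G by apply: Rint_ge0 => x; exact: sqr_ge0.
apply/cvgrPdist_lt => e e0.
(* Replacing [Psi] by [psi] costs at most [dl * (4 * G + 1)], which this choice keeps below
   [e / 2]. *)
pose dl := e / (8 * (G + 1)).
have dl0 : 0 < dl by rewrite divr_gt0// mulr_gt0// ltr_wpDl.
have dlG : dl * (8 * (G + 1)) = e by rewrite /dl divfK// gt_eqF// mulr_gt0// ltr_wpDl.
have [psi tpsi Hpsi] := test_dense P2 (exprn_gt0 2 dl0).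
have p2 := L2_test tpsi.
have cpsi : (fun n => \int[mu]_x (D n x * psi x)) @ \oo --> \int[mu]_x (g x * psi x).
  have := test_integral_quotient lf tpsi.
  rewrite Hfg// opprK; apply: cvg_trans; apply: near_eq_cvg; apply: nearW => n.
  rewrite -RintZ; last by apply: L2M => //; apply: L2B => //; exact: (L2_shift _ f2).
  by apply: eq_Rint => x; rewrite /D mulrA.
have e4 : 0 < e / 4 by rewrite divr_gt0.
have [n0 _ Hn] := (cvgrPdist_lt _ _).1 cpsi _ e4.
exists n0 => // n /Hn /=.
have Dg2 : L2 (fun x => g x - D n x) by exact: L2B.
have Pp2 : L2 (fun x => Psi x - psi x) by exact: L2B.
rewrite -!RintB; [|exact: L2M|exact: L2M|exact: L2M|exact: L2M].
move=> H1.
have E : \int[mu]_x (g x * Psi x - D n x * Psi x) =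
  \int[mu]_x (g x * psi x - D n x * psi x) + \int[mu]_x ((g x - D n x) * (Psi x - psi x)).
  rewrite -RintD; [|by apply: L1B; exact: L2M|exact: L2M].
  by apply: eq_Rint => x; ring.
rewrite E (le_lt_trans (ler_normD _ _))//.
have B1 : \int[mu]_x (g x - D n x) ^+ 2 <= 4 * G.
  have := Rint_sqD_le g2 (L2N (D2 n)).
  rewrite (_ : \int[mu]_x (- D n x) ^+ 2 = \int[mu]_x (D n x) ^+ 2); last first.
    by apply: eq_Rint => x; rewrite sqrrN.
  by have := D_bound n; rewrite -/G; lra.
have B2 : `|\int[mu]_x ((g x - D n x) * (Psi x - psi x))| <= 
    dl * \int[mu]_x (g x - D n x) ^+ 2 + dl^-1 * \int[mu]_x (Psi x - psi x) ^+ 2.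
  rewrite (le_trans (Rint_norm (L2M Dg2 Pp2)))//.
  have I1 := L2_sq Dg2; have I2 := L2_sq Pp2.
  rewrite -!RintZ// -RintD; [|exact: L1Z|exact: L1Z].
  apply: Rint_le => [||x]; first by apply: L1_norm; exact: L2M.
    by apply: L1D; exact: L1Z.
  move: (g x - D n x) (Psi x - psi x) => a b.
  have dV : 0 < dl^-1 by rewrite invr_gt0.
  have dlV : dl * dl^-1 = 1 by rewrite mulfV// gt_eqF.
  have := sqr_ge0 (dl * a - b); have := sqr_ge0 (dl * a + b).
  rewrite ler_norml => S1 S2.
  have S1' : 0 <= dl^-1 * (dl * a + b) ^+ 2 by rewrite mulr_ge0 ?sqr_ge0 ?ltW.
  have S2' : 0 <= dl^-1 * (dl * a - b) ^+ 2 by rewrite mulr_ge0 ?sqr_ge0 ?ltW.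
  have E1 : dl^-1 * (dl * a + b) ^+ 2 = dl * a ^+ 2 + 2 * a * b + dl^-1 * b ^+ 2.
    by rewrite sqrrD !mulrDr; congr (_ + _ + _); field; rewrite gt_eqF.
  have E2 : dl^-1 * (dl * a - b) ^+ 2 = dl * a ^+ 2 - 2 * a * b + dl^-1 * b ^+ 2.
    by rewrite sqrrB !mulrDr mulrN; congr (_ - _ + _); field; rewrite gt_eqF.
  have T1 : 0 <= dl * a ^+ 2 by rewrite mulr_ge0 ?sqr_ge0 ?ltW.
  have T2 : 0 <= dl^-1 * b ^+ 2 by rewrite mulr_ge0 ?sqr_ge0 ?ltW.
  by apply/andP; split; lra.
have B3 : dl^-1 * \int[mu]_x (Psi x - psi x) ^+ 2 <= dl.
  by rewrite ler_pdivrMl// -expr2 ltW.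
have B4 : dl * \int[mu]_x (g x - D n x) ^+ 2 <= dl * (4 * G) by rewrite ler_pM2l.
have B5 : 0 <= dl * G by rewrite mulr_ge0// ltW.
by lra.
Qed.

(** Chain rule for [F] with a quadratic Taylor remainder. The quotient of [F (f x)] differs from
    [F' (f x)] times that of [f] by at most [K * hn n * D n x ^+ 2], whose integral tends to 0; the
    linear part converges weakly by [weak_partial_quotient]. *)
Lemma weak_partial_comp (F F' : R -> R) (K : R) :
  (forall a b, `|F b - F a - F' a * (b - a)| <= K * (b - a) ^+ 2) ->
  loc_integrable (fun x => F (f x)) -> loc_integrable (fun x => F' (f x) * g x) ->
  (forall psi, test_function psi -> L2 (fun x => F' (f x) * psi x)) ->
  weak_partial i (fun x => F (f x)) (fun x => F' (f x) * g x).
Proof.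
move=> HF lF lFg FP; split=> // psi tpsi.
have c1 := test_integral_quotient lF tpsi.
have c2 := weak_partial_quotient (FP _ tpsi).
have [C C0 HC] := test_bounded tpsi.
have K0 : 0 <= K.
  by have := HF 0 1; rewrite subr0 expr1n !mulr1; exact: (le_trans (normr_ge0 _)).
set G := \int[mu]_x g x ^+ 2.
have G0 : 0 <= G by apply: Rint_ge0 => x; exact: sqr_ge0.
have Hd n : `|(hn n)^-1 * \int[mu]_x ((F (f (x + hn n *: e_ i)) - F (f x)) * psi x) -
    \int[mu]_x (D n x * (F' (f x) * psi x))| <= hn n * (K * C * G).
  have IA : L1 (fun x => (F (f (x + hn n *: e_ i)) - F (f x)) * psi x).
    have := L1B (locint_test (locint_shift (hn n *: e_ i) lF) tpsi) (locint_test lF tpsi).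
    by apply: eq_L1 => x; rewrite mulrBl.
  have IB : L1 (fun x => D n x * (F' (f x) * psi x)) by apply: L2M => //; exact: FP.
  rewrite -RintZ// -RintB//; last exact: L1Z.
  rewrite (le_trans (Rint_norm _))//; first by apply: L1B => //; exact: L1Z.
  have ID := L2_sq (D2 n).
  apply: (@le_trans _ _ (\int[mu]_x (hn n * K * C * D n x ^+ 2))).
    apply: Rint_le => [||x].
    - by apply: L1_norm; apply: L1B => //; exact: L1Z.
    - exact: L1Z.
    have hV : (hn n)^-1 * (f (x + hn n *: e_ i) - f x) = D n x by [].
    have fE : f (x + hn n *: e_ i) - f x = hn n * D n x.
      by rewrite -hV mulrA divff ?mul1r// gt_eqF.
    have := HF (f x) (f (x + hn n *: e_ i)); rewrite fE => HFx.
    have -> : (hn n)^-1 * ((F (f (x + hn n *: e_ i)) - F (f x)) * psi x) -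
        D n x * (F' (f x) * psi x) =
      (hn n)^-1 * (F (f (x + hn n *: e_ i)) - F (f x) - F' (f x) * (hn n * D n x)) * psi x.
      by field; rewrite gt_eqF.
    rewrite 2!normrM normfV (gtr0_norm (hn0 n)).
    rewrite (_ : hn n * K * C * D n x ^+ 2 = (hn n)^-1 * (K * (hn n * D n x) ^+ 2) * C); last first.
      by field; rewrite gt_eqF.
    apply: ler_pM => //; first by rewrite mulr_ge0// invr_ge0 ltW.
    by rewrite ler_pM2l// invr_gt0.
  rewrite RintZ// -!mulrA ler_pM2l// !mulrA ler_wpM2l ?mulr_ge0// ?D_bound// ltW//.
have c3 : (fun n => (hn n)^-1 * \int[mu]_x ((F (f (x + hn n *: e_ i)) - F (f x)) * psi x) -
    \int[mu]_x (D n x * (F' (f x) * psi x))) @ \oo --> (0 : R).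
  have hc : (fun n => hn n * (K * C * G)) @ \oo --> (0 : R).
    by rewrite -(mul0r (K * C * G)); apply: cvgMl; exact: cvg_harmonic.
  apply/cvgr0Pnorm_lt => e e0.
  have [n0 _ Hn] := (cvgr0Pnorm_lt _).1 hc _ e0.
  exists n0 => // n /Hn; rewrite ger0_norm; first by apply: le_lt_trans; exact: Hd.
  by rewrite mulr_ge0 ?mulr_ge0// ltW.
have E : - (\int[mu]_x (F (f x) * 'D_(e_ i) psi x)) = \int[mu]_x (g x * (F' (f x) * psi x)).
  apply/eqP; rewrite -subr_eq0; apply/eqP.
  by rewrite -(cvg_lim _ c3)// (cvg_lim _ (cvgB c1 c2)).
rewrite -[LHS]opprK E; congr (- _); apply: eq_Rint => x; ring.
Qed.

End weak_derivative.
End translations.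

(** * Calculus of weak derivatives *)

Section weak_partial_calculus.
Context {R : realType} (N : nat).
Local Notation mu := (@lebesgue_row R N).
Local Notation L1 f := (mu.-integrable [set: 'rV[R]_N] (EFin \o f)).
Local Notation L2 := (L2 mu).
Implicit Types (f g k psi p : 'rV[R]_N -> R) (x z : 'rV[R]_N).

Lemma weak_partialD i f f' g g' : weak_partial i f g -> weak_partial i f' g' ->
  weak_partial i (fun x => f x + f' x) (fun x => g x + g' x).
Proof.
move=> [lf lg H] [lf' lg' H']; split; [exact: locintD|exact: locintD|move=> psi tpsi].
have td := test_derive i tpsi.
transitivity (\int[mu]_x (f x * 'D_(basis_vec i) psi x + f' x * 'D_(basis_vec i) psi x)).
  by apply: eq_Rint => x; rewrite mulrDl.
rewrite RintD; [|exact: locint_test|exact: locint_test].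
rewrite H// H'// -opprD -RintD; [|exact: locint_test|exact: locint_test].
by congr (- _); apply: eq_Rint => x; rewrite mulrDl.
Qed.

(** Test the relation for [f] with the test function [psi * p] and expand its derivative. *)
Lemma weak_partial_smoothM i f g p : weak_partial i f g -> smooth p ->
  weak_partial i (fun x => p x * f x) (fun x => p x * g x + 'D_(basis_vec i) p x * f x).
Proof.
move=> [lf lg H] sp; have cp := smooth_continuous sp.
have cdp := smooth_continuous (smooth_derive i sp).
have lpg := locint_continuousM lg cp; have ldf := locint_continuousM lf cdp.
split; [exact: locint_continuousM|exact: locintD|move=> psi tpsi].
have td := test_derive i tpsi.
have tpp : test_function (fun x => psi x * p x) by exact: testMr.
have tdp : test_function (fun x => psi x * 'D_(basis_vec i) p x).
  by apply: testMr => //; exact: smooth_derive.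
have tpd : test_function (fun x => 'D_(basis_vec i) psi x * p x) by exact: testMr.
have E x : 'D_(basis_vec i) (fun x => psi x * p x) x =
    psi x * 'D_(basis_vec i) p x + p x * 'D_(basis_vec i) psi x.
  rewrite -deriveM//; [exact: smooth_derivable (test_smooth tpsi) _|exact: smooth_derivable].
have := H _ tpp; under eq_Rint do rewrite E.
rewrite (_ : \int[mu]_x _ = \int[mu]_x (f x * (psi x * 'D_(basis_vec i) p x)) +
    \int[mu]_x (f x * ('D_(basis_vec i) psi x * p x))); last first.
  rewrite -RintD; [|exact: locint_test|exact: locint_test].
  by apply: eq_Rint => x; ring.
move=> H1.
rewrite (_ : \int[mu]_x _ = \int[mu]_x (f x * ('D_(basis_vec i) psi x * p x))); last first.
  by apply: eq_Rint => x; ring.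
rewrite (_ : \int[mu]_x ((_ + _) * _) = \int[mu]_x (g x * (psi x * p x)) +
    \int[mu]_x (f x * (psi x * 'D_(basis_vec i) p x))); last first.
  rewrite -RintD; [|exact: locint_test|exact: locint_test].
  by apply: eq_Rint => x; ring.
by lra.
Qed.

Lemma weak_partialZ i f g c : weak_partial i f g ->
  weak_partial i (fun x => c * f x) (fun x => c * g x).
Proof.
move=> fg; have := weak_partial_smoothM fg (smooth_cst N c).
by congr weak_partial; apply/funext => x; rewrite derive_cst mul0r addr0.
Qed.

Lemma weak_partialN i f g : weak_partial i f g ->
  weak_partial i (fun x => - f x) (fun x => - g x).
Proof.
by move=> /(weak_partialZ (-1)); congr weak_partial; apply/funext => x; rewrite mulN1r.
Qed.

Lemma weak_partialB i f f' g g' : weak_partial i f g -> weak_partial i f' g' ->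
  weak_partial i (fun x => f x - f' x) (fun x => g x - g' x).
Proof. by move=> H /weak_partialN; exact: weak_partialD. Qed.

Lemma eq_weak_partial i f f' g g' : f =1 f' -> g =1 g' ->
  weak_partial i f g -> weak_partial i f' g'.
Proof. by move=> /funext -> /funext ->. Qed.

Lemma locint_cst (c : R) : loc_integrable (fun _ : 'rV[R]_N => c).
Proof.
by apply/loc_integrableP; split=> // M; apply: L1Z; exact: L1_boxM.
Qed.

(** The difference quotients of a constant vanish, hence so does their limit: a derivative of a test
    function has integral 0. *)
Lemma weak_partial_cst (i : 'I_N) (c : R) : weak_partial i (fun=> c) (fun=> 0).
Proof.
split; [exact: locint_cst|exact: locint_cst|move=> psi tpsi].
have := test_integral_quotient (i := i) (locint_cst c) tpsi.
under eq_fun => n.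
  rewrite (_ : \int[mu]_x _ = 0); last first.
    by rewrite -(Rint_zero mu); apply: eq_Rint => x; rewrite subrr mul0r.
  rewrite mulr0; over.
move=> /cvg_cst_eq/eqP; rewrite oppr_eq0 => /eqP ->.
rewrite (_ : \int[mu]_x _ = 0) ?oppr0//.
by rewrite -[RHS](Rint_zero mu); apply: eq_Rint => x; rewrite mul0r.
Qed.

Lemma weak_partial_smooth i p : smooth p -> weak_partial i p ('D_(basis_vec i) p).
Proof.
move=> sp; have := weak_partial_smoothM (weak_partial_cst i 1) sp.
by apply: eq_weak_partial => x; rewrite ?mulr1// mulr0 add0r.
Qed.

Definition pos (s : R) := Num.max s 0.

Lemma pos_ge0 s : 0 <= pos s. Proof. by rewrite /pos le_max lexx orbT. Qed.

Lemma pos_ifE s : pos s = if 0 < s then s else 0.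
Proof. by rewrite /pos; case: ltgtP. Qed.

Lemma pos_le s c : 0 <= c -> pos (s - c) <= `|s|.
Proof.
move=> c0; rewrite pos_ifE; case: ifPn => // _.
by rewrite lerBlDr (le_trans (ler_norm s))// lerDl.
Qed.

Lemma measurable_pos f c : measurable_fun setT f -> measurable_fun setT (fun x => pos (f x - c)).
Proof. by move=> mf; apply: measurable_maxr => //; exact: measurable_funB. Qed.

Lemma L2_pos f c : L2 f -> 0 <= c -> L2 (fun x => pos (f x - c)).
Proof.
move=> f2 c0; apply: (L2_le _ f2) => [|x]; first exact: measurable_pos (L2_meas f2).
by rewrite ger0_norm ?pos_ge0// pos_le.
Qed.

Lemma weak_partial_sqr i f g : L2 f -> L2 g -> weak_partial i f g ->
  weak_partial i (fun x => f x ^+ 2) (fun x => 2 * f x * g x).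
Proof.
move=> f2 g2 fg.
apply: (@weak_partial_comp _ _ i f g f2 g2 fg (fun s => s ^+ 2) (fun s => 2 * s) 1) => [a b||| psi tpsi].
- by rewrite mul1r (_ : b ^+ 2 - a ^+ 2 - 2 * a * (b - a) = (b - a) ^+ 2) ?ger0_norm ?sqr_ge0//; ring.
- exact/L1_locint/L2_sq.
- by apply/L1_locint/L2M => //; exact: L2Z.
- have [C C0 HC] := test_bounded tpsi.
  have := L2_bounded_mul (L2Z 2 f2) (test_measurable tpsi) HC.
  by apply: eq_L2 => x; rewrite mulrC.
Qed.

(** [pos] itself has no quadratic Taylor remainder, but half its square has one. Differencing this
    square in the threshold, between [c] and [c + e n], gives functions [q n] tending to
    [pos (f - c)] whose derivatives [r n] tend to [g] on the set [c < f]; both limits are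
    dominated. *)
Lemma weak_partial_pos i f g c : L2 f -> L2 g -> weak_partial i f g -> 0 <= c ->
  weak_partial i (fun x => pos (f x - c)) (fun x => if c < f x then g x else 0).
Proof.
move=> f2 g2 fg c0.
have mf := L2_meas f2; have mg := L2_meas g2.
have half d : 0 <= d -> weak_partial i (fun x => pos (f x - d) ^+ 2 / 2) (fun x => pos (f x - d) * g x).
  move=> d0.
  apply: (@weak_partial_comp _ _ i f g f2 g2 fg (fun s => pos (s - d) ^+ 2 / 2) (fun s => pos (s - d)) (1/2)) => [a b||| psi tpsi].
  - have -> : b - a = (b - d) - (a - d) by ring.
    move: (b - d) (a - d) => p q /=; rewrite ler_norml !pos_ifE.
    have [p0 q0] : 0 <= p ^+ 2 /\ 0 <= q ^+ 2 by rewrite !sqr_ge0.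
    have E0 : (p - q) ^+ 2 = p ^+ 2 - 2 * (p * q) + q ^+ 2 by ring.
    have S := sqr_ge0 (p - q); rewrite E0 in S *; case: (ltP 0 p) => b0; case: (ltP 0 q) => a0; rewrite ?expr0n/= ?mul0r ?subr0.
    - by apply/andP; split; lra.
    - by have pq := mulr_ge0_le0 (ltW b0) a0; apply/andP; split; lra.
    - by have pq := mulr_le0_ge0 b0 (ltW a0); apply/andP; split; lra.
    - by have pq := mulr_le0 b0 a0; apply/andP; split; lra.
  - have := L1Zr (2^-1) (L2_sq (L2_pos f2 d0)); exact: L1_locint.
  - by apply/L1_locint/L2M => //; exact: L2_pos.
  - have [C C0 HC] := test_bounded tpsi.
    have := L2_bounded_mul (L2_pos f2 d0) (test_measurable tpsi) HC.
    by apply: eq_L2 => x; rewrite mulrC.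
pose e n : R := n.+1%:R^-1.
have e0 n : 0 < e n by rewrite invr_gt0.
have ce n : 0 <= c + e n by rewrite addr_ge0// ltW.
have p2 := L2_pos f2 c0.
have mc : measurable_fun setT (fun x => if c < f x then g x else 0).
  by apply: measurable_fun_if => //; [exact: measurable_fun_ltr|exact: measurable_funTS].
have lc : L2 (fun x => if c < f x then g x else 0).
  by apply: (L2_le mc g2) => x; case: ifPn => // _; rewrite normr0.
split; [exact: L2_locint|exact: L2_locint|move=> psi tpsi].
have td := test_derive i tpsi.
pose q n x := (e n)^-1 * (pos (f x - c) ^+ 2 / 2 - pos (f x - (c + e n)) ^+ 2 / 2).
pose r n x := (e n)^-1 * (pos (f x - c) - pos (f x - (c + e n))) * g x.
have W n : weak_partial i (q n) (r n).
  have := weak_partialZ (e n)^-1 (weak_partialB (half _ c0) (half _ (ce n))).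
  by apply: eq_weak_partial => x //; rewrite /r; ring.
have qb n x : pos (f x - c) - e n <= q n x <= pos (f x - c).
  rewrite /q; have -> : pos (f x - (c + e n)) = pos (pos (f x - c) - e n).
    by have := e0 n; rewrite !pos_ifE => en; do 3 case: ifPn => //; rewrite -?leNgt; lra.
  have := pos_ge0 (f x - c); move: (pos (f x - c)) => s s0.
  have en := e0 n; rewrite pos_ifE.
  move: (e n) en => t t0; rewrite ler_pdivlMl// ler_pdivrMl//.
  have t2 := sqr_ge0 t; have s2 := sqr_ge0 s.
  case: (ltP 0 (s - t)) => H; rewrite ?expr0n/= ?mul0r ?subr0.
    have -> : s ^+ 2 / 2 - (s - t) ^+ 2 / 2 = t * s - t ^+ 2 / 2 by field.
    by rewrite mulrBr -expr2; apply/andP; split; lra.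
  have st : s <= t by lra.
  have h1 : t * (s - t) <= 0 by rewrite mulr_ge0_le0// ltW.
  have h2 : s * s <= t * s by rewrite ler_wpM2r.
  by apply/andP; split; lra.
have q0 n x : 0 <= q n x.
  apply: mulr_ge0; first by rewrite invr_ge0 ltW.
  rewrite subr_ge0 ler_pM2r ?invr_gt0// lerXn2r ?nnegrE ?pos_ge0//.
  by have := e0 n; rewrite !pos_ifE => en; do 2 case: ifPn => //; rewrite -?leNgt; lra.
have rb n x : 0 <= (e n)^-1 * (pos (f x - c) - pos (f x - (c + e n))) <= 1.
  move: (e n) (e0 n) => t t0; rewrite ler_pdivrMl// mulr1; apply/andP; split.
    apply: mulr_ge0; first by rewrite invr_ge0 ltW.
    by rewrite !pos_ifE; do 2 case: ifPn => //; rewrite -?leNgt; lra.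
  by rewrite !pos_ifE; do 2 case: ifPn => //; rewrite -?leNgt; lra.
have ecvg : e @ \oo --> (0 : R) by exact: cvg_harmonic.
have cvq x : q ^~ x @ \oo --> pos (f x - c).
  apply: (@squeeze_cvgr _ _ _ _ (fun n => pos (f x - c) - e n) (fun=> pos (f x - c))).
  - by apply: nearW => n; exact: qb.
  - by rewrite -[X in _ --> X]subr0; apply: cvgB => //; exact: cvg_cst.
  - exact: cvg_cst.
have cvr x : r ^~ x @ \oo --> (if c < f x then g x else 0).
  case: ifPn => [cf|cf].
    apply: cvg_near_cst.
    have fc0 : 0 < f x - c by rewrite subr_gt0.
    have [n0 _ Hn] := (cvgr0Pnorm_lt _).1 ecvg _ fc0.
    exists n0 => // n /Hn; rewrite gtr0_norm ?e0// => en; have en0 := e0 n.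
    rewrite /r !pos_ifE fc0 ifT; last by lra.
    have -> : f x - c - (f x - (c + e n)) = e n by ring.
    by rewrite mulVf ?mul1r// gt_eqF.
  apply: cvg_near_cst; apply: nearW => n; rewrite /r !pos_ifE.
  have en0 := e0 n; rewrite -leNgt in cf.
  by rewrite !ifN ?subrr ?mulr0 ?mul0r// -leNgt; lra.
have mpsi := test_measurable tpsi; have mdpsi := test_measurable td.
have mq n : measurable_fun setT (q n) by case: (W n) => /locint_meas.
have mr n : measurable_fun setT (r n) by case: (W n) => _ /locint_meas.
have cv1 x : (fun n => q n x * 'D_(basis_vec i) psi x) @ \oo -->
    pos (f x - c) * 'D_(basis_vec i) psi x.
  by apply: cvgMl; exact: cvq.
have le1 n x : `|q n x * 'D_(basis_vec i) psi x| <= `|pos (f x - c) * 'D_(basis_vec i) psi x|.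
  rewrite normrM [leRHS]normrM ler_wpM2r// (ger0_norm (q0 n x)) ger0_norm ?pos_ge0//.
  by have /andP[] := qb n x.
have cv2 x : (fun n => r n x * psi x) @ \oo --> (if c < f x then g x else 0) * psi x.
  by apply: cvgMl; exact: cvr.
have le2 n x : `|r n x * psi x| <= `|g x * psi x|.
  have /andP[r0 r1] := rb n x; rewrite /r -mulrA normrM ger0_norm//.
  by rewrite ler_piMl.
have [_ C1] := Rint_dct (fun n => measurable_funM (mq n) mdpsi)
  (measurable_funM (measurable_pos c mf) mdpsi) cv1 (L1_norm (L2M p2 (L2_test td))) le1.
have [_ C2] := Rint_dct (fun n => measurable_funM (mr n) mpsi)
  (measurable_funM mc mpsi) cv2 (L1_norm (L2M g2 (L2_test tpsi))) le2.
rewrite -(cvg_lim _ C1)// -(cvg_lim _ (cvgN C2))//.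
by congr (lim (_ @ \oo)); apply/funext => n; case: (W n) => _ _ ->.
Qed.

Lemma is_derive_dotr_self (i : 'I_N) (x : 'rV[R]_N) :
  is_derive x (basis_vec i) (fun y : 'rV[R]_N => dotr y y) (2 * x 0 i).
Proof.
pose h (j : 'I_N) (y : 'rV[R]_N) := y 0 j.
have dh j : is_derive x (basis_vec i) (h j) (basis_vec i 0 j) := is_derive_coord j x (basis_vec i).
have H := @is_derive_sum _ _ _ N (fun j => h j * h j) x (basis_vec i) _
  (fun j => is_deriveM (dh j) (dh j)).
have E : \sum_(j < N) h j * h j = (fun y : 'rV[R]_N => dotr y y).
  by apply/funext => y; rewrite fct_sumE.
rewrite E in H; apply: is_derive_eq H _.
rewrite (bigD1 i)//= big1 => [|j ji]; rewrite /GRing.scale/= /basis_vec mxE eqxx/=.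
  by rewrite eqxx mulr1 addr0 /h; ring.
by rewrite (negbTE ji) mulr0 addr0.
Qed.

(** Equal to 1 at the origin and supported in the ball of radius [n.+1]. *)
Definition cutoff (n : nat) x : R := ballbump (n.+1%:R^-2) x / flat1 1.

Lemma flat1_mono (s t : R) : s <= t -> flat1 s <= flat1 t.
Proof.
move=> st; rewrite !flat1E; case: (ltP 0 s) => s0; last by case: ifPn => // _; rewrite expR_ge0.
by rewrite (lt_le_trans s0 st) ler_expR lerN2 lef_pV2// posrE (lt_le_trans s0 st).
Qed.

Lemma test_cutoff n : test_function (cutoff n).
Proof.
have n0 : 0 < n.+1%:R^-2 :> R by rewrite invr_gt0 exprn_gt0.
have := testZ (flat1 1)^-1 (@test_bump R N _ n0).
by congr test_function; apply/funext => x; rewrite mulrC.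
Qed.

Lemma cutoff01 n x : 0 <= cutoff n x <= 1.
Proof.
have f10 : 0 < flat1 1 :> R by rewrite flat1_gt0.
rewrite /cutoff divr_ge0 ?flat1_ge0//= ler_pdivrMr// mul1r.
by apply: flat1_mono; rewrite gerBl mulr_ge0// ?dotr_ge0// invr_ge0 exprn_ge0.
Qed.

Lemma cutoff_cvg x : cutoff ^~ x @ \oo --> (1 : R).
Proof.
have -> : (1 : R) = flat1 1 / flat1 1 by rewrite divff// gt_eqF// flat1_gt0.
apply: cvgMl.
have c : {for 1, continuous (@flat1 R)}.
  by apply/differentiable_continuous/derivable1_diffP; case: (is_derive_flat1 (1 : R)).
have H : (fun n : nat => 1 - n.+1%:R^-2 * dotr x x) @ \oo --> (1 : R).
  rewrite -[X in _ --> X](subr0 1) -(mul0r (dotr x x)).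
  apply: cvgB; first exact: cvg_cst.
  apply: cvgMl; rewrite -(mul0r 0).
  under eq_fun do rewrite expr2 invfM.
  by apply: cvgM; exact: cvg_harmonic.
exact: cvg_comp H c.
Qed.

(** On the support [|x_i| <= n.+1], so that the inner derivative [2 x_i / (n.+1)^2] is at most
    [2 / n.+1] in absolute value. *)
Lemma cutoff_derive : exists2 C, 0 < C &
  forall n i x, `|'D_(basis_vec i) (cutoff n) x| <= C * n.+1%:R^-1.
Proof.
have [C C0 HC] := @flatX2_bounded R.
have f10 : 0 < flat1 1 :> R by rewrite flat1_gt0.
exists (2 * C / flat1 1) => [|n i x]; first by rewrite divr_gt0// mulr_gt0.
set r : R := n.+1%:R^-2; have r0 : 0 < r by rewrite invr_gt0 exprn_gt0.
have dp : is_derive x (basis_vec i) (fun y : 'rV[R]_N => 1 - r * dotr y y) (- r * (2 * x 0 i)).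
  have H1 := @is_deriveZ _ _ _ (fun y : 'rV[R]_N => dotr y y) (- r) x _ _ (is_derive_dotr_self i x).
  have := is_deriveD (is_derive_cst (1 : R) x (basis_vec i)) H1.
  rewrite add0r; congr is_derive; apply/funext => y /=.
  by rewrite /GRing.scale/= -[in RHS]mulNr.
have dc : is_derive x (basis_vec i) (cutoff n)
    ((flat1 1)^-1 * (flat 'X^2 (1 - r * dotr x x) * (- r * (2 * x 0 i)))).
  have dpf : is_derive (1 - r * dotr x x) (1 : R) (@flat1 R) (flat 'X^2 (1 - r * dotr x x)).
    exact: is_derive_flat1.
  have H2 := is_derive_comp_real dpf dp.
  have := @is_deriveZ _ _ _ (fun y : 'rV[R]_N => flat1 (1 - r * dotr y y)) (flat1 1)^-1 x _ _ H2.
  by congr is_derive; apply/funext => y; rewrite /cutoff /ballbump /= [RHS]mulrC.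
rewrite (@derive_val _ _ _ _ _ _ _ dc).
rewrite normrM gtr0_norm ?invr_gt0// [2 * C / _]mulrC -!mulrA ler_pM2l ?invr_gt0//.
have [H|H] := leP (1 - r * dotr x x) 0.
  rewrite /flat ltNge H /= mul0r normr0 !mulr_ge0// ?invr_ge0// ltW//.
rewrite normrM (_ : 2 * (C / n.+1%:R) = C * (2 / n.+1%:R)); last by ring.
apply: ler_pM => //.
rewrite normrM normrN (gtr0_norm r0) normrM gtr0_norm// mulrCA ler_pM2l//.
have rE : r = n.+1%:R^-1 * n.+1%:R^-1 by rewrite /r expr2 invfM.
rewrite rE -mulrA ger_pMr ?invr_gt0// -(@ler_sqr _ _ 1) ?nnegrE ?mulr_ge0//.
rewrite expr1n exprMn exprVn real_normK ?num_real// -/r.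
have := coord_dotr_le x i; have : 0 < 1 - r * dotr x x by [].
move: (x 0 i ^+ 2) (dotr x x) => a b ab Hab.
by have := ler_wpM2l (ltW r0) Hab; lra.
Qed.

(** Integration by parts without compact support: apply the definition to [cutoff n * p]. The extra
    term contains the derivative of the cutoff, which tends to 0 uniformly, while [f * p] is
    integrable. *)
Lemma weak_partial_ibp i f g p : weak_partial i f g -> smooth p ->
  L1 (fun x => g x * p x) -> L1 (fun x => f x * 'D_(basis_vec i) p x) -> L1 (fun x => f x * p x) ->
  \int[mu]_x (f x * 'D_(basis_vec i) p x) = - \int[mu]_x (g x * p x).
Proof.
move=> [lf lg H] sp I1 I2 I3; have [C C0 HC] := cutoff_derive.
have tp n : test_function (fun x => cutoff n x * p x) by apply: testMr => //; exact: test_cutoff.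
have E n x : 'D_(basis_vec i) (fun x => cutoff n x * p x) x =
    cutoff n x * 'D_(basis_vec i) p x + p x * 'D_(basis_vec i) (cutoff n) x.
  rewrite -deriveM//; last exact: smooth_derivable.
  by apply: smooth_derivable; exact/test_smooth/test_cutoff.
have mchi n := test_measurable (test_cutoff n).
have mdchi n := test_measurable (test_derive i (test_cutoff n)).
have cvc h x : (fun n => h x * cutoff n x) @ \oo --> h x.
  by rewrite -[X in _ --> X]mulr1; apply: cvgMr; exact: cutoff_cvg.
have lec h n x : `|h x * cutoff n x| <= `|h x|.
  by have /andP[c0 c1] := cutoff01 n x; rewrite normrM ler_piMr// ger0_norm.
have [_ c1] := Rint_dct (fun n => measurable_funM (L1_meas I1) (mchi n)) (L1_meas I1)
  (cvc (fun x => g x * p x)) (L1_norm I1) (lec (fun x => g x * p x)).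
have [_ c2] := Rint_dct (fun n => measurable_funM (L1_meas I2) (mchi n)) (L1_meas I2)
  (cvc (fun x => f x * 'D_(basis_vec i) p x)) (L1_norm I2) (lec (fun x => f x * 'D_(basis_vec i) p x)).
have cv3 x : (fun n => f x * p x * 'D_(basis_vec i) (cutoff n) x) @ \oo --> (0 : R).
  rewrite -(mulr0 (f x * p x)); apply: cvgMr.
  have hc : (fun n : nat => C * n.+1%:R^-1) @ \oo --> (0 : R).
    by rewrite -(mulr0 C); apply: cvgMr; exact: cvg_harmonic.
  apply/cvgr0Pnorm_lt => e e0; have [n0 _ Hn] := (cvgr0Pnorm_lt _).1 hc _ e0.
  exists n0 => // n /Hn; rewrite ger0_norm; first by apply: le_lt_trans; exact: HC.
  by rewrite mulr_ge0 ?invr_ge0// ltW.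
have le3 n x : `|f x * p x * 'D_(basis_vec i) (cutoff n) x| <= C * `|f x * p x|.
  rewrite normrM mulrC ler_wpM2r// (le_trans (HC n i x))// ler_piMr//; first exact: ltW.
  by rewrite invf_le1// ler1n.
have [_ c3] := Rint_dct (fun n => measurable_funM (L1_meas I3) (mdchi n)) (measurable_cst (0 : R))
  cv3 (L1Z C (L1_norm I3)) le3.
have Hn n : \int[mu]_x (f x * 'D_(basis_vec i) p x * cutoff n x) +
    \int[mu]_x (f x * p x * 'D_(basis_vec i) (cutoff n) x) =
    - \int[mu]_x (g x * p x * cutoff n x).
  have -> : \int[mu]_x (g x * p x * cutoff n x) = \int[mu]_x (g x * (cutoff n x * p x)).
    by apply: eq_Rint => x; ring.
  rewrite -(H _ (tp n)) -RintD.
  - by apply: eq_Rint => x; rewrite E; ring.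
  - apply: (L1_le _ (L1_norm I2)); first by apply: measurable_funM => //; exact: L1_meas I2.
    exact: (lec (fun x => f x * 'D_(basis_vec i) p x)).
  - apply: (L1_le _ (L1Z C (L1_norm I3))) => //.
    by apply: measurable_funM => //; exact: L1_meas I3.
have c4 : (fun n => \int[mu]_x (f x * 'D_(basis_vec i) p x * cutoff n x) +
    \int[mu]_x (f x * p x * 'D_(basis_vec i) (cutoff n) x)) @ \oo -->
    \int[mu]_x (f x * 'D_(basis_vec i) p x).
  by rewrite -[X in _ --> X]addr0 -[X in _ + X](Rint_zero mu); apply: cvgD.
rewrite -(cvg_lim _ c4)// -(cvg_lim _ (cvgN c1))//.
by congr (lim (_ @ \oo)); apply/funext => n; exact: Hn.
Qed.

End weak_partial_calculus.

(** * Faber-Krahn and logarithmic Sobolev inequalities *)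

Section sobolev_data.
Context {R : realType} (N : nat).
Local Notation mu := (@lebesgue_row R N).
Local Notation L1 f := (mu.-integrable [set: 'rV[R]_N] (EFin \o f)).
Local Notation L2 := (L2 mu).
Implicit Types (f w : 'rV[R]_N -> R) (g : 'I_N -> 'rV[R]_N -> R) (x z : 'rV[R]_N).
Local Notation e_ i := (basis_vec i : 'rV[R]_N).

(** Membership in H^1 with the gradient kept as explicit data, since truncations come with formulas
    for their gradients. *)
Definition has_grad f g := [/\ L2 f, forall i, L2 (g i) & forall i, weak_partial i f (g i)].

Definition energy g : R := \sum_(i < N) \int[mu]_x (g i x) ^+ 2.

Lemma energy_ge0 g : 0 <= energy g.
Proof. by apply: sumr_ge0 => i _; apply: Rint_ge0 => x; exact: sqr_ge0. Qed.

Lemma has_gradN f g : has_grad f g -> has_grad (fun x => - f x) (fun i x => - g i x).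
Proof.
move=> [f2 g2 fg]; split=> [|i|i]; [exact: L2N|exact: L2N|exact: weak_partialN].
Qed.

Lemma energyN g : energy (fun i x => - g i x) = energy g.
Proof. by apply: eq_bigr => i _; apply: eq_Rint => x; rewrite sqrrN. Qed.

Lemma has_grad_pos f g c : has_grad f g -> 0 <= c ->
  has_grad (fun x => pos (f x - c)) (fun i x => if c < f x then g i x else 0).
Proof.
move=> [f2 g2 fg] c0; split=> [|i|i]; first exact: L2_pos.
  have mf := L2_meas f2; have mg := L2_meas (g2 i).
  apply: (L2_le _ (g2 i)) => [|x]; last by case: ifPn => // _; rewrite normr0.
  by apply: measurable_fun_if => //; [exact: measurable_fun_ltr|exact: measurable_funTS].
exact: weak_partial_pos.
Qed.

Lemma energy_pos f g c : has_grad f g -> 0 <= c ->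
  energy (fun i x => if c < f x then g i x else 0) <= energy g.
Proof.
move=> fg c0; have [_ h2 _] := has_grad_pos fg c0; have [_ g2 _] := fg.
apply: ler_sum => i _; apply: Rint_le => [||x]; [exact: L2_sq (h2 i)|exact: L2_sq|].
by case: ifPn => // _; rewrite expr0n sqr_ge0.
Qed.

(** The vector is decomposed along the coordinates; each further coordinate costs a factor 2 through
    [(p + q)^2 <= 2 p^2 + 2 q^2]. *)
Lemma translation_bound f g e z : has_grad f g -> (forall i, `|z 0 i| <= e) ->
  \int[mu]_x (f (x + z) - f x) ^+ 2 <= 2 ^+ N * (e ^+ 2 * energy g).
Proof.
move=> [f2 g2 fg] ze; pose zs (s : seq 'I_N) := \sum_(i <- s) z 0 i *: e_ i.
have H (s : seq 'I_N) : \int[mu]_x (f (x + zs s) - f x) ^+ 2 <=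
    2 ^+ size s * \sum_(i <- s) e ^+ 2 * \int[mu]_x (g i x) ^+ 2.
  elim: s => [|i s IH].
    rewrite big_nil mulr0 (_ : \int[mu]_x _ = 0)//.
    by rewrite -[RHS](Rint_zero mu); apply: eq_Rint => x; rewrite /zs big_nil addr0 subrr expr0n.
  set h := fun x => f (x + z 0 i *: e_ i) - f x.
  have h2 : L2 h by apply: L2B => //; exact: L2_shift.
  have hz2 : L2 (fun x => h (x + zs s)) by exact: L2_shift.
  have k2 : L2 (fun x => f (x + zs s) - f x) by apply: L2B => //; exact: L2_shift.
  have -> : \int[mu]_x (f (x + zs (i :: s)) - f x) ^+ 2 =
      \int[mu]_x (h (x + zs s) + (f (x + zs s) - f x)) ^+ 2.
    apply: eq_Rint => x; congr (_ ^+ 2); rewrite /h /zs big_cons.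
    by rewrite (addrC (z 0 i *: _)) addrA addrA subrK.
  apply: le_trans (Rint_sqD_le hz2 k2) _.
  rewrite (Rint_shift (zs s) (L2_sq h2)) big_cons /= [2 ^+ _.+1]exprS.
  have T := weak_partial_translation f2 (g2 i) (fg i) (z 0 i).
  have T2 : z 0 i ^+ 2 * \int[mu]_x (g i x) ^+ 2 <= e ^+ 2 * \int[mu]_x (g i x) ^+ 2.
    apply: ler_wpM2r; first by apply: Rint_ge0 => x; exact: sqr_ge0.
    by rewrite -[leLHS]real_normK ?num_real// lerXn2r// nnegrE// (le_trans _ (ze i)).
  rewrite -mulrA mulrDr mulrDr lerD//; last by rewrite ler_pM2l.
  rewrite ler_pM2l// (le_trans T)// (le_trans T2)// ler_peMl//.
    by rewrite mulr_ge0 ?sqr_ge0//; apply: Rint_ge0 => x; exact: sqr_ge0.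
  by rewrite -natrX ler1n expn_gt0.
have := H (index_enum 'I_N).
rewrite -mulr_sumr (_ : zs _ = z); last first.
  by rewrite /zs [RHS]row_sum_delta.
by rewrite [X in 2 ^+ X](_ : _ = N)// -[RHS]card_ord cardT enumT.
Qed.

Lemma Rint_fatou (F : nat -> 'rV[R]_N -> R) f (M : R) :
  (forall n, L1 (F n)) -> (forall n x, 0 <= F n x) -> (forall x, F ^~ x @ \oo --> f x) ->
  (forall n, \int[mu]_x F n x <= M) -> L1 f /\ \int[mu]_x f x <= M.
Proof.
move=> IF F0 Ff FM.
have mF n : measurable_fun setT (F n) by exact: L1_meas.
have mf : measurable_fun setT f.
  by apply: (measurable_fun_cvg (h := F)) => // x _; exact: Ff.
have f0 x : 0 <= f x.
  rewrite -(cvg_lim _ (Ff x))//; apply: limr_ge; last by apply: nearW => n; exact: F0.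
  by apply/cvg_ex; exists (f x); exact: Ff.
have H : (\int[mu]_x (f x)%:E <= M%:E)%E.
  have := @fatou _ _ _ mu _ measurableT (fun n x => (F n x)%:E) _ _.
  have -> : (\int[mu]_x (limn_einf (fun n => (F n x)%:E)) = \int[mu]_x (f x)%:E)%E.
    apply: eq_integral => x _.
    have c : ((fun n => (F n x)%:E) @ \oo --> (f x)%:E)%E by apply: cvg_EFin; [apply: nearW|exact: Ff].
    rewrite is_cvg_limn_einfE; first exact/cvg_lim.
    by apply/cvg_ex; exists (f x)%:E.
  move=> /(_ _ _)/le_trans; apply.
  - by move=> n; exact/measurable_EFinP.
  - by move=> n x _; rewrite lee_fin.
  rewrite limn_einf_lim; apply: lime_le; first exact: is_cvg_einfs.
  apply: nearW => n; apply: (@le_trans _ _ (\int[mu]_x (F n x)%:E)%E).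
    by apply: ereal_inf_lbound; exists n => /=.
  by rewrite -EFin_Rint// lee_fin.
have If : L1 f by apply/L1_ge0P => //; apply: le_lt_trans H _; rewrite ltry.
by split=> //; rewrite -lee_fin EFin_Rint.
Qed.

(** Enlarge the cube to the whole space; by Tonelli's theorem and translation invariance the double
    integral then factors. *)
Lemma autocorrelation w e : 0 <= e -> (forall x, 0 <= w x) -> measurable_fun setT w ->
  (\int[mu]_(z in cube N e) \int[mu]_x (w (x + z)%R * w x)%:E <=
   (\int[mu]_x (w x)%:E) * (\int[mu]_x (w x)%:E))%E.
Proof.
move=> e0 w0 mw.
have mF : measurable_fun setT (fun p : 'rV[R]_N * 'rV[R]_N => (w (p.1 + p.2) * w p.1)%:E).
  apply/measurable_EFinP; apply: measurable_funM.
    by apply: measurableT_comp => //; exact: measurable_row_add.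
  exact: measurableT_comp.
have F0 p : (0 <= (w (p.1 + p.2) * w p.1)%:E)%E by rewrite lee_fin mulr_ge0.
have := @fubini_tonelli _ _ _ _ _ mu mu _ mF F0.
rewrite /fubini_F /fubini_G /= => FT.
apply: (@le_trans _ _ (\int[mu]_z \int[mu]_x (w (x + z)%R * w x)%:E)%E).
  apply: ge0_subset_integral => //; first exact: measurable_cube.
    exact: (@measurable_fun_fubini_tonelli_G _ _ _ _ _ mu _ mF F0).
  by move=> z _; apply: integral_ge0 => x _; rewrite lee_fin mulr_ge0.
rewrite -FT -ge0_integralZr//; last 3 first.
- exact/measurable_EFinP.
- by move=> x _; rewrite lee_fin.
- by apply: integral_ge0 => x _; rewrite lee_fin.
apply: ge0_le_integral => //.
- by move=> x _; apply: integral_ge0 => z _; rewrite lee_fin mulr_ge0.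
- exact: (@measurable_fun_fubini_tonelli_F _ _ _ _ _ mu _ mF F0).
- by apply: emeasurable_funM; [exact/measurable_EFinP|exact: measurable_cst].
move=> x _; under eq_integral => z _ do rewrite mulrC EFinM addrC.
rewrite ge0_integralZl//.
- by rewrite (integral_shift x (f := fun z => (w z)%:E))//; first exact/measurable_EFinP.
- by apply/measurable_EFinP; exact: measurable_shift.
- by move=> z _; rewrite lee_fin.
- by rewrite lee_fin.
Qed.

(** For [z] in the cube of side [e], the translation bound makes the correlation of [w] with its
    translate at least [a - b / 2]. Integrating over the cube, [(a - b / 2) * e ^+ N <= (\int w)^2],
    and this is at most [a * e ^+ N / 2] by the Cauchy-Schwarz inequality on the small support.
    Hence [a <= b]. *)
Lemma faber_krahn w g e : has_grad w g -> 0 < e -> (forall x, 0 <= w x) ->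
  (mu [set x | (0 < w x)%R] <= (e ^+ N / 2)%:E)%E ->
  \int[mu]_x w x ^+ 2 <= 2 ^+ N * (e ^+ 2 * energy g).
Proof.
move=> wg e0 w0 mA; have [w2 g2 _] := wg.
set a := \int[mu]_x _; set b := 2 ^+ N * _.
have mw := L2_meas w2.
pose A := [set x | (0 < w x)%R].
have mAA : measurable A.
  have := mw measurableT `]0, +oo[%classic; rewrite setTI.
  rewrite (_ : _ @^-1` _ = A); first by apply.
  by apply/seteqP; split=> y /=; rewrite in_itv/= andbT.
have A1 : (mu A < +oo)%E by apply: le_lt_trans mA _; rewrite ltry.
have LA : L1 (\1_A : 'rV[R]_N -> R).
  by apply/L1_ge0P => //; rewrite integral_indic// setIT.
have L2A : L2 (\1_A : 'rV[R]_N -> R).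
  split; first exact: measurable_indic.
  by apply: eq_L1 LA => x; rewrite indicE; case: (_ \in _); rewrite ?expr1n ?expr0n.
have wA x : w x = w x * \1_A x.
  rewrite indicE; case: (boolP (x \in A)); rewrite ?mulr1// => /negP xA.
  by rewrite mulr0; apply/eqP; rewrite eq_le w0 andbT leNgt; apply/negP => H; apply: xA; rewrite inE.
have w1 : L1 w by apply: eq_L1 (L2M w2 L2A) => x; rewrite -wA.
have intA : \int[mu]_x (\1_A x) ^+ 2 <= e ^+ N / 2.
  rewrite (_ : \int[mu]_x _ = \int[mu]_x \1_A x); last first.
    by apply: eq_Rint => x; rewrite indicE; case: (_ \in _); rewrite ?expr1n ?expr0n.
  by rewrite -lee_fin EFin_Rint// integral_indic// setIT.
have CS : (\int[mu]_x w x) ^+ 2 <= a * (e ^+ N / 2).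
  rewrite (_ : \int[mu]_x w x = \int[mu]_x (w x * \1_A x)); last by apply: eq_Rint => x; exact: wA.
  apply: le_trans (Rint_CS w2 L2A) _; apply: ler_wpM2l => //.
  by apply: Rint_ge0 => x; exact: sqr_ge0.
have low z : cube N e z -> ((a - b / 2)%:E <= \int[mu]_x (w (x + z)%R * w x)%:E)%E.
  move=> ze; have wz2 := L2_shift z w2; 
  rewrite -EFin_Rint; last exact: L2M.
  rewrite lee_fin.
  have {}TB : \int[mu]_x (w (x + z) - w x) ^+ 2 <= b.
    by apply: translation_bound wg _ => i; have /andP[z0 ?] := ze i; rewrite ger0_norm.
  move: TB.
  have -> : \int[mu]_x (w (x + z) - w x) ^+ 2 = a + a - 2 * \int[mu]_x (w (x + z) * w x).
    have az : \int[mu]_x w (x + z) ^+ 2 = a by exact: (Rint_shift z (L2_sq w2)).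
    rewrite -{1}az -RintD; [|exact: L2_sq wz2|exact: L2_sq].
    rewrite -RintZ; last exact: L2M.
    rewrite -RintB; [|by apply: L1D; [exact: L2_sq wz2|exact: L2_sq]|by apply: L1Z; exact: L2M].
    by apply: eq_Rint => x; ring.
  by lra.
have eN : 0 < e ^+ N by rewrite exprn_gt0.
have a0 : 0 <= a by apply: Rint_ge0 => x; exact: sqr_ge0.
have [ab|ab] := leP a (b / 2); first by lra.
have ab0 : 0 <= a - b / 2 by lra.
have up : (a - b / 2) * e ^+ N <= a * (e ^+ N / 2).
  apply: le_trans CS; rewrite -lee_fin EFinM -(lebesgue_cube N (ltW e0)) expr2 EFinM EFin_Rint//.
  apply: le_trans (autocorrelation (ltW e0) w0 mw).
  rewrite -integral_cst; last exact: measurable_cube.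
  have mF : measurable_fun setT (fun p : 'rV[R]_N * 'rV[R]_N => (w (p.1 + p.2) * w p.1)%:E).
    apply/measurable_EFinP; apply: measurable_funM.
      by apply: measurableT_comp => //; exact: measurable_row_add.
    exact: measurableT_comp.
  apply: ge0_le_integral => //; first exact: measurable_cube.
  apply: measurable_funTS; apply: (@measurable_fun_fubini_tonelli_G _ _ _ _ _ mu _ mF).
  by move=> p; rewrite lee_fin mulr_ge0.
have {}up : (a - b / 2) * e ^+ N <= a / 2 * e ^+ N by rewrite (mulrAC a) -mulrA.
by rewrite ler_pM2r// in up; lra.
Qed.

(** Chebyshev's inequality bounds the measure of [f > t] by the integral of [f ^+ 2] over [t ^+ 2],
    which makes the support of [pos (f - t)] small enough for [faber_krahn] at scale [e]. *)
Lemma weak_type f g t e : has_grad f g -> 0 < t -> 0 < e ->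
  2 * \int[mu]_x f x ^+ 2 <= t ^+ 2 * e ^+ N ->
  \int[mu]_x pos (f x - t) ^+ 2 <= 2 ^+ N * (e ^+ 2 * energy g).
Proof.
move=> fg t0 e0 H; have [f2 _ _] := fg; have mf := L2_meas f2.
apply: (@le_trans _ _ (2 ^+ N * (e ^+ 2 * energy (fun i x => if t < f x then g i x else 0)))); last first.
  by rewrite ler_pM2l ?exprn_gt0// ler_pM2l ?exprn_gt0//; apply: energy_pos (ltW t0).
apply: faber_krahn => //; [exact: has_grad_pos (ltW t0)|by move=> x; exact: pos_ge0|].
set A := [set x | _]; have AE : A = [set x | t < f x].
  have E x : (0 < pos (f x - t)) = (t < f x).
    by rewrite pos_ifE subr_gt0; case: ifPn; rewrite ?subr_gt0// ltxx.
  by apply/seteqP; split=> x; rewrite /A /= E.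
have mA : measurable A.
  rewrite AE; have := mf measurableT `]t, +oo[%classic; rewrite setTI.
  rewrite (_ : _ @^-1` _ = [set x | t < f x]); first by apply.
  by apply/seteqP; split=> y /=; rewrite in_itv/= andbT.
have E1 : ((t ^+ 2)%:E * mu A <= (\int[mu]_x f x ^+ 2)%:E)%E.
  rewrite EFin_Rint; last exact: L2_sq.
  rewrite -integral_cst// integral_mkcond; apply: ge0_le_integral => //.
  - by move=> x _; rewrite patchE; case: ifPn => // _; rewrite lee_fin sqr_ge0.
  - by apply/(measurable_restrictT _ mA); exact: measurable_cst.
  - by apply/measurable_EFinP; exact: L1_meas (L2_sq f2).
  move=> x _; rewrite patchE; case: ifPn => [|_]; last by rewrite lee_fin sqr_ge0.
  rewrite AE inE /= => tf; rewrite lee_fin ler_pXn2r ?nnegrE// ltW//.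
  exact: lt_trans tf.
have t20 : 0 < t ^+ 2 by rewrite exprn_gt0.
rewrite -(@lee_pmul2l _ (t ^+ 2)%:E)//; apply: le_trans E1 _.
by rewrite -EFinM lee_fin; lra.
Qed.

Lemma ln2_le1 : ln (2 : R) <= 1.
Proof.
by have := @le_ln1Dx R 1; rewrite (_ : 1 + 1 = 2 :> R)//; apply; lra.
Qed.

(** If [|s|] lies between the heights of index [n] and [n + 1], the logarithm is at most
    [2 N (n + 1)], as [ln 2 <= 1], and each of the [n + 1] heights below [|s|] contributes at least
    [s^2 / 4], because [pos] subtracts only half of it. This accounts for the factor [8 N]. *)
Lemma layer_bound (s T : R) (n : nat) : 0 < T -> `|s| < T * 2 ^+ (N * n) ->
  s ^+ 2 * ln (Num.max 1 (s ^+ 2 / T ^+ 2)) <= 8 * N%:R *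
   \sum_(k < n) (pos (s - T * 2 ^+ (N * k) / 2) ^+ 2 + pos (- s - T * 2 ^+ (N * k) / 2) ^+ 2).
Proof.
move=> T0; elim: n => [|n IH sT].
  rewrite muln0 expr0 mulr1 big_ord0 mulr0 => sT.
  rewrite max_l ?ln1 ?mulr0//.
  rewrite ler_pdivrMr ?exprn_gt0// mul1r -real_normK ?num_real//.
  by rewrite ler_pXn2r ?nnegrE// ltW.
have [sn|ns] := ltP `|s| (T * 2 ^+ (N * n)).
  apply: (le_trans (IH sn)); rewrite ler_wpM2l//.
  by rewrite big_ord_recr/= lerDl addr_ge0// sqr_ge0.
have lnb : ln (Num.max 1 (s ^+ 2 / T ^+ 2)) <= 2 * N%:R * n.+1%:R.
  have -> : 2 * N%:R * n.+1%:R = (N * n.+1 * 2)%:R * 1 :> R by rewrite !natrM; ring.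
  apply: (@le_trans _ _ ((N * n.+1 * 2)%:R * ln 2)); last by rewrite ler_wpM2l// ln2_le1.
  rewrite mulr_natl -lnXn// ler_ln ?posrE ?lt_max ?ltr01 ?exprn_gt0// ge_max.
  rewrite -natrX ler1n expn_gt0/= natrX ler_pdivrMr ?exprn_gt0// exprM -exprMn mulrC.
  rewrite -real_normK ?num_real// ler_pXn2r ?nnegrE ?(ltW sT)//.
  by rewrite mulr_ge0 ?(ltW T0)// exprn_ge0.
have term (k : 'I_n.+1) : s ^+ 2 / 4 <= pos (s - T * 2 ^+ (N * k) / 2) ^+ 2 + pos (- s - T * 2 ^+ (N * k) / 2) ^+ 2.
  have kn : T * 2 ^+ (N * k) <= `|s|.
    apply: le_trans ns; rewrite ler_pM2l// -!natrX ler_nat leq_exp2l// leq_mul2l.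
    by rewrite -ltnS ltn_ord orbT.
  have p0 : 0 < T * 2 ^+ (N * k) by rewrite mulr_gt0// exprn_gt0.
  move: (T * _) kn p0 => tau kn p0.
  have -> : s ^+ 2 / 4 = (`|s| / 2) ^+ 2 by rewrite expr_div_n real_normK ?num_real//; congr (_ / _); ring.
  have key (r : R) : tau <= r -> (r / 2) ^+ 2 <= pos (r - tau / 2) ^+ 2.
    move=> tr; rewrite ler_pXn2r ?nnegrE ?pos_ge0//; last by lra.
    by rewrite pos_ifE; case: ltP; lra.
  move: kn; have [s0|s0] := leP 0 s; last first.
    by rewrite ltr0_norm// => kn; rewrite (le_trans (key _ kn))// lerDr sqr_ge0.
  by rewrite ger0_norm// => kn; rewrite (le_trans (key _ kn))// lerDl sqr_ge0.
apply: (@le_trans _ _ (8 * N%:R * \sum_(k < n.+1) s ^+ 2 / 4)); last first.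
  by rewrite ler_wpM2l ?mulr_ge0//; apply: ler_sum => k _; exact: term.
rewrite sumr_const card_ord -mulr_natr.
apply: (le_trans (ler_wpM2l (sqr_ge0 s) lnb)).
by rewrite le_eqVlt; apply/orP; left; apply/eqP; field.
Qed.

Lemma measurable_sqln f (c : R) : measurable_fun setT f ->
  measurable_fun setT (fun x => f x ^+ 2 * ln (Num.max 1 (f x ^+ 2 / c))).
Proof.
move=> mf; have m2 : measurable_fun setT (fun x => f x ^+ 2) by exact: measurable_funX.
apply: measurable_funM => //; apply: measurableT_comp => //.
by apply: measurable_maxr => //; exact: measurable_funM.
Qed.

(** The layer of height [T * 2 ^+ (N * k)] is estimated by [weak_type] at scale [e * 4^-k]. The
    bounds are geometric of ratio 1/16, so their sum is controlled by the energy alone. *)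
Lemma log_sobolev_level f g (e : R) : (0 < N)%N -> has_grad f g -> 0 < e -> 0 < \int[mu]_x f x ^+ 2 ->
  let T2 := 8 * (\int[mu]_x f x ^+ 2) / e ^+ N in
  L1 (fun x => f x ^+ 2 * ln (Num.max 1 (f x ^+ 2 / T2))) /\
  \int[mu]_x (f x ^+ 2 * ln (Num.max 1 (f x ^+ 2 / T2))) <=
    32 * N%:R * 2 ^+ N * (e ^+ 2 * energy g).
Proof.
move=> N0 fg e0; set a := \int[mu]_x _ => a0 T2; have [f2 _ _] := fg; have mf := L2_meas f2.
have T20 : 0 < T2 by rewrite divr_gt0 ?exprn_gt0// mulr_gt0.
pose T := Num.sqrt T2; have T0 : 0 < T by rewrite sqrtr_gt0.
have TT : T ^+ 2 = T2 by rewrite sqr_sqrtr// ltW.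
pose tau k := T * 2 ^+ (N * k) / 2; have tau0 k : 0 < tau k.
  by rewrite divr_gt0// mulr_gt0// exprn_gt0.
set h := fun x => _; have mh : measurable_fun setT h by exact: measurable_sqln.
have h0 x : 0 <= h x.
  by rewrite mulr_ge0 ?sqr_ge0// ln_ge0// le_max lexx.
pose P k x := pos (f x - tau k) ^+ 2 + pos (- f x - tau k) ^+ 2.
have IP k : L1 (P k).
  by apply: L1D; apply: L2_sq; apply: L2_pos (ltW (tau0 k)) => //; exact: L2N.
have BP k : \int[mu]_x P k x <= 2 * 2 ^+ N * (e ^+ 2 * energy g) * (16^-1) ^+ k.
  have ek : 0 < e * (4^-1) ^+ k by rewrite mulr_gt0// exprn_gt0.
  (* An equality: it determines [T2] and balances the growth [2 ^+ (N * k)] of the heights against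
     the scales [4^-k]. *)
  have cond : 2 * a <= tau k ^+ 2 * (e * (4^-1) ^+ k) ^+ N.
    rewrite /tau exprMn exprMn TT /T2 exprMn -!exprM mulnC exprM.
    rewrite (_ : 2 ^+ 2 = 4); last by rewrite expr2 -natrM.
    have pq : 4 ^+ (N * k) * (4^-1 : R) ^+ (k * N) = 1.
      by rewrite (mulnC k) -exprMn divff// expr1n.
    have eN : e ^+ N != 0 by rewrite gt_eqF// exprn_gt0.
    suff -> : 8 * a / e ^+ N * 4 ^+ (N * k) * 2^-1 ^+ 2 * (e ^+ N * 4^-1 ^+ (k * N)) =
        2 * a * (4 ^+ (N * k) * 4^-1 ^+ (k * N)) by rewrite pq mulr1.
    by move: (_ ^+ N) (4 ^+ _) (_ ^+ (k * N)) eN => E p q E0; field.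
  have W1 := weak_type fg (tau0 k) ek cond.
  have cond' : 2 * \int[mu]_x (- f x) ^+ 2 <= tau k ^+ 2 * (e * (4^-1) ^+ k) ^+ N.
    by rewrite (_ : \int[mu]_x _ = a)//; apply: eq_Rint => x; rewrite sqrrN.
  have W2 := weak_type (has_gradN fg) (tau0 k) ek cond'.
  rewrite energyN in W2; rewrite RintD; [|exact: L2_sq (L2_pos f2 (ltW (tau0 k)))|exact: L2_sq (L2_pos (L2N f2) (ltW (tau0 k)))].
  apply: (le_trans (lerD W1 W2)); rewrite exprMn -exprM mulnC exprM.
  rewrite (_ : 4^-1 ^+ 2 = 16^-1 :> R); last by rewrite exprVn; congr (_^-1); ring.
  by rewrite le_eqVlt; apply/orP; left; apply/eqP; ring.
(* Truncation to finitely many layers, removed at the end by Fatou's lemma, which also yields the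
   integrability of [h]. *)
pose F n x := h x * (\1_[set y | `|f y| < T * 2 ^+ (N * n)] x).
have mI n : measurable [set y : 'rV[R]_N | `|f y| < T * 2 ^+ (N * n)].
  have mn : measurable_fun setT (fun y => `|f y|) by exact: measurableT_comp.
  have := mn measurableT `]-oo, (T * 2 ^+ (N * n))[%classic; rewrite setTI.
  rewrite (_ : _ @^-1` _ = [set y : 'rV[R]_N | `|f y| < T * 2 ^+ (N * n)]); first by apply.
  by apply/seteqP; split=> y /=; rewrite in_itv.
have mF n : measurable_fun setT (F n) by apply: measurable_funM => //; exact: measurable_indic.
have F0 n x : 0 <= F n x by rewrite mulr_ge0// indicE.
have FP n x : F n x <= 8 * N%:R * \sum_(k < n) P k x.
  rewrite /F indicE; case: (boolP (x \in _)); rewrite ?mulr1 ?mulr0.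
    by rewrite inE /= /h -TT => /layer_bound; exact.
  by move=> _; rewrite mulr_ge0// sumr_ge0// => k _; rewrite addr_ge0// sqr_ge0.
have IS n : L1 (fun x => 8 * N%:R * \sum_(k < n) P k x) by apply: L1Z; apply: L1_sum => k.
have IF n : L1 (F n).
  by apply: (L1_le (mF n) (IS n)) => x; rewrite ger0_norm// FP.
have geo n : \sum_(k < n) (16^-1 : R) ^+ k <= 2 * (1 - (16^-1) ^+ n).
  elim: n => [|n IH]; first by rewrite big_ord0 expr0 subrr mulr0.
  rewrite big_ord_recr/= exprS; have : 0 < (16^-1 : R) ^+ n by rewrite exprn_gt0.
  by move: (_ ^+ n) IH => q IH q0; lra.
apply: (Rint_fatou IF F0) => [x|n].
  apply: cvg_near_cst.
  have [n Hn] : exists n : nat, `|f x| / T < n%:R.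
    by exists (Num.trunc (`|f x| / T)).+1; rewrite truncnS_gt.
  exists n.+1 => // m /= nm; rewrite /F indicE mem_set ?mulr1//=.
  rewrite -ltr_pdivrMl// mulrC (lt_le_trans Hn)//.
  rewrite -natrX ler_nat (leq_trans (ltnW nm))//.
  by rewrite (leq_trans (ltnW (ltn_expl m (isT : 1 < 2)%N)))// leq_exp2l// leq_pmull.
apply: (@le_trans _ _ (8 * N%:R * \sum_(k < n) 2 * 2 ^+ N * (e ^+ 2 * energy g) * (16^-1) ^+ k)).
  apply: (le_trans (Rint_le (IF n) (IS n) (FP n))).
  rewrite RintZ; last by apply: L1_sum => k.
  by rewrite Rint_sum// ler_wpM2l//; apply: ler_sum => k _; exact: BP.
rewrite -mulr_sumr; have E0 : 0 <= 2 ^+ N * (e ^+ 2 * energy g).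
  by apply: mulr_ge0; [exact: exprn_ge0|apply: mulr_ge0; [exact: sqr_ge0|exact: energy_ge0]].
have q0 : 0 < (16^-1 : R) ^+ n by rewrite exprn_gt0.
rewrite (_ : 32 * N%:R * _ * _ = 8 * N%:R * (2 * 2 ^+ N * (e ^+ 2 * energy g) * 2)); last by ring.
rewrite ler_wpM2l// ler_wpM2l//; first by rewrite -mulrA mulr_ge0.
by apply: (le_trans (geo n)); lra.
Qed.

(** The factor in front of the energy is made small by the scale [e]; lowering the level from [T2]
    to the integral of [f ^+ 2] costs only a multiple of that integral. *)
Lemma log_sobolev (eta : R) : (0 < N)%N -> 0 < eta -> exists2 C : R, 0 <= C &
  forall f g, has_grad f g -> 0 < \int[mu]_x f x ^+ 2 ->
  L1 (fun x => f x ^+ 2 * ln (Num.max 1 (f x ^+ 2 / \int[mu]_x f x ^+ 2))) /\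
  \int[mu]_x (f x ^+ 2 * ln (Num.max 1 (f x ^+ 2 / \int[mu]_x f x ^+ 2))) <=
    eta * energy g + C * \int[mu]_x f x ^+ 2.
Proof.
move=> N0 eta0; pose K : R := 32 * N%:R * 2 ^+ N.
have K0 : 0 <= K by rewrite !mulr_ge0// exprn_ge0.
pose e := Num.sqrt (eta / (K + 1)).
have e0 : 0 < e by rewrite sqrtr_gt0 divr_gt0// ltr_pwDr.
have Ke : K * e ^+ 2 <= eta.
  rewrite sqr_sqrtr; last by rewrite divr_ge0 ?(ltW eta0)// addr_ge0.
  by rewrite mulrCA ger_pMr// ler_pdivrMr ?mul1r ?lerDl// ltr_pwDr.
pose M := 8 / e ^+ N; have M0 : 0 < M by rewrite divr_gt0// exprn_gt0.
exists (ln (Num.max 1 M)); first by rewrite ln_ge0// le_max lexx.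
move=> f g fg a0; have [I B] := log_sobolev_level N0 fg e0 a0; have [f2 _ _] := fg.
move: a0 I B; set a := \int[mu]_x f x ^+ 2 => a0 I B.
(* With [q = f^2 / a], this is [ln max(1, q) <= ln max(1, q / M) + ln max(1, M)]. *)
have pw x : f x ^+ 2 * ln (Num.max 1 (f x ^+ 2 / a)) <=
    f x ^+ 2 * ln (Num.max 1 (f x ^+ 2 / (8 * a / e ^+ N))) + ln (Num.max 1 M) * f x ^+ 2.
  rewrite (mulrC (ln _)) -mulrDr ler_wpM2l ?sqr_ge0//.
  rewrite -lnM ?posrE ?lt_max ?ltr01//.
  rewrite ler_ln ?posrE ?mulr_gt0 ?lt_max ?ltr01//.
  have -> : f x ^+ 2 / (8 * a / e ^+ N) = f x ^+ 2 / a / M.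
    by rewrite /M; field; rewrite !gt_eqF// exprn_gt0.
  have : 0 <= f x ^+ 2 / a by rewrite divr_ge0 ?sqr_ge0// ltW.
  move: (_ / a) => q q0; rewrite ge_max; apply/andP; split.
    by apply: mulr_ege1; rewrite le_max lexx.
  rewrite -[leLHS](divfK (lt0r_neq0 M0)).
  have M1 : M <= Num.max 1 M by rewrite le_max lexx orbT.
  have q1 : q / M <= Num.max 1 (q / M) by rewrite le_max lexx orbT.
  by apply: ler_pM => //; [exact: divr_ge0 q0 (ltW M0)|exact: ltW].
have nn x : 0 <= f x ^+ 2 * ln (Num.max 1 (f x ^+ 2 / a)).
  by rewrite mulr_ge0 ?sqr_ge0// ln_ge0// le_max lexx.
have IS := L1D I (L1Z (ln (Num.max 1 M)) (L2_sq f2)).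
have IL : L1 (fun x => f x ^+ 2 * ln (Num.max 1 (f x ^+ 2 / a))).
  by apply: (L1_le _ IS) => [|x]; [exact: measurable_sqln (L2_meas f2)|by rewrite ger0_norm].
split=> //; apply: (le_trans (Rint_le IL IS pw)).
rewrite RintD//; last by apply: L1Z; exact: L2_sq.
rewrite RintZ; last exact: L2_sq.
rewrite lerD2r (le_trans B)// -/K mulrA ler_wpM2r// energy_ge0//.
Qed.

End sobolev_data.

(** * Transfer to the Gaussian space *)

Section Lfun2.
Context d (T : measurableType d) (R : realType) (nu : {measure set T -> \bar R}).
Implicit Types f : T -> R.

Lemma Lnorm2_integral f :
  ('N[nu]_2%:E[EFin \o f] = (\int[nu]_x (f x ^+ 2)%:E) `^ 2^-1)%E.
Proof.
rewrite unlock /=; congr (_ `^ _)%E; apply: eq_integral => x _.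
by rewrite /= powR_mulrn// real_normK// num_real.
Qed.

Lemma Lfun2P f : f \in Lfun nu 2%:E <-> L2 nu f.
Proof.
split.
  move=> /andP[/= /[!inE] mf ff].
  split=> //; apply/L1_ge0P; [exact: measurable_funX|by move=> x; exact: sqr_ge0|].
  have := @poweR_Lnorm _ _ _ nu (EFin \o f) 2 (lt0r_neq0 (ltr0Sn _ 1)).
  have -> : (\int[nu]_x (`|(EFin \o f) x| `^ 2) = \int[nu]_x (f x ^+ 2)%:E)%E.
    by apply: eq_integral => x _; rewrite /= powR_mulrn// real_normK// num_real.
  by move=> <-; exact: poweR_lty.
move=> [mf f2]; apply/andP; split; first by rewrite inE.
rewrite inE /= /finite_norm Lnorm2_integral poweR_lty//.
by apply/L1_ge0P => // [|x]; [exact: measurable_funX|exact: sqr_ge0].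
Qed.

Lemma Lnorm2E f : L2 nu f ->
  ('N[nu]_2%:E[EFin \o f] = (Num.sqrt (\int[nu]_x f x ^+ 2))%:E)%E.
Proof.
move=> f2; rewrite Lnorm2_integral -EFin_Rint; last exact: L2_sq.
by rewrite poweR_EFin powR12_sqrt//; apply: Rint_ge0 => x; exact: sqr_ge0.
Qed.

End Lfun2.

(** * Gaussian functions and their moments *)

Section gaussian_functions.
Context {R : realType} (N : nat).
Local Notation mu := (@lebesgue_row R N).
Local Notation L1 f := (mu.-integrable [set: 'rV[R]_N] (EFin \o f)).
Implicit Types (x b : 'rV[R]_N) (a : R).

Definition gaus a x : R := expR (- a * dotr x x).

Lemma gaus_gt0 a x : 0 < gaus a x. Proof. exact: expR_gt0. Qed.

Lemma gaus_le1 a x : 0 <= a -> gaus a x <= 1.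
Proof. by move=> a0; rewrite /gaus -expR0 ler_expR mulNr oppr_le0 mulr_ge0// dotr_ge0. Qed.

Lemma gausD a a' x : gaus (a + a') x = gaus a x * gaus a' x.
Proof. by rewrite /gaus -expRD; congr expR; ring. Qed.

Lemma gaus_mono a a' x : a <= a' -> gaus a' x <= gaus a x.
Proof. by move=> aa'; rewrite /gaus ler_expR !mulNr lerN2 ler_wpM2r// dotr_ge0. Qed.

Lemma smooth_gaus a : smooth (@gaus a).
Proof. by apply: smooth_expR; apply: smoothZ; exact: smooth_dotr_self. Qed.

Lemma measurable_gaus a : measurable_fun setT (@gaus a).
Proof. exact: smooth_measurable (smooth_gaus a). Qed.

Lemma is_derive_gaus a (i : 'I_N) x :
  is_derive x (basis_vec i) (gaus a) (- 2 * a * x 0 i * gaus a x).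
Proof.
have H1 := @is_deriveZ _ _ _ (fun y : 'rV[R]_N => dotr y y) (- a) x _ _ (is_derive_dotr_self i x).
have H2 := is_derive_comp_real (is_derive_expR (- a * dotr x x)) H1.
by apply: is_derive_eq H2 _; rewrite /GRing.scale/= /gaus; ring.
Qed.

Lemma derive_gaus a (i : 'I_N) x : 'D_(basis_vec i) (gaus a) x = - 2 * a * x 0 i * gaus a x.
Proof. exact: (@derive_val _ _ _ _ _ _ _ (is_derive_gaus a i x)). Qed.

(** Half of the exponent pays for the quadratic factor, by [s <= exp s]. *)
Lemma dotr_gaus_le a x : 0 < a -> dotr x x * gaus a x <= 2 / a * gaus (a / 2) x.
Proof.
move=> a0; rewrite [X in gaus X](_ : a = a / 2 + a / 2); last by field.
rewrite gausD mulrA; apply: ler_wpM2r; first exact/ltW/gaus_gt0.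
have H : a / 2 * dotr x x <= expR (a / 2 * dotr x x).
  by apply: le_trans (expR_ge1Dx _); rewrite lerDr.
rewrite {1}/gaus mulNr expRN ler_pdivrMr ?expR_gt0//.
rewrite -[leLHS](_ : 2 / a * (a / 2 * dotr x x) = _); last by field; exact: lt0r_neq0.
by rewrite ler_wpM2l// divr_ge0// ltW.
Qed.

End gaussian_functions.

Lemma gauss_integral_lty {R : realType} (N : nat) (a : R) : 0 < a ->
  (\int[lebesgue_row N]_x (gaus a x)%:E < +oo)%E.
Proof.
move=> a0; elim: N => [|N IH].
  rewrite /= integral_dirac//; last by apply/measurable_EFinP; exact: measurable_gaus.
  by rewrite diracE in_setT mul1e ltry.
have I1 : (\int[@lebesgue_measure R]_t (expR (- a * t ^+ 2))%:E < +oo)%E.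
  (* The standard deviation for which the normal density is [exp (- a t^2)] up to its peak value. *)
  pose s : R := Num.sqrt (2 * a)^-1.
  have s0 : 0 < s by rewrite sqrtr_gt0 invr_gt0 mulr_gt0.
  have s2 : s ^+ 2 = (2 * a)^-1 by rewrite sqr_sqrtr// invr_ge0 mulr_ge0// ltW.
  have := integrable_normal_pdf 0 s => /integrableP[mi ii].
  have p0 : 0 < normal_peak s by exact: normal_peak_gt0 (lt0r_neq0 s0).
  have E t : expR (- a * t ^+ 2) = (normal_peak s)^-1 * `|normal_pdf 0 s t|.
    rewrite ger0_norm ?normal_pdf_ge0// normal_pdfE ?(lt0r_neq0 s0)// mulKf ?lt0r_neq0//.
    rewrite /normal_fun subr0 s2; congr expR; rewrite mulr2n; field; exact: lt0r_neq0.
  under eq_integral do rewrite E EFinM.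
  rewrite ge0_integralZl//.
  - by rewrite lte_mul_pinfty// lee_fin invr_ge0 ltW.
  - apply/measurable_EFinP; apply: measurableT_comp => //; exact/measurable_EFinP.
  - by rewrite lee_fin invr_ge0 ltW.
rewrite integral_cons; last 2 first.
- by apply/measurable_EFinP; exact: measurable_gaus.
- by move=> x; rewrite lee_fin ltW// gaus_gt0.
have E (t : R) (x : 'rV[R]_N) : gaus a (cons_row (t, x)) = expR (- a * t ^+ 2) * gaus a x.
  rewrite /gaus -expRD; congr expR; rewrite /dotr big_ord_recl /cons_row !mxE unlift_none/=.
  rewrite mulrDr expr2; congr (_ + _ * _).
  by apply: eq_bigr => i _; rewrite !mxE liftK.
under eq_integral => t _.
  under eq_integral => x _ do rewrite E EFinM.
  rewrite ge0_integralZl//; last 2 first.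
  - by apply/measurable_EFinP; exact: measurable_gaus.
  - by move=> x _; rewrite lee_fin ltW// gaus_gt0.
  over.
have m1 : measurable_fun setT (fun t : R => (expR (- a * t ^+ 2))%:E).
  by apply/measurable_EFinP; apply: measurableT_comp => //; apply: measurable_funM.
rewrite ge0_integralZr//.
- apply: lte_mul_pinfty => //; first by apply: integral_ge0 => t _; rewrite lee_fin expR_ge0.
  by rewrite ge0_fin_numE//; apply: integral_ge0 => t _; rewrite lee_fin expR_ge0.
- by apply: integral_ge0 => x _; rewrite lee_fin ltW// gaus_gt0.
Qed.

Section gaussian_integrability.
Context {R : realType} (N : nat).
Local Notation mu := (@lebesgue_row R N).
Local Notation L1 f := (mu.-integrable [set: 'rV[R]_N] (EFin \o f)).
Local Notation L2 := (L2 mu).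
Implicit Types (x b : 'rV[R]_N) (a : R).

Lemma L1_gaus a : 0 < a -> L1 (gaus a).
Proof.
move=> a0; apply/L1_ge0P => [|x|]; first exact: measurable_gaus.
  by rewrite ltW// gaus_gt0.
exact: gauss_integral_lty.
Qed.

Lemma L2_gaus a : 0 < a -> L2 (gaus a).
Proof.
move=> a0; split; first exact: measurable_gaus.
have a2 : 0 < a + a by rewrite addr_gt0.
by apply: eq_L1 (L1_gaus a2) => x; rewrite gausD expr2.
Qed.

Lemma measurable_coord (i : 'I_N) : measurable_fun setT (fun x : 'rV[R]_N => x 0 i).
Proof. exact: measurable_row_coord. Qed.

Lemma coord_gaus_le a (i : 'I_N) x : 0 < a ->
  `|x 0 i * gaus a x| <= (1 + 2 / a) * gaus (a / 2) x.
Proof.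
move=> a0; rewrite normrM [X in _ * X]ger0_norm; last by rewrite ltW// gaus_gt0.
have H : `|x 0 i| <= 1 + dotr x x.
  have := coord_dotr_le x i; have := sqr_ge0 (`|x 0 i| - 1).
  rewrite -[X in X <= dotr _ _ -> _]real_normK ?num_real//.
  have := normr_ge0 (x 0 i); move: `|_| (dotr _ _) => s t s0; rewrite sqrrB1 => h1 h2; nra.
apply: (@le_trans _ _ ((1 + dotr x x) * gaus a x)); first by rewrite ler_wpM2r// ltW// gaus_gt0.
rewrite mulrDl [leRHS]mulrDl !mul1r; apply: lerD; last exact: dotr_gaus_le.
by apply: gaus_mono; lra.
Qed.

Lemma L2_coord_gaus a (i : 'I_N) : 0 < a -> L2 (fun x => x 0 i * gaus a x).
Proof.
move=> a0; have a2 : 0 < a / 2 by rewrite divr_gt0.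
apply: (L2_le _ (L2Z (1 + 2 / a) (L2_gaus a2))) => [|x].
  by apply: measurable_funM; [exact: measurable_coord|exact: measurable_gaus].
rewrite [leRHS]ger0_norm ?coord_gaus_le// mulr_ge0 ?ltW ?gaus_gt0//.
by rewrite addr_gt0// divr_gt0.
Qed.

Lemma has_grad_gaus a : 0 < a ->
  has_grad (gaus a) (fun i x => - 2 * a * x 0 i * gaus a x).
Proof.
move=> a0; split=> [|i|i]; first exact: L2_gaus.
  by apply: eq_L2 (L2Z (- 2 * a) (L2_coord_gaus i a0)) => x; rewrite mulrA.
have := weak_partial_smooth i (@smooth_gaus R N a).
by apply: eq_weak_partial => x //; exact: derive_gaus.
Qed.

End gaussian_integrability.

Section gaussian_transfer.
Context {R : realType} (N : nat).
Local Notation mu := (@lebesgue_row R N).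
Local Notation nu := (@gauss_measure R N).
Local Notation L1 f := (mu.-integrable [set: 'rV[R]_N] (EFin \o f)).
Implicit Types (x b : 'rV[R]_N) (f h k : 'rV[R]_N -> R).

Lemma gamE x : gam x = gaus (pi / 2) x :> R.
Proof. by rewrite /gam /gaus enorm_sqr. Qed.

Lemma gam_gt0 x : 0 < gam x :> R. Proof. by rewrite gamE gaus_gt0. Qed.

Lemma gam_neq0 x : gam x != 0 :> R. Proof. by rewrite gt_eqF// gam_gt0. Qed.

Lemma measurable_gam2 : measurable_fun setT (fun x => gam x ^+ 2 : R).
Proof. by apply: measurable_funX; exact: measurable_gam. Qed.

Lemma ge0_integral_gauss (h : 'rV[R]_N -> \bar R) : measurable_fun setT h ->
  (forall x, 0 <= h x)%E ->
  (\int[nu]_x h x = \int[mu]_x (h x * (gam x ^+ 2)%:E))%E.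
Proof.
move=> mh h0; apply: ge0_integral_density => //; first exact: measurable_gam2.
by move=> x; exact: sqr_ge0.
Qed.

Lemma integral_gauss h : measurable_fun setT h ->
  (\int[nu]_x (h x)%:E = \int[mu]_x (h x * gam x ^+ 2)%:E)%E.
Proof.
move=> mh; have mE : measurable_fun setT (EFin \o h) by exact/measurable_EFinP.
rewrite integralE [RHS]integralE !ge0_integral_gauss//; last 2 first.
- exact: measurable_funeneg.
- exact: measurable_funepos.
congr (_ - _)%E; apply: eq_integral => x _.
  by rewrite !funeposE -EFin_max -EFin_max -EFinM maxr_pMl ?sqr_ge0// mul0r.
by rewrite !funenegE -EFinN -EFin_max -EFinN -EFin_max -EFinM maxr_pMl ?sqr_ge0// mul0r mulNr.
Qed.

Lemma gauss_L1P h : measurable_fun setT h ->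
  nu.-integrable [set: 'rV[R]_N] (EFin \o h) <-> L1 (fun x => h x * gam x ^+ 2).
Proof.
move=> mh; have mn : measurable_fun setT (fun x => `|h x|) by exact: measurableT_comp.
have E : (\int[nu]_x `|(h x)%:E| = \int[mu]_x `|(h x * gam x ^+ 2)%:E|)%E.
  rewrite -[LHS]/(\int[nu]_x (`|h x|)%:E)%E integral_gauss//.
  by apply: eq_integral => x _; rewrite /= normrM (ger0_norm (sqr_ge0 (gam x))).
split=> /integrableP[m i]; apply/integrableP; split.
- by apply/measurable_EFinP; apply: measurable_funM => //; exact: measurable_gam2.
- by rewrite -E.
- exact/measurable_EFinP.
- by rewrite E.
Qed.

Lemma gauss_Rint h : measurable_fun setT h ->
  \int[nu]_x h x = \int[mu]_x (h x * gam x ^+ 2).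
Proof. by move=> mh; rewrite /Rintegral integral_gauss. Qed.

Lemma measurable_div_gam f : measurable_fun setT f -> measurable_fun setT (fun x => f x / gam x).
Proof.
move=> mf; rewrite (_ : (fun x => _) = fun x => f x * gaus (- (pi / 2)) x).
  by apply: measurable_funM => //; exact: measurable_gaus.
by apply/funext => x; rewrite gamE /gaus opprK mulNr expRN invrK.
Qed.

Lemma gauss_L2 f : L2 mu f <-> L2 nu (fun x => f x / gam x).
Proof.
have E x : (f x / gam x) ^+ 2 * gam x ^+ 2 = f x ^+ 2.
  by rewrite -exprMn divfK// gam_neq0.
split=> [[mf f2]|[mf f2]].
  have mg := measurable_div_gam mf; split => //.
  by apply/gauss_L1P; [exact: measurable_funX|apply: eq_L1 f2 => x; rewrite E].
have mf' : measurable_fun setT f.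
  have := measurable_funM mf (@measurable_gam R N); apply: eq_measurable_fun => x _ /=.
  by rewrite divfK// gam_neq0.
split=> //; move/gauss_L1P : f2 => /(_ (measurable_funX _ mf)).
by apply: eq_L1 => x; rewrite E.
Qed.

(** The density is everywhere positive, so both measures have the same null sets. *)
Lemma ae_gauss (P : 'rV[R]_N -> Prop) :
  {ae nu, forall x, P x} <-> {ae mu, forall x, P x}.
Proof.
split=> -[A [mA A0 AP]]; exists A; split=> //.
  have mg : measurable_fun A (fun x => (gam x ^+ 2 : R)%:E).
    by apply/measurable_EFinP; apply: measurable_funTS; exact: measurable_gam2.
  have H : (\int[mu]_(x in A) `|(gam x ^+ 2)%:E| = 0)%E.
    by rewrite -[RHS]A0; apply: eq_integral => x _; rewrite /= ger0_norm// sqr_ge0.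
  have [B [mB B0 BP]] := (ae_eq_integral_abs mu mA mg).1 H.
  apply: (subset_measure0 mA mB) => // x Ax; apply: BP => /(_ Ax) [] /eqP.
  by rewrite expf_eq0/= (negbTE (gam_neq0 x)).
apply: null_set_integral => //.
by apply/measurable_EFinP; apply: measurable_funTS; exact: measurable_gam2.
Qed.


Lemma transfer_smooth : smooth (fun x : 'rV[R]_N => (gam x)^-1).
Proof.
have := @smooth_gaus R N (- (pi / 2)).
by congr smooth; apply/funext => x; rewrite gamE /gaus opprK mulNr expRN invrK.
Qed.

Lemma derive_inv_gam (i : 'I_N) x :
  'D_(basis_vec i) (fun y : 'rV[R]_N => (gam y)^-1) x = pi * x 0 i / gam x.
Proof.
have E (y : 'rV[R]_N) : (gam y)^-1 = gaus (- (pi / 2)) y :> R.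
  by rewrite gamE /gaus opprK mulNr expRN invrK.
rewrite (_ : (fun y => _) = gaus (- (pi / 2))); last by apply/funext => y; exact: E.
by rewrite derive_gaus E; field.
Qed.

End gaussian_transfer.

(** * Dirichlet energy, entropy and deficit in the two settings *)

Section gaussian_space.
Context {R : realType} (N : nat).
Local Notation mu := (@lebesgue_row R N).
Local Notation nu := (@gauss_measure R N).
Local Notation L1 f := (mu.-integrable [set: 'rV[R]_N] (EFin \o f)).
Local Notation L2at m := (L2 m).
Local Notation L2 := (L2 mu).
Implicit Types (x b : 'rV[R]_N) (f h k : 'rV[R]_N -> R) (g : 'I_N -> 'rV[R]_N -> R).

(** [weak_gradient] is an arbitrary choice; uniqueness identifies it with [g] off a Lebesgue-null
    set. The hypothesis on null sets lets [m] be the Lebesgue or the Gaussian measure. *)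
Lemma dirichletE (m : {measure set 'rV[R]_N -> \bar R}) f g :
  (forall P, {ae mu, forall x, P x} -> {ae m, forall x : 'rV[R]_N, P x}) ->
  (forall i, weak_partial i f (g i)) -> (forall i, L2at m (g i)) -> loc_integrable f ->
  dirichlet m f = (\sum_(i < N) \int[m]_x (g i x) ^+ 2)%:E.
Proof.
move=> mum fg g2 lf.
pose G x : 'rV[R]_N := \row_i g i x.
have WG : is_weak_gradient f G.
  apply/weak_gradientP; split=> // i; apply: eq_weak_partial (fg i) => // x.
  by rewrite mxE.
have /weak_gradientP[_ H] : is_weak_gradient f (weak_gradient f).
  by rewrite /weak_gradient; apply: xgetPex; exists G.
have mwg i : measurable_fun setT (fun x => weak_gradient f x 0 i).
  by case: (H i) => _ /locint_meas.
rewrite -(Rint_sum _ (fun i => L2_sq (g2 i))) EFin_Rint; last first.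
  by apply: L1_sum => i; exact: L2_sq.
rewrite (_ : dirichlet m f = \int[m]_x (dotr (weak_gradient f x) (weak_gradient f x))%:E)%E; last first.
  by apply: eq_integral => x _; rewrite enorm_sqr.
apply: ge0_ae_eq_integral => //.
- apply/measurable_EFinP; apply: measurable_sum => i.
  by apply: measurable_funM; exact: mwg.
- by apply/measurable_EFinP; apply: measurable_sum => i; apply: measurable_funX; exact: L2_meas.
- by move=> x _; rewrite lee_fin dotr_ge0.
- by move=> x _; rewrite lee_fin sumr_ge0// => i _; exact: sqr_ge0.
have HH : {ae m, forall x, forall i, weak_gradient f x 0 i = g i x}.
  apply: mum; have : forall i, {ae mu, forall x, weak_gradient f x 0 i = g i x}.
    by move=> i; exact: weak_partial_unique (H i) (fg i).
  move=> Hi; have := @filter_forall _ _ _ _ (ae_filter_ringOfSetsType mu) Hi.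
  by apply: filterS.
apply: filterS HH => x Hx _; congr EFin; apply: eq_bigr => i _.
by rewrite Hx expr2.
Qed.

Lemma entropyE f : L2 f -> L1 (fun x => f x ^+ 2 * ln (f x ^+ 2 / \int[mu]_x f x ^+ 2)) ->
  entropy mu f = (\int[mu]_x (f x ^+ 2 * ln (f x ^+ 2 / \int[mu]_x f x ^+ 2)))%:E.
Proof.
move=> f2 If; rewrite EFin_Rint// /entropy Lnorm2E//= sqr_sqrtr//.
by apply: Rint_ge0 => x; exact: sqr_ge0.
Qed.

Lemma deficitE f g : has_grad f g ->
  L1 (fun x => f x ^+ 2 * ln (f x ^+ 2 / \int[mu]_x f x ^+ 2)) ->
  deficit f = (energy g - pi * \int[mu]_x (f x ^+ 2 * ln (f x ^+ 2 / \int[mu]_x f x ^+ 2))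
    - N%:R * pi * \int[mu]_x f x ^+ 2)%:E.
Proof.
move=> [f2 g2 fg] If; rewrite /deficit entropyE// (dirichletE (g := g))//; last exact: L2_locint.
by rewrite -EFin_Rint//; exact: L2_sq.
Qed.

(** Integration by parts of [f ^+ 2] against the coordinate [x_i], whose derivative is 1. The moment
    hypothesis makes the products integrable. *)
Lemma coord_ibp f g (i : 'I_N) : has_grad f g -> L2 (fun x => x 0 i * f x) ->
  2 * \int[mu]_x (x 0 i * f x * g i x) = - \int[mu]_x f x ^+ 2.
Proof.
move=> [f2 g2 fg] xf2.
have sx : smooth (fun x : 'rV[R]_N => x 0 i) by exact: smooth_coord.
have dx x : 'D_(basis_vec i) (fun y : 'rV[R]_N => y 0 i) x = 1.
  by rewrite (@derive_val _ _ _ _ _ _ _ (is_derive_coord i x (basis_vec i))) /basis_vec mxE !eqxx.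
have := weak_partial_ibp (weak_partial_sqr f2 (g2 i) (fg i)) sx.
move=> /(_ _ _ _); rewrite (_ : \int[mu]_x (f x ^+ 2 * _) = \int[mu]_x f x ^+ 2); last first.
  by apply: eq_Rint => x; rewrite dx mulr1.
move=> ->; first last.
- by apply: eq_L1 (L2M f2 xf2) => x; ring.
- by apply: eq_L1 (L2_sq f2) => x; rewrite dx mulr1.
- by apply: eq_L1 (L1Z 2 (L2M xf2 (g2 i))) => x; ring.
by rewrite opprK -RintZ; [apply: eq_Rint => x; ring|exact: L2M].
Qed.

Lemma gauss_has_grad f g (i : 'I_N) : has_grad f g ->
  weak_partial i (fun x => f x / gam x) (fun x => (g i x + pi * (x 0 i * f x)) / gam x).
Proof.
move=> [f2 g2 fg]; have := weak_partial_smoothM (fg i) (@transfer_smooth R N).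
apply: eq_weak_partial => x; first by rewrite mulrC.
rewrite derive_inv_gam; ring.
Qed.

Lemma gauss_H1 f g : has_grad f g -> (forall i, L2 (fun x => x 0 i * f x)) ->
  H1 nu (fun x => f x / gam x).
Proof.
move=> fg xf; have [f2 g2 _] := fg; split; first exact/Lfun2P/gauss_L2.
exists (fun x => \row_i ((g i x + pi * (x 0 i * f x)) / gam x)); last first.
  move=> i; apply/Lfun2P; under eq_fun do rewrite mxE.
  by apply/gauss_L2; apply: L2D => //; exact: L2Z.
apply/weak_gradientP; split.
  have := locint_continuousM (L2_locint f2) (smooth_continuous (@transfer_smooth R N)).
  by congr loc_integrable; apply/funext => x; rewrite mulrC.
move=> i; apply: eq_weak_partial (gauss_has_grad i fg) => // x.
by rewrite mxE.
Qed.

(** Let [W] be the integral of [|x|^2 f^2]. Dividing by [gam] adds [pi^2 W - N pi a] to the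
    Dirichlet energy, the cross terms being evaluated by [coord_ibp], and adds [pi W] to the
    entropy. The terms in [W], finite by the moment hypothesis, cancel. *)
Lemma gdeficitE f g : has_grad f g -> (forall i, L2 (fun x => x 0 i * f x)) ->
  0 < \int[mu]_x f x ^+ 2 ->
  L1 (fun x => f x ^+ 2 * ln (f x ^+ 2 / \int[mu]_x f x ^+ 2)) ->
  gdeficit (fun x => f x / gam x) =
   (energy g - pi * \int[mu]_x (f x ^+ 2 * ln (f x ^+ 2 / \int[mu]_x f x ^+ 2))
    - N%:R * pi * \int[mu]_x f x ^+ 2)%:E.
Proof.
move=> fg xf; set a := \int[mu]_x f x ^+ 2 => a0 If; have [f2 g2 gfg] := fg; have mf := L2_meas f2.
pose W : R := \sum_(i < N) \int[mu]_x (x 0 i * f x) ^+ 2.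
have nP (P : 'rV[R]_N -> Prop) : {ae mu, forall x, P x} -> {ae nu, forall x, P x}.
  by move/ae_gauss.
have G2 i : L2at nu (fun x => (g i x + pi * (x 0 i * f x)) / gam x).
  by apply/gauss_L2; apply: L2D => //; exact: L2Z.
have lv : loc_integrable (fun x => f x / gam x).
  have := locint_continuousM (L2_locint f2) (smooth_continuous (@transfer_smooth R N)).
  by congr loc_integrable; apply/funext => x; rewrite mulrC.
have D : dirichlet nu (fun x => f x / gam x) = (energy g - N%:R * pi * a + pi ^+ 2 * W)%:E.
  rewrite (dirichletE nP (fun i => gauss_has_grad i fg) G2 lv); congr EFin.
  transitivity (\sum_(i < N) (\int[mu]_x g i x ^+ 2 - pi * a + pi ^+ 2 * \int[mu]_x (x 0 i * f x) ^+ 2)).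
    apply: eq_bigr => i _; rewrite gauss_Rint; last first.
      by apply: measurable_funX; exact: L2_meas (G2 i).
    have Ig := L2_sq (g2 i); have Ix := L2_sq (xf i); have Ixg := L2M (xf i) (g2 i).
    have := coord_ibp fg (xf i); rewrite -/a => E.
    transitivity (\int[mu]_x (g i x ^+ 2 + (2 * pi * (x 0 i * f x * g i x) + pi ^+ 2 * (x 0 i * f x) ^+ 2))).
      apply: eq_Rint => x; rewrite -exprMn divfK ?gam_neq0//; ring.
    rewrite RintD//; last by apply: L1D; exact: L1Z.
    rewrite RintD//; [|exact: L1Z|exact: L1Z].
    rewrite !RintZ// -addrA; congr (_ + (_ + _)).
    by rewrite mulrAC E; ring.
  rewrite !big_split/= sumr_const card_ord -mulr_sumr /energy -/W; congr (_ + _ + _).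
  by rewrite -mulr_natr; ring.
have E : entropy nu (fun x => f x / gam x) = (\int[mu]_x (f x ^+ 2 * ln (f x ^+ 2 / a)) + pi * W)%:E.
  have v2 : L2at nu (fun x => f x / gam x) by exact/gauss_L2.
  have mv := L2_meas v2.
  have aE : \int[nu]_x (f x / gam x) ^+ 2 = a.
    rewrite gauss_Rint; last exact: measurable_funX.
    by apply: eq_Rint => x; rewrite -exprMn divfK// gam_neq0.
  rewrite /entropy Lnorm2E// aE /= sqr_sqrtr ?(ltW a0)// integral_gauss; last first.
    apply: measurable_funM; first exact: measurable_funX.
    apply: measurableT_comp => //; apply: measurable_funM => //; exact: measurable_funX.
  have IW i : L1 (fun x => (x 0 i * f x) ^+ 2) by exact: L2_sq.
  have IWs : L1 (fun x => pi * \sum_(i < N) (x 0 i * f x) ^+ 2).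
    by apply: L1Z; exact: L1_sum.
  rewrite /W -Rint_sum// -RintZ; last exact: L1_sum.
  rewrite -RintD// EFin_Rint; last exact: L1D.
  apply: eq_integral => x _; congr EFin.
  have -> : (f x / gam x) ^+ 2 * ln ((f x / gam x) ^+ 2 / a) * gam x ^+ 2 =
      f x ^+ 2 * ln ((f x / gam x) ^+ 2 / a).
    by rewrite mulrAC -exprMn divfK// gam_neq0.
  have [->|fx0] := eqVneq (f x) 0.
    rewrite expr0n/= !mul0r add0r big1 ?mulr0// => i _; by rewrite mulr0 expr0n.
  have f20 : 0 < f x ^+ 2 by rewrite exprn_even_gt0.
  have -> : (f x / gam x) ^+ 2 / a = f x ^+ 2 / a * expR (pi * dotr x x).
    rewrite expr_div_n mulrAC; congr (_ * _); rewrite gamE /gaus -expRM_natl -expRN.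
    by congr expR; rewrite mulr_natl; field.
  rewrite lnM ?posrE ?divr_gt0 ?expR_gt0// expRK mulrDr; congr (_ + _).
  rewrite mulrCA /dotr mulr_sumr; congr (_ * _).
  by apply: eq_bigr => i _; ring.
rewrite /gdeficit D E -EFinM -EFinB; congr EFin; ring.
Qed.

End gaussian_space.

(** * Distance to the Gaussians *)

Section distance.
Context {R : realType} (N : nat).
Local Notation mu := (@lebesgue_row R N).
Local Notation nu := (@gauss_measure R N).
Local Notation L1 f := (mu.-integrable [set: 'rV[R]_N] (EFin \o f)).
Local Notation L2 := (L2 mu).
Implicit Types (x b : 'rV[R]_N) (f h k u w : 'rV[R]_N -> R) (a : R).

Definition gw b x : R := gaus (pi / 2) (x - b).

Lemma dotrB x b : dotr (x - b) (x - b) = dotr x x - 2 * dotr b x + dotr b b :> R.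
Proof.
rewrite /dotr mulr_sumr -sumrB -big_split/=; apply: eq_bigr => i _; rewrite !mxE; ring.
Qed.

Lemma GaussiansP w : Gaussians w <-> exists a b, w = fun x => a * gw b x.
Proof.
split=> -[a [b ->]]; exists a, b; apply/funext => x; congr (_ * _);
  by rewrite /gw /gaus enorm_sqr.
Qed.

Lemma gw_gt0 b x : 0 < gw b x. Proof. exact: gaus_gt0. Qed.

Lemma measurable_gw b : measurable_fun setT (gw b).
Proof. by apply: measurable_shift; exact: measurable_gaus. Qed.

Lemma pi20 : 0 < pi / 2 :> R. Proof. by rewrite divr_gt0 ?pi_gt0. Qed.

Lemma L2_gw b : L2 (gw b).
Proof. by apply: (L2_shift (- b)); apply: L2_gaus; exact: pi20. Qed.

Definition gmass : R := \int[mu]_x gaus (pi / 2) x ^+ 2.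

Lemma gmassE b : \int[mu]_x gw b x ^+ 2 = gmass.
Proof. by rewrite /gmass -[RHS](Rint_shift (- b) (L2_sq (L2_gaus N pi20))). Qed.

Lemma gmass_gt0 : 0 < gmass.
Proof.
rewrite lt_neqAle Rint_ge0 ?andbT => [|x]; last exact: sqr_ge0.
apply/negP => /eqP/esym/(Rint_eq0_ae (L2_sq (L2_gaus N pi20)) (fun x => sqr_ge0 _)).
move=> [A [mA A0 AT]]; have : mu (cube N 1) = 0.
  have cA : cube N 1 `<=` A.
    by move=> x _; apply: AT => /eqP; rewrite expf_eq0/= gt_eqF// gaus_gt0.
  apply/eqP; rewrite eq_le measure_ge0 andbT -A0.
  by apply: le_measure; rewrite ?inE//; exact: measurable_cube.
by rewrite lebesgue_cube// expr1n => /eqP; rewrite eqe oner_eq0.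
Qed.

(** Expanding [|x - b|^2], the quadratic part is cancelled by [gam] and an exponential remains. *)
Lemma gw_div_gam b x : gw b x / gam x = expR (- (pi / 2) * dotr b b) * expR (dotr (pi *: b) x).
Proof.
rewrite gamE /gw /gaus -expRN -!expRD; congr expR.
have -> : dotr (pi *: b) x = pi * dotr b x.
  by rewrite /dotr mulr_sumr; apply: eq_bigr => i _; rewrite mxE mulrA.
by rewrite dotrB; field.
Qed.

Lemma Exponentials_gam w : Exponentials w -> Gaussians (fun x => w x * gam x).
Proof.
move=> [a [b ->]]; apply/GaussiansP; pose b' := pi^-1 *: b.
exists (a * expR (pi / 2 * dotr b' b')), b'; apply/funext => x.
have /(canRL (divfK (gam_neq0 x))) -> := gw_div_gam b' x.
rewrite /b' scalerA divff ?scale1r ?(lt0r_neq0 (pi_gt0 R))// -/b'.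
rewrite !mulrA -[in RHS](mulrA a) -expRD (_ : _ + _ = 0) ?expR0 ?mulr1//; ring.
Qed.

Lemma Gaussians_gam w : Gaussians w -> Exponentials (fun x => w x / gam x).
Proof.
move=> /GaussiansP[a [b ->]]; exists (a * expR (- (pi / 2) * dotr b b)), (pi *: b).
by apply/funext => x; rewrite -mulrA gw_div_gam mulrA.
Qed.

Lemma measurable_Gaussians w : Gaussians w -> measurable_fun setT w.
Proof.
move=> /GaussiansP[a [b ->]]; apply: measurable_funM => //; exact: measurable_gw.
Qed.

Lemma L2_Gaussians w : Gaussians w -> L2 w.
Proof. by move=> /GaussiansP[a [b ->]]; apply: L2Z; exact: L2_gw. Qed.

(** Division by [gam] is an isometry from the Lebesgue to the Gaussian L2 space that maps
    [Gaussians] onto [Exponentials]. *)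
Lemma L2dist_gauss f : measurable_fun setT f ->
  L2dist nu (fun x => f x / gam x) (@Exponentials R N) = L2dist mu f (@Gaussians R N).
Proof.
move=> mf; have E w : Gaussians w ->
    ('N[nu]_2%:E[EFin \o (fun x => f x / gam x - w x / gam x)%R] =
     'N[mu]_2%:E[EFin \o (fun x => f x - w x)%R])%E.
  move=> Gw; rewrite !Lnorm2_integral integral_gauss; last first.
    apply: measurable_funX; apply: measurable_funB; apply: measurable_div_gam => //.
    exact: measurable_Gaussians.
  congr (_ `^ _)%E; apply: eq_integral => x _; congr EFin.
  by rewrite -mulrBl -exprMn divfK// gam_neq0.
congr ereal_inf; apply/seteqP; split=> _ [w Hw <-].
  exists (fun x => w x * gam x); first exact: Exponentials_gam.
  rewrite -E; last exact: Exponentials_gam.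
  by congr Lnorm; apply/funext => x /=; rewrite mulfK// gam_neq0.
exists (fun x => w x / gam x); first exact: Gaussians_gam.
by rewrite -E.
Qed.

Lemma ae_in_gauss f :
  ae_in nu (@Exponentials R N) (fun x => f x / gam x) <-> ae_in mu (@Gaussians R N) f.
Proof.
split=> -[w Hw fw].
  exists (fun x => w x * gam x); first exact: Exponentials_gam.
  move/(ae_gauss (fun x => [set: 'rV[R]_N] x -> f x / gam x = w x)) : fw.
  by apply: filterS => x /(_ Logic.I) <- _; rewrite divfK// gam_neq0.
exists (fun x => w x / gam x); first exact: Gaussians_gam.
apply/(ae_gauss (fun x => [set: 'rV[R]_N] x -> f x / gam x = w x / gam x)).
by apply: filterS fw => x /(_ Logic.I) ->.
Qed.

(** The square of [L2dist] as a real number, so that minimality becomes an inequality between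
    reals. *)
Definition dist2 f : R := inf [set \int[mu]_x (f x - w x) ^+ 2 | w in @Gaussians R N].

Let Gaussians0 : Gaussians (fun _ : 'rV[R]_N => 0 : R).
Proof. by exists 0, (0 : 'rV[R]_N); apply/funext => x; rewrite mul0r. Qed.

Lemma dist2_has_inf f : has_inf [set \int[mu]_x (f x - w x) ^+ 2 | w in @Gaussians R N].
Proof.
split; first by exists (\int[mu]_x (f x - 0) ^+ 2), (fun=> 0).
by exists 0 => _ [w _ <-]; apply: Rint_ge0 => x; exact: sqr_ge0.
Qed.

Lemma dist2_ge0 f : 0 <= dist2 f.
Proof.
apply: lb_le_inf; first by case: (dist2_has_inf f).
by move=> _ [w _ <-]; apply: Rint_ge0 => x; exact: sqr_ge0.
Qed.

Lemma L2dist_sqr f : L2 f -> (L2dist mu f (@Gaussians R N) ^+ 2 = (dist2 f)%:E)%E.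
Proof.
move=> f2; suff -> : L2dist mu f (@Gaussians R N) = (Num.sqrt (dist2 f))%:E.
  by rewrite -EFin_expe sqr_sqrtr// dist2_ge0.
have Nw w : Gaussians w ->
    ('N[mu]_2%:E[EFin \o (fun x => f x - w x)%R] = (Num.sqrt (\int[mu]_x (f x - w x) ^+ 2))%:E)%E.
  by move=> Gw; rewrite Lnorm2E//; apply: L2B => //; exact: L2_Gaussians.
apply/eqP; rewrite eq_le; apply/andP; split; last first.
  apply: le_ereal_inf_tmp => _ [w Gw <-]; rewrite Nw// lee_fin ler_wsqrtr//.
  by apply: ge_inf; [case: (dist2_has_inf f)|exists w].
apply/lee_addgt0Pr => e e0; set s := Num.sqrt _.
have s0 : 0 <= s by exact: sqrtr_ge0.
have lt1 : dist2 f < (s + e) ^+ 2.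
  by rewrite -(sqr_sqrtr (dist2_ge0 f)) -/s ltr_pXn2r ?nnegrE ?addr_ge0// ?(ltW e0)// ltrDl.
have eps0 : 0 < (s + e) ^+ 2 - dist2 f by rewrite subr_gt0.
have [_ [w Gw <-]] := inf_adherent eps0 (dist2_has_inf f); rewrite -/(dist2 f) addrC subrK => Hw.
apply: (@le_trans _ _ (Num.sqrt (\int[mu]_x (f x - w x) ^+ 2))%:E).
  by apply: ereal_inf_lbound; exists w => //; rewrite Nw.
rewrite lee_fin -(@ler_pXn2r _ 2) ?nnegrE ?sqrtr_ge0 ?addr_ge0 ?(ltW e0)//.
by rewrite sqr_sqrtr ?(ltW Hw)//; apply: Rint_ge0 => x; exact: sqr_ge0.
Qed.

Definition ip f b : R := \int[mu]_x (f x * gw b x).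

Lemma ipB f k b : L2 f -> L2 k -> ip (fun x => f x - k x) b = ip f b - ip k b.
Proof.
move=> f2 k2; rewrite /ip -RintB; [|exact: L2M (L2_gw b)|exact: L2M (L2_gw b)].
by apply: eq_Rint => x; ring.
Qed.

Lemma ip_CS f b : L2 f -> ip f b ^+ 2 / gmass <= \int[mu]_x f x ^+ 2.
Proof.
by move=> f2; rewrite ler_pdivrMr ?gmass_gt0// -(gmassE b); exact: Rint_CS (L2_gw b).
Qed.

(** Completing the square in the amplitude [a]: the best one for a given centre is
    [ip f b / gmass]. *)
Lemma Rint_sub_gaussian f a b : L2 f ->
  \int[mu]_x (f x - a * gw b x) ^+ 2 =
  \int[mu]_x f x ^+ 2 - ip f b ^+ 2 / gmass + gmass * (a - ip f b / gmass) ^+ 2.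
Proof.
move=> f2; have g2 := L2_gw b; have I1 := L2_sq f2; have I2 := L2M f2 g2; have I3 := L2_sq g2.
transitivity (\int[mu]_x (f x ^+ 2 - (2 * a * (f x * gw b x) - a ^+ 2 * gw b x ^+ 2))).
  by apply: eq_Rint => x; ring.
rewrite RintB//; last by apply: L1B; exact: L1Z.
rewrite RintB; [|exact: L1Z|exact: L1Z].
by rewrite !RintZ// gmassE -/(ip f b); field; rewrite gt_eqF// gmass_gt0.
Qed.

(** The supremum over centres of the squared norm of the projection of [f] onto the line spanned by
    [gw b]; it is what the squared distance lacks from the squared norm. *)
Definition gproj f : R := sup [set ip f b ^+ 2 / gmass | b in [set: 'rV[R]_N]].

Lemma gproj_has_sup f : L2 f -> has_sup [set ip f b ^+ 2 / gmass | b in [set: 'rV[R]_N]].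
Proof.
move=> f2; split; first by exists (ip f 0 ^+ 2 / gmass), 0.
by exists (\int[mu]_x f x ^+ 2) => _ [b _ <-]; exact: ip_CS.
Qed.

Lemma gproj_ge f b : L2 f -> ip f b ^+ 2 / gmass <= gproj f.
Proof. by move=> f2; apply: ub_le_sup; [case: (gproj_has_sup f2)|exists b]. Qed.

Lemma gproj_ge0 f : L2 f -> 0 <= gproj f.
Proof.
move=> f2; apply: le_trans (gproj_ge 0 f2).
by rewrite divr_ge0 ?sqr_ge0// ltW// gmass_gt0.
Qed.

Lemma dist2E f : L2 f -> dist2 f = \int[mu]_x f x ^+ 2 - gproj f.
Proof.
move=> f2; apply/eqP; rewrite eq_le; apply/andP; split.
  rewrite lerBrDl -lerBrDr; apply: ge_sup; first by case: (gproj_has_sup f2).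
  move=> _ [b _ <-]; rewrite lerBrDr -lerBrDl.
  apply: ge_inf; first by case: (dist2_has_inf f).
  exists (fun x => ip f b / gmass * gw b x); first by apply/GaussiansP; exists (ip f b / gmass), b.
  by rewrite Rint_sub_gaussian// subrr expr0n mulr0 addr0.
apply: lb_le_inf; first by case: (dist2_has_inf f).
move=> _ [w /GaussiansP[a [b ->]] <-]; rewrite Rint_sub_gaussian//.
have := gproj_ge b f2; have : 0 <= gmass * (a - ip f b / gmass) ^+ 2.
  by rewrite mulr_ge0 ?sqr_ge0// ltW// gmass_gt0.
lra.
Qed.

(** Up to a small L2 error [f] lives in a box, and a Gaussian centred far away is small there. *)
Lemma ip_far f (e : R) : L2 f -> 0 < e ->
  exists2 B, 0 <= B & forall b, ~ boxM B b -> `|ip f b| <= e.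
Proof.
have aux (l r : R) : 1 <= l -> l ^+ 2 <= r -> l <= 1 + pi / 2 * r.
  move=> l1 lr; have lr1 : l <= r by apply: le_trans lr; rewrite expr2 ler_peMl// (le_trans ler01).
  have : 1 * r <= pi / 2 * r by apply: ler_wpM2r; have := pi_ge2 R; lra.
  lra.
move=> f2 e0; have mf := L2_meas f2; have m0 := gmass_gt0.
pose D (n : nat) : set 'rV[R]_N := boxM n%:R.
pose F (n : nat) x := f x * \1_(D n) x.
have mI (n : nat) : measurable_fun setT (\1_(D n) : 'rV[R]_N -> R).
  by apply: measurable_indic; exact: measurable_boxM.
have I01 (n : nat) x : 0 <= (\1_(D n) x : R) <= 1.
  by rewrite indicE; case: (_ \in _); rewrite ?lexx ?ler01.
have cvF x : F ^~ x @ \oo --> f x.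
  have [L L0 HL] := compact_sub_boxM (@compact_set1 _ x).
  apply: cvg_near_cst; exists (Num.trunc L).+1 => // n /= Ln.
  rewrite /F indicE mem_set ?mulr1//= => i; apply: (le_trans (HL x erefl i)).
  apply: (@le_trans _ _ (Num.trunc L).+1%:R); first by rewrite ltW// truncnS_gt.
  by rewrite ler_nat.
have leF n x : `|F n x| <= `|f x|.
  by have /andP[h0 h1] := I01 n x; rewrite normrM ler_piMr// ger0_norm.
have mF n : measurable_fun setT (F n) by exact: measurable_funM.
have F2 n : L2 (F n) by apply: (L2_le (mF n) f2).
have ee : 0 < e ^+ 2 / (4 * gmass) by rewrite divr_gt0 ?exprn_gt0// mulr_gt0.
have [n0 _ Hn] := (cvgrPdist_lt _ _).1 (L2_dct mF f2 cvF leF) _ ee.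
have {}Hn : \int[mu]_x (F n0 x - f x) ^+ 2 <= e ^+ 2 / (4 * gmass).
  by have := Hn n0 (leqnn n0); rewrite sub0r normrN => H; exact: le_trans (ler_norm _) (ltW H).
have I1 : L1 (\1_(D n0) : 'rV[R]_N -> R).
  apply/L1_ge0P => [//|x|]; first by case/andP: (I01 n0 x).
  by rewrite integral_indic ?setIT; [exact: boxM_finite|exact: measurableT|exact: measurable_boxM].
set V := \int[mu]_x (\1_(D n0) x : R).
have V0 : 0 <= V by apply: Rint_ge0 => x; case/andP: (I01 n0 x).
set a := \int[mu]_x f x ^+ 2.
have a0 : 0 <= a by apply: Rint_ge0 => x; exact: sqr_ge0.
(* At distance [L] from the box, [gw b ^+ 2] is at most [1 / L] on it, and [a * V / L <= (e / 2)^2]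
   for this [L]. *)
pose L : R := 1 + 4 * (a * V) / e ^+ 2.
have L1 : 1 <= L by rewrite lerDl divr_ge0 ?sqr_ge0// !mulr_ge0.
have L0 : 0 <= L by exact: le_trans L1.
exists (n0%:R + L) => [|b Hb]; first by rewrite addr_ge0.
have far x : boxM n0%:R x -> gw b x ^+ 2 <= L^-1.
  move=> xn; have [i Hi] : exists i, n0%:R + L < `|b 0 i|.
    apply: contrapT => H; apply: Hb => i; rewrite leNgt; apply/negP => Hi; apply: H; by exists i.
  have d1 : L ^+ 2 <= dotr (x - b) (x - b).
    apply: le_trans (coord_dotr_le _ i); rewrite !mxE -[leRHS]real_normK ?num_real//.
    rewrite ler_pXn2r ?nnegrE//; have := xn i.
    by have := lerB_dist (b 0 i) (x 0 i); rewrite distrC; lra.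
  have g1 : gw b x <= L^-1.
    rewrite /gw /gaus mulNr expRN lef_pV2 ?posrE ?expR_gt0 ?(lt_le_trans ltr01)//.
    by apply: le_trans (expR_ge1Dx _); exact: aux.
  apply: le_trans g1; rewrite expr2 ler_piMl ?(ltW (gw_gt0 _ _))//.
  by apply: gaus_le1; rewrite ltW// pi20.
have P1 : ip (F n0) b ^+ 2 <= (e / 2) ^+ 2.
  have g2 : L2 (fun x => \1_(D n0) x * gw b x).
    apply: (L2_le _ (L2_gw b)) => [|x]; first by apply: measurable_funM => //; exact: measurable_gw.
    by have /andP[h0 h1] := I01 n0 x; rewrite normrM ler_piMl// ger0_norm.
  have -> : ip (F n0) b = \int[mu]_x (f x * (\1_(D n0) x * gw b x)).
    by apply: eq_Rint => x; rewrite /F mulrA.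
  apply: le_trans (Rint_CS f2 g2) _; rewrite -/a.
  have : \int[mu]_x (\1_(D n0) x * gw b x) ^+ 2 <= V * L^-1.
    rewrite /V -RintZr//; apply: Rint_le => [||x]; [exact: L2_sq|exact: L1Zr|].
    rewrite indicE; case: (boolP (x \in _)) => [|_]; last by rewrite !mul0r expr0n.
    by rewrite inE !mul1r => /far.
  move/(ler_wpM2l a0)/le_trans; apply; rewrite mulrA ler_pdivrMr ?(lt_le_trans ltr01)//.
  have -> : (e / 2) ^+ 2 * L = e ^+ 2 / 4 + a * V.
    by rewrite /L; field; rewrite lt0r_neq0.
  by rewrite lerDr divr_ge0// sqr_ge0.
have P2 : (ip (F n0) b - ip f b) ^+ 2 <= (e / 2) ^+ 2.
  rewrite -ipB//; have := ip_CS b (L2B (F2 n0) f2); rewrite ler_pdivrMr// => /le_trans; apply.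
  apply: (le_trans (ler_wpM2r (ltW m0) Hn)).
  by rewrite le_eqVlt; apply/orP; left; apply/eqP; field; exact: lt0r_neq0.
have e20 : 0 <= e / 2 by rewrite divr_ge0// ltW.
move: P1 P2; rewrite -[X in X <= _ -> _]real_normK ?num_real//.
rewrite -[X in _ -> X <= _ -> _]real_normK ?num_real// !ler_pXn2r ?nnegrE// => P1 P2.
rewrite (_ : ip f b = ip (F n0) b - (ip (F n0) b - ip f b)); last by ring.
by apply: (le_trans (ler_normB _ _)); lra.
Qed.

(** Moving the centre translates one fixed Gaussian, whose L2 modulus of continuity is given by
    [translation_bound]. *)
Lemma ip_continuous f : L2 f -> continuous (ip f).
Proof.
have aux (m : R) : 0 <= m -> m < (m + 1) ^+ 2 by move=> m0; nra.
move=> f2 b; set a := \int[mu]_x f x ^+ 2.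
have hg := @has_grad_gaus R N _ pi20.
set E := energy (fun (i : 'I_N) x => - 2 * (pi / 2) * x 0 i * gaus (pi / 2) x).
pose M := a * (2 ^+ N * E).
have a0 : 0 <= a by apply: Rint_ge0 => x; exact: sqr_ge0.
have M0 : 0 <= M by rewrite mulr_ge0// mulr_ge0 ?exprn_ge0// energy_ge0.
move=> A /nbhs_ballP[e /= e0 eA]; pose d := e / (M + 1).
have d0 : 0 < d by rewrite divr_gt0// ltr_wpDl.
apply/nbhs_ballP; exists d => // b' Hb'; apply: eA; rewrite -ball_normE /=.
have Hd i : `|(b - b') 0 i| <= d.
  by rewrite !mxE; have [_ /(_ 0 i)] := Hb'; rewrite -ball_normE /= => /ltW.
have gE : \int[mu]_x (gw b x - gw b' x) ^+ 2 <= 2 ^+ N * (d ^+ 2 * E).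
  have T := translation_bound hg Hd.
  have I : L1 (fun x => (gaus (pi / 2) (x + (b - b')) - gaus (pi / 2) x) ^+ 2).
    by apply/L2_sq/L2B; [exact: (L2_shift _ (L2_gaus N pi20))|exact: (L2_gaus N pi20)].
  apply: le_trans T; rewrite -(Rint_shift (- b) I) le_eqVlt; apply/orP; left; apply/eqP.
  apply: eq_Rint => x; rewrite /gw addrA subrK -sqrrN opprB.
  by [].
have D2 : (ip f b - ip f b') ^+ 2 <= M * d ^+ 2.
  have -> : ip f b - ip f b' = \int[mu]_x (f x * (gw b x - gw b' x)).
    rewrite /ip -RintB; [|exact: L2M (L2_gw b)|exact: L2M (L2_gw b')].
    by apply: eq_Rint => x; ring.
  apply: le_trans (Rint_CS f2 (L2B (L2_gw b) (L2_gw b'))) _; rewrite -/a.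
  apply: (le_trans (ler_wpM2l a0 gE)).
  by rewrite /M le_eqVlt; apply/orP; left; apply/eqP; ring.
rewrite -(@ltr_pXn2r _ 2) ?nnegrE ?(ltW e0)// real_normK ?num_real//.
apply: (le_lt_trans D2).
rewrite /d expr_div_n mulrA ltr_pdivrMr ?exprn_gt0 ?ltr_wpDl//.
rewrite mulrC ltr_pM2l ?exprn_gt0//; exact: aux.
Qed.

(** If the supremum is positive, centres outside a large box reach at most half of it by [ip_far];
    on the compact box continuity gives a maximum. *)
Lemma gproj_attained f : L2 f -> exists b, gproj f = ip f b ^+ 2 / gmass.
Proof.
move=> f2; have m0 := gmass_gt0; have q0 := gproj_ge0 f2.
have [Z|Z] := eqVneq (gproj f) 0.
  exists 0; apply/eqP; rewrite eq_le gproj_ge// andbT Z.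
  by rewrite divr_ge0 ?sqr_ge0// ltW.
have {}q0 : 0 < gproj f by rewrite lt_neqAle eq_sym Z.
pose e := Num.sqrt (gmass * (gproj f / 2)).
have e0 : 0 < e by rewrite sqrtr_gt0 mulr_gt0// divr_gt0.
have [B B0 HB] := ip_far f2 e0.
have [||c _ Hc] := @EVT_max_rV R N (fun b => ip f b ^+ 2) (boxM B) _ (compact_boxM (M := B)).
- by exists 0 => i; rewrite mxE normr0.
- apply: continuous_subspaceT => b.
  have cf := ip_continuous f2; rewrite (_ : (fun b => _) = (fun b => ip f b * ip f b)).
    by apply: continuousM; exact: cf.
  by apply/funext => y; rewrite expr2.
exists c; apply/eqP; rewrite eq_le gproj_ge// andbT.
rewrite leNgt; apply/negP => H.
have : gproj f <= Num.max (ip f c ^+ 2 / gmass) (gproj f / 2).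
  apply: ge_sup; first by case: (gproj_has_sup f2).
  move=> _ [b _ <-]; rewrite le_max; have [bB|bB] := pselect (boxM B b).
    apply/orP; left; apply: ler_wpM2r; first by rewrite invr_ge0 ltW.
    by apply: Hc; rewrite inE.
  apply/orP; right; rewrite ler_pdivrMr// mulrC -[leRHS]sqr_sqrtr -/e; last first.
    by rewrite mulr_ge0 ?divr_ge0// ltW.
  by rewrite -[leLHS]real_normK ?num_real// ler_pXn2r ?nnegrE ?(ltW e0)//; exact: HB.
by rewrite le_max leNgt H/= => h; lra.
Qed.

(** The distance is attained, since the best centre is; a zero distance would make [f] almost
    everywhere equal to a Gaussian. *)
Lemma dist2_gt0 f : L2 f -> ~ ae_in mu (@Gaussians R N) f -> 0 < dist2 f.
Proof.
move=> f2 nG; rewrite lt_neqAle dist2_ge0 andbT; apply/negP => /eqP d0; apply: nG.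
have [b Hb] := gproj_attained f2.
pose w x := ip f b / gmass * gw b x.
have Gw : Gaussians w by apply/GaussiansP; exists (ip f b / gmass), b.
exists w => //.
have : \int[mu]_x (f x - w x) ^+ 2 = 0.
  by rewrite Rint_sub_gaussian// subrr expr0n mulr0 addr0 -Hb -dist2E.
have := L2_sq (L2B f2 (L2_Gaussians Gw)) => I /(Rint_eq0_ae I (fun x => sqr_ge0 _)).
by apply: filterS => x /eqP; rewrite expf_eq0/= subr_eq0 => /eqP ->.
Qed.

(** From [|x - b|^2 >= |x|^2 / 2 - |b|^2], which is half of [|x - 2 b|^2 >= 0], and
    [pi / 2 >= 1]. *)
Lemma gw_le_gaus B b x : 0 <= B -> boxM B b ->
  gw b x <= expR (pi / 2 * (N%:R * B ^+ 2)) * gaus (1 / 2) x.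
Proof.
move=> B0 bB; rewrite /gw /gaus -expRD ler_expR dotrB.
have b2 : dotr b b <= N%:R * B ^+ 2.
  apply: (@le_trans _ _ (\sum_(i < N) B ^+ 2)); last by rewrite sumr_const card_ord mulr_natl.
  apply: ler_sum => i _; by rewrite -expr2 -[leLHS]real_normK ?num_real// ler_pXn2r ?nnegrE.
have x0 := dotr_ge0 x; have p2 := pi_ge2 R.
have key : dotr x x / 2 - dotr b b <= dotr x x - 2 * dotr b x + dotr b b.
  have := dotr_ge0 (x - 2 *: b); rewrite dotrB.
  have -> : dotr (2 *: b) x = 2 * dotr b x by rewrite /dotr mulr_sumr; apply: eq_bigr => i _; rewrite mxE mulrA.
  have -> : dotr (2 *: b) (2 *: b) = 4 * dotr b b.
    by rewrite /dotr mulr_sumr; apply: eq_bigr => i _; rewrite !mxE; ring.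
  lra.
have pp : 0 <= pi / 2 :> R by rewrite ltW// pi20.
have k1 := ler_wpM2l pp key; have k2 := ler_wpM2l pp b2.
have k3 : 1 * (dotr x x / 2) <= pi / 2 * (dotr x x / 2) by apply: ler_wpM2r; [rewrite divr_ge0|lra].
rewrite mulrBr in k1; rewrite mulNr; lra.
Qed.

(** The bound has to be linear in [w * phi], not merely in the norm of [w]. For centres in a box
    depending only on [u], [gw b] is at most a multiple of [phi], so the change of [ip] is
    controlled by the integral of [w * phi]. For centres outside, the projection of [u] is too small
    to compete, and replacing [u] by [u'] costs twice the integral of [w ^+ 2]. *)
Lemma gproj_diff u : L2 u -> exists2 C : R, 0 <= C &
  forall u' w phi, L2 u' -> L2 w -> L2 phi -> (forall x, 0 <= w x) ->
  (forall x, `|u x - u' x| <= w x) -> (forall x, gaus (1 / 2) x <= phi x) ->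
  \int[mu]_x u' x ^+ 2 <= \int[mu]_x u x ^+ 2 ->
  `|gproj u - gproj u'| <= C * (\int[mu]_x (w x * phi x) + \int[mu]_x w x ^+ 2).
Proof.
have aux1 (r1 r2 r3 r4 r5 : R) : r1 <= r3 -> r2 - r1 <= r4 -> 0 <= r5 -> r2 - r3 <= r4 + 2 * r5.
  by lra.
have aux2 (p q t k W : R) : p <= 2 * q + 2 * W -> q <= t / 8 -> 0 <= t -> 0 <= k -> p - t <= k + 2 * W.
  by lra.
have aux3 (p q t k W : R) : p <= 2 * q + 2 * W -> q <= t -> t <= 0 -> 0 <= k -> p - t <= k + 2 * W.
  by lra.
have aux5 (p q w m : R) : (p - q) ^+ 2 <= w * m -> p ^+ 2 <= 2 * q * q + 2 * w * m.
  by have := sqr_ge0 (p - 2 * q); rewrite !sqrrB; nra.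
have aux4 (t t' k W : R) : t <= t / 8 -> 0 <= t' -> 0 <= k -> 0 <= W -> t - t' <= k + 2 * W.
  by lra.
move=> u2; have m0 := gmass_gt0; set a := \int[mu]_x u x ^+ 2.
have a0 : 0 <= a by apply: Rint_ge0 => x; exact: sqr_ge0.
pose s := gmass * a + 1; have s0 : 0 <= s by rewrite addr_ge0// mulr_ge0// ltW.
(* Outside the box obtained from this [e], the projections of [u] are at most [gproj u / 8]; the
   factor 8 leaves room for the factor 2 from squaring a sum. *)
pose e := Num.sqrt (gmass * gproj u / 8).
have q0 := gproj_ge0 u2.
have e2 : e ^+ 2 = gmass * gproj u / 8 by rewrite sqr_sqrtr// divr_ge0// mulr_ge0// ltW.
have [B B0 HB] : exists2 B, 0 <= B & 0 < gproj u -> forall b, ~ boxM B b -> `|ip u b| <= e.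
  have [q1|q1] := ltP 0 (gproj u); last by exists 0.
  have [|B B0 HB] := @ip_far u e u2; first by rewrite sqrtr_gt0 divr_gt0// mulr_gt0.
  by exists B.
pose K := expR (pi / 2 * (N%:R * B ^+ 2)); have K0 : 0 <= K by exact: expR_ge0.
exists (K * (2 * s) / gmass + 2) => [|u' w phi u2' w2 phi2 w0 uw gphi u'u].
  by rewrite addr_ge0// divr_ge0 ?(ltW m0)// mulr_ge0// mulr_ge0.
set P := \int[mu]_x (w x * phi x); set W := \int[mu]_x w x ^+ 2.
have phi0 x : 0 <= phi x by apply: le_trans (gphi x); exact: ltW (gaus_gt0 _ _).
have P0 : 0 <= P by apply: Rint_ge0 => x; rewrite mulr_ge0.
have W0 : 0 <= W by apply: Rint_ge0 => x; exact: sqr_ge0.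
have KK : 0 <= K * (2 * s) / gmass by rewrite divr_ge0 ?(ltW m0)// mulr_ge0// mulr_ge0.
have fin (t : R) : t <= K * (2 * s) / gmass * P + 2 * W -> t <= (K * (2 * s) / gmass + 2) * (P + W).
  have := mulr_ge0 KK W0; move: (_ / gmass) KK => k KK; nra.
have d2 : L2 (fun x => u' x - u x) by exact: L2B.
have dW : \int[mu]_x (u' x - u x) ^+ 2 <= W.
  apply: Rint_le => [||x]; [exact: L2_sq|exact: L2_sq|].
  by rewrite -[leLHS]real_normK ?num_real// ler_pXn2r ?nnegrE// distrC.
have dip b : (ip u' b - ip u b) ^+ 2 / gmass <= W.
  by rewrite -ipB//; apply: le_trans (ip_CS b d2) dW.
have ips f : L2 f -> \int[mu]_x f x ^+ 2 <= a -> forall b, `|ip f b| <= s.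
  move=> f2 fa b; have := ip_CS b f2; rewrite ler_pdivrMr// => H.
  have : ip f b ^+ 2 <= gmass * a by rewrite mulrC; apply: le_trans H _; rewrite ler_wpM2r// ltW.
  rewrite -real_normK ?num_real// /s; have := sqr_ge0 (`|ip f b| - 1); rewrite sqrrB1.
  by have := normr_ge0 (ip f b); move: `|_| (gmass * a) => t r; lra.
have near b : boxM B b -> `|ip u b ^+ 2 / gmass - ip u' b ^+ 2 / gmass| <= K * (2 * s) / gmass * P.
  move=> bB; rewrite -mulrBl subr_sqr normrM normrM [X in _ * X]ger0_norm ?invr_ge0 ?(ltW m0)//.
  have h1 : `|ip u b - ip u' b| <= K * P.
    rewrite distrC -ipB//; have I1 := L2M d2 (L2_gw b).
    apply: le_trans (Rint_norm I1) _; rewrite /P -RintZ; last exact: L2M.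
    apply: Rint_le => [||x]; [exact: L1_norm|by apply: L1Z; exact: L2M|].
    rewrite normrM (gtr0_norm (gw_gt0 b x)) mulrCA; apply: ler_pM => //; first exact: ltW (gw_gt0 _ _).
      by rewrite distrC.
    by apply: le_trans (gw_le_gaus x B0 bB) _; apply: ler_wpM2l.
  have h2 : `|ip u b + ip u' b| <= 2 * s.
    apply: le_trans (ler_normD _ _) _.
    by have := ips _ u2 (lexx _) b; have := ips _ u2' u'u b; lra.
  rewrite (_ : K * (2 * s) / gmass * P = K * P * (2 * s) / gmass); last by ring.
  by rewrite ler_wpM2r ?invr_ge0 ?(ltW m0)//; exact: ler_pM.
have [b' Hb'] := gproj_attained u2'; have [b Hb] := gproj_attained u2.
have Pk : 0 <= K * (2 * s) / gmass * P by rewrite mulr_ge0.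
have up : gproj u' - gproj u <= K * (2 * s) / gmass * P + 2 * W.
  have gb := gproj_ge b' u2.
  have [bB|bB] := pselect (boxM B b').
    have h : ip u' b' ^+ 2 / gmass - ip u b' ^+ 2 / gmass <= K * (2 * s) / gmass * P.
      by apply: le_trans (near _ bB); rewrite distrC ler_norm.
    by rewrite Hb'; exact: aux1 gb h W0.
  have sq : ip u' b' ^+ 2 / gmass <= 2 * (ip u b' ^+ 2 / gmass) + 2 * W.
    have := dip b'; rewrite ler_pdivrMr// !mulrA ler_pdivrMr// mulrDl divfK ?(lt0r_neq0 m0)//.
    exact: aux5.
  have [q1|q1] := ltP 0 (gproj u).
    have h : ip u b' ^+ 2 / gmass <= gproj u / 8.
      rewrite ler_pdivrMr// -real_normK ?num_real//.
      rewrite (_ : _ / 8 * _ = e ^+ 2); last by rewrite e2; ring.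
      by rewrite ler_pXn2r ?nnegrE ?sqrtr_ge0//; exact: HB.
    by rewrite Hb'; exact: aux2 sq h q0 Pk.
  by rewrite Hb'; exact: aux3 sq gb q1 Pk.
have down : gproj u - gproj u' <= K * (2 * s) / gmass * P + 2 * W.
  have gb := gproj_ge b u2'; have q0' := gproj_ge0 u2'.
  have [q1|q1] := ltP 0 (gproj u); last first.
    by apply: aux4 => //; rewrite (le_trans q1)// divr_ge0.
  have [bB|bB] := pselect (boxM B b).
    have h : ip u b ^+ 2 / gmass - ip u' b ^+ 2 / gmass <= K * (2 * s) / gmass * P.
      by apply: le_trans (near _ bB); rewrite ler_norm.
    by rewrite Hb; exact: aux1 gb h W0.
  suff H : gproj u <= gproj u / 8 by exact: aux4.
  rewrite {1}Hb ler_pdivrMr// -real_normK ?num_real//.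
  rewrite (_ : _ / 8 * _ = e ^+ 2); last by rewrite e2; ring.
  by rewrite ler_pXn2r ?nnegrE ?sqrtr_ge0//; exact: HB.
by rewrite ler_norml lerNl opprB !fin.
Qed.

End distance.

(** * Truncation *)

Section sqln.
Context {R : realType}.

Definition sqln (s : R) : R := s ^+ 2 * ln (s ^+ 2).

Lemma sqln0 : sqln 0 = 0. Proof. by rewrite /sqln expr0n mul0r. Qed.

Lemma sqlnN s : sqln (- s) = sqln s. Proof. by rewrite /sqln sqrrN. Qed.

Lemma ln_le_id (s : R) : 0 < s -> ln s <= s.
Proof.
move=> s0; have := @le_ln1Dx R (s - 1); rewrite addrCA subrr addr0; lra.
Qed.

Lemma sqln_norm s : `|sqln s| <= 2 * `|s| + 2 * `|s| ^+ 3.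
Proof.
wlog s0 : s / 0 < s => [W|].
  have [s0|s0|->] := ltgtP s 0; last by rewrite sqln0 normr0 expr0n/= !mulr0 addr0.
    by have := W (- s); rewrite oppr_gt0 sqlnN normrN; apply.
  exact: W.
rewrite (gtr0_norm s0) /sqln normrM (ger0_norm (sqr_ge0 s)) lnXn// -[ln s *+ 2]mulr_natl normrM ger0_norm//.
have s30 : 0 <= s ^+ 3 by rewrite exprn_ge0// ltW.
have [s1|s1] := leP 1 s.
  rewrite ger0_norm ?ln_ge0//; have := ler_wpM2l (sqr_ge0 s) (ln_le_id s0).
  by rewrite -exprSr; lra.
rewrite ler0_norm ?ln_le0 ?(ltW s1)//.
have := @ln_le_id s^-1; rewrite invr_gt0 lnV// => /(_ s0)/(ler_wpM2l (sqr_ge0 s)).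
by rewrite expr2 mulfK ?lt0r_neq0//; lra.
Qed.

Lemma lnD_le (p w : R) : 0 < p -> 0 < w -> ln (p + w) <= ln p + w / p.
Proof.
move=> p0 w0; have -> : p + w = p * (1 + w / p) by field; exact: lt0r_neq0.
rewrite lnM ?posrE ?addr_gt0 ?divr_gt0// lerD2l; apply: le_ln1Dx.
by apply: (@lt_le_trans _ _ 0); [rewrite ltrN10|rewrite divr_ge0// ltW].
Qed.

(** Expand [(p + w)^2] in front of the logarithm. In the terms with [p^2] and [p w] use
    [ln (p + w) <= ln p + w / p], in the one with [w^2] use [ln (p + w) <= ln w + p / w]. *)
Lemma sqlnD_le (p w : R) : 0 < p -> 0 < w ->
  sqln (p + w) - sqln p <= sqln w + 4 * w ^+ 2 + 4 * (p * w) + 2 * (p * w) * ln (p ^+ 2).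
Proof.
move=> p0 w0; rewrite /sqln !lnXn ?addr_gt0//; rewrite -![ln _ *+ 2]mulr_natl.
have h1 : p ^+ 2 * (ln (p + w) - ln p) <= p * w.
  have := ler_wpM2l (sqr_ge0 p) (lnD_le p0 w0); rewrite mulrDr.
  have -> : p ^+ 2 * (w / p) = p * w by field; exact: lt0r_neq0.
  by rewrite mulrBr; lra.
have h2 : w ^+ 2 * ln (p + w) <= w ^+ 2 * ln w + p * w.
  rewrite addrC; have := ler_wpM2l (sqr_ge0 w) (lnD_le w0 p0); rewrite mulrDr.
  have -> : w ^+ 2 * (p / w) = p * w by field; exact: lt0r_neq0.
  by rewrite (addrC w p); lra.
have h3 : p * w * ln (p + w) <= p * w * ln p + w ^+ 2.
  have pw : 0 <= p * w by rewrite mulr_ge0// ltW.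
  have := ler_wpM2l pw (lnD_le p0 w0); rewrite mulrDr.
  by have -> : p * w * (w / p) = w ^+ 2 by field; exact: lt0r_neq0.
move: h1; rewrite mulrBr sqrrD => h1.
move: (ln _) (ln p) (ln w) h1 h2 h3 => x y z h1 h2 h3.
have e1 : (p ^+ 2 + p * w *+ 2 + w ^+ 2) * (2 * x) = 2 * (p ^+ 2 * x) + 4 * (p * w * x) + 2 * (w ^+ 2 * x) by ring.
have e2 : p ^+ 2 * (2 * y) = 2 * (p ^+ 2 * y) by ring.
have e3 : w ^+ 2 * (2 * z) = 2 * (w ^+ 2 * z) by ring.
have e4 : 2 * (p * w) * (2 * y) = 4 * (p * w * y) by ring.
by rewrite e1 e2 e3 e4; lra.
Qed.

End sqln.

(** * Truncation at a positive barrier *)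

Section has_grad_algebra.
Context {R : realType} (N : nat).
Local Notation mu := (@lebesgue_row R N).
Local Notation L1 f := (mu.-integrable [set: 'rV[R]_N] (EFin \o f)).
Local Notation L2 := (L2 mu).
Implicit Types (f w u : 'rV[R]_N -> R) (g dp : 'I_N -> 'rV[R]_N -> R) (x : 'rV[R]_N).

Lemma has_gradD f g f' g' : has_grad f g -> has_grad f' g' ->
  has_grad (fun x => f x + f' x) (fun i x => g i x + g' i x).
Proof.
move=> [f2 g2 fg] [f2' g2' fg']; split=> [|i|i]; [exact: L2D|exact: L2D|exact: weak_partialD].
Qed.

Lemma has_gradB f g f' g' : has_grad f g -> has_grad f' g' ->
  has_grad (fun x => f x - f' x) (fun i x => g i x - g' i x).
Proof. by move=> H /has_gradN; exact: has_gradD. Qed.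

Lemma has_gradZ c f g : has_grad f g -> has_grad (fun x => c * f x) (fun i x => c * g i x).
Proof.
move=> [f2 g2 fg]; split=> [|i|i]; [exact: L2Z|exact: L2Z|exact: weak_partialZ].
Qed.

Lemma eq_has_grad f f' g g' : f =1 f' -> (forall i, g i =1 g' i) -> has_grad f g -> has_grad f' g'.
Proof.
move=> ff gg [f2 g2 fg]; split=> [|i|i]; [exact: eq_L2 f2|exact: eq_L2 (g2 i)|].
exact: eq_weak_partial (fg i).
Qed.

Lemma has_grad_pos0 f g : has_grad f g ->
  has_grad (fun x => pos (f x)) (fun i x => if 0 < f x then g i x else 0).
Proof. by move/has_grad_pos/(_ (lexx 0)); apply: eq_has_grad => // x; rewrite subr0. Qed.

(** [excess] and [clip] are [w] and [u'] of the overview, written with one-sided positive parts so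
    that the gradients come from [has_grad_pos0]. *)
Definition excess u phi x : R := pos (u x - phi x) + pos (- u x - phi x).

Definition clip u phi x : R := u x - pos (u x - phi x) + pos (- u x - phi x).

Definition excess_grad u g phi dp : 'I_N -> 'rV[R]_N -> R := fun i x =>
  (if 0 < u x - phi x then g i x - dp i x else 0) + (if 0 < - u x - phi x then - g i x - dp i x else 0).

Definition clip_grad u g phi dp : 'I_N -> 'rV[R]_N -> R := fun i x =>
  g i x - (if 0 < u x - phi x then g i x - dp i x else 0) + (if 0 < - u x - phi x then - g i x - dp i x else 0).

Section clip.
Context (u phi : 'rV[R]_N -> R) (g dp : 'I_N -> 'rV[R]_N -> R).
Context (ug : has_grad u g) (pg : has_grad phi dp) (phi0 : forall x, 0 < phi x).

Lemma has_grad_excess : has_grad (excess u phi) (excess_grad u g phi dp).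
Proof.
apply: has_gradD; first exact/has_grad_pos0/has_gradB.
by apply/has_grad_pos0/has_gradB => //; exact: has_gradN.
Qed.

Lemma has_grad_clip : has_grad (clip u phi) (clip_grad u g phi dp).
Proof.
apply: has_gradD; last by apply/has_grad_pos0/has_gradB => //; exact: has_gradN.
by apply: has_gradB => //; exact/has_grad_pos0/has_gradB.
Qed.

Lemma clip_cases x :
  [\/ [/\ phi x < u x, excess u phi x = u x - phi x & clip u phi x = phi x],
      [/\ phi x < - u x, excess u phi x = - u x - phi x & clip u phi x = - phi x] |
      [/\ `|u x| <= phi x, excess u phi x = 0 & clip u phi x = u x]].
Proof.
have p0 := phi0 x; rewrite /excess /clip !pos_ifE !subr_gt0.
have [h|h] := ltP (phi x) (u x).
  by constructor 1; rewrite ifN; [split=> //; ring|rewrite -leNgt; lra].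
have [h'|h'] := ltP (phi x) (- u x).
  by constructor 2; split=> //; ring.
by constructor 3; rewrite ler_norml; split; [apply/andP; split; lra|ring|ring].
Qed.

Lemma excess_ge0 x : 0 <= excess u phi x.
Proof. by rewrite addr_ge0// pos_ge0. Qed.

Lemma excessE x : excess u phi x = pos (`|u x| - phi x).
Proof.
rewrite pos_ifE subr_gt0; have p0 := phi0 x; case: (clip_cases x) => -[h -> _].
- by rewrite ger0_norm ?h//; lra.
- by rewrite ler0_norm ?h//; lra.
- by rewrite ifN// -leNgt.
Qed.

Lemma clip_le_phi x : `|clip u phi x| <= phi x.
Proof.
have p0 := phi0 x; case: (clip_cases x) => -[h _ ->] //; first by rewrite gtr0_norm.
by rewrite normrN gtr0_norm.
Qed.

Lemma sub_clip_norm x : `|u x - clip u phi x| = excess u phi x.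
Proof.
have p0 := phi0 x; case: (clip_cases x) => -[h -> ->].
- by rewrite ger0_norm// subr_ge0 ltW.
- by rewrite ler0_norm; lra.
- by rewrite subrr normr0.
Qed.

Lemma clip_sqr x : u x ^+ 2 = clip u phi x ^+ 2 + excess u phi x ^+ 2 + 2 * (excess u phi x * phi x).
Proof.
by case: (clip_cases x) => -[h -> ->]; [ring|ring|rewrite expr0n/= mul0r mulr0 !addr0].
Qed.

(** Beyond the barrier the clipped gradient is [dp] or [- dp], and [g] is the sum of [dp] and the
    gradient of the excess, with the same sign. Both truncations cannot be active at once, as
    [phi > 0]. *)
Lemma clip_grad_sqr i x : g i x ^+ 2 = clip_grad u g phi dp i x ^+ 2 + excess_grad u g phi dp i x ^+ 2
   + 2 * (excess_grad u g phi dp i x * dp i x).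
Proof.
rewrite /clip_grad /excess_grad; have p0 := phi0 x.
case: ifPn => h; case: ifPn => h'; [lra|ring|ring|].
by rewrite !addr0 subr0 expr0n/= mul0r mulr0 !addr0.
Qed.

Lemma excess_phi_L1 : L1 (fun x => excess u phi x * phi x).
Proof. by case: has_grad_excess => o2 _ _; case: pg => p2 _ _; exact: L2M. Qed.

Lemma Rint_clip_sqr : \int[mu]_x u x ^+ 2 =
  \int[mu]_x clip u phi x ^+ 2 + \int[mu]_x excess u phi x ^+ 2 + 2 * \int[mu]_x (excess u phi x * phi x).
Proof.
case: has_grad_excess => o2 _ _; case: has_grad_clip => c2 _ _.
have I1 := L2_sq o2; have I2 := L2_sq c2; have I3 := excess_phi_L1.
rewrite -RintZ// -RintD// -RintD; [|exact: L1D|exact: L1Z].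
by apply: eq_Rint => x; exact: clip_sqr.
Qed.

Lemma energy_clip : energy g = energy (clip_grad u g phi dp) + energy (excess_grad u g phi dp)
  + 2 * \sum_(i < N) \int[mu]_x (excess_grad u g phi dp i x * dp i x).
Proof.
have [_ o2 _] := has_grad_excess; have [_ c2 _] := has_grad_clip; have [_ p2 _] := pg.
rewrite /energy mulr_sumr -!big_split/=; apply: eq_bigr => i _.
have I1 := L2_sq (o2 i); have I2 := L2_sq (c2 i); have I3 := L2M (o2 i) (p2 i).
rewrite -RintZ// -RintD// -RintD; [|exact: L1D|exact: L1Z].
by apply: eq_Rint => x; exact: clip_grad_sqr.
Qed.

(* For [excess u phi x = 0] the right-hand side vanishes thanks to [ln 0 = 0]. *)
Lemma sqln_clip x : sqln (u x) - sqln (clip u phi x) <=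
  sqln (excess u phi x) + 4 * excess u phi x ^+ 2 + 4 * (excess u phi x * phi x)
  + excess u phi x * phi x * (2 * ln (phi x ^+ 2)).
Proof.
have p0 := phi0 x; case: (clip_cases x) => -[h E ->]; last first.
- by rewrite E sqln0 subrr expr0n/= !mul0r !mulr0 !addr0.
- have := sqlnD_le p0 (w := - u x - phi x); rewrite subr_gt0 h => /(_ isT).
  rewrite (addrC (phi x)) subrK !sqlnN -E => /le_trans; apply.
  by rewrite le_eqVlt; apply/orP; left; apply/eqP; ring.
- have := sqlnD_le p0 (w := u x - phi x); rewrite subr_gt0 h => /(_ isT).
  rewrite (addrC (phi x)) subrK -E => /le_trans; apply.
  by rewrite le_eqVlt; apply/orP; left; apply/eqP; ring.
Qed.

Lemma L1_sqln_clip : L1 (fun x => phi x + phi x ^+ 3) -> L1 (fun x => sqln (clip u phi x)).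
Proof.
case: has_grad_clip => c2 _ _ I; have mc := L2_meas c2.
have ms : measurable_fun setT (fun x => sqln (clip u phi x)).
  have m2 := measurable_funX 2 mc; apply: measurable_funM => //.
  exact: measurableT_comp.
apply: (L1_le ms (L1Z 2 I)) => x; apply: le_trans (sqln_norm _) _.
rewrite mulrDr lerD// ler_wpM2l ?clip_le_phi// ler_pXn2r ?nnegrE ?clip_le_phi//.
exact: ltW.
Qed.

End clip.

End has_grad_algebra.

(** * The inequality obtained by truncating a minimiser *)

Section main_inequality.
Context {R : realType} (N : nat).
Local Notation mu := (@lebesgue_row R N).
Local Notation L1 f := (mu.-integrable [set: 'rV[R]_N] (EFin \o f)).
Local Notation L2 := (L2 mu).
Implicit Types (f u w : 'rV[R]_N -> R) (g : 'I_N -> 'rV[R]_N -> R) (x : 'rV[R]_N) (k al : R).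

Definition bell k al x : R := k * gaus al x.

Definition bell_grad k al (i : 'I_N) x : R := k * (- 2 * al * x 0 i * gaus al x).

Lemma has_grad_bell k al : 0 < al -> has_grad (bell k al) (bell_grad k al).
Proof. by move=> al0; exact/has_gradZ/has_grad_gaus. Qed.

Lemma bell_gt0 k al x : 0 < k -> 0 < bell k al x.
Proof. by move=> k0; rewrite mulr_gt0// gaus_gt0. Qed.

Lemma L2_dotr_gaus al : 0 < al -> L2 (fun x => dotr x x * gaus al x).
Proof.
move=> al0; have al2 : 0 < al / 2 by rewrite divr_gt0.
apply: (L2_le _ (L2Z (2 / al) (L2_gaus N al2))) => [|x].
  by apply: measurable_funM; [exact: measurable_dotr_self|exact: measurable_gaus].
rewrite ger0_norm; last by rewrite mulr_ge0 ?dotr_ge0// ltW// gaus_gt0.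
rewrite ger0_norm ?dotr_gaus_le// mulr_ge0//; last by rewrite ltW// gaus_gt0.
by rewrite divr_ge0// ltW.
Qed.

Lemma L2_coord2_gaus al (i : 'I_N) : 0 < al -> L2 (fun x => x 0 i ^+ 2 * gaus al x).
Proof.
move=> al0; apply: (L2_le _ (L2_dotr_gaus al0)) => [|x].
  apply: measurable_funM; last exact: measurable_gaus.
  by apply: measurable_funX; exact: measurable_coord.
have g0 := ltW (gaus_gt0 al x).
rewrite normrM [leRHS]normrM; apply: ler_wpM2r => //.
by rewrite !ger0_norm ?sqr_ge0 ?dotr_ge0// coord_dotr_le.
Qed.

Lemma is_derive_bell_grad k al (i : 'I_N) x :
  is_derive x (basis_vec i) (bell_grad k al i)
    (k * (4 * al ^+ 2 * (x 0 i ^+ 2 * gaus al x) - 2 * al * gaus al x)).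
Proof.
have d1 := is_derive_coord i x (basis_vec i).
have d2 := is_derive_gaus al i x.
have d3 := is_deriveM d1 d2.
have := @is_deriveZ _ _ _ (fun y : 'rV[R]_N => y 0 i * gaus al y) (k * (- 2 * al)) x _ _ d3.
rewrite (_ : _ \*: _ = bell_grad k al i); last first.
  by apply/funext => y; rewrite /bell_grad /= /GRing.scale/=; ring.
move=> H; apply: is_derive_eq H _.
rewrite /GRing.scale/= /basis_vec mxE !eqxx/=; ring.
Qed.

Lemma smooth_bell_grad k al (i : 'I_N) : smooth (bell_grad k al i).
Proof.
apply: smoothZ; apply: smoothM; last exact: smooth_gaus.
by apply: smoothZ; exact: smooth_coord.
Qed.

(** The factor multiplying [f] is the Laplacian of [bell k al]. *)
Lemma bell_ibp f g k al : has_grad f g -> 0 < al ->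
  \sum_(i < N) \int[mu]_x (g i x * bell_grad k al i x) =
  - \int[mu]_x (f x * (k * ((4 * al ^+ 2 * dotr x x - 2 * al * N%:R) * gaus al x))).
Proof.
move=> [f2 g2 fg] al0; have [_ p2 _] := has_grad_bell k al0.
have D i x : 'D_(basis_vec i) (bell_grad k al i) x =
    k * (4 * al ^+ 2 * (x 0 i ^+ 2 * gaus al x) - 2 * al * gaus al x).
  exact: (@derive_val _ _ _ _ _ _ _ (is_derive_bell_grad k al i x)).
have D2 i : L2 (fun x => k * (4 * al ^+ 2 * (x 0 i ^+ 2 * gaus al x) - 2 * al * gaus al x)).
  by apply: L2Z; apply: L2B; apply: L2Z; [exact: L2_coord2_gaus|exact: L2_gaus].
have I i := L2M f2 (D2 i).
transitivity (\sum_(i < N) - \int[mu]_x (f x * (k * (4 * al ^+ 2 * (x 0 i ^+ 2 * gaus al x) - 2 * al * gaus al x)))).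
  apply: eq_bigr => i _; apply/esym/eqP; rewrite eqr_oppLR; apply/eqP.
  rewrite -(weak_partial_ibp (fg i) (smooth_bell_grad k al i)).
  - by apply: eq_Rint => x; rewrite D.
  - exact: L2M.
  - by apply: eq_L1 (I i) => x; rewrite D.
  - exact: L2M.
rewrite sumrN -Rint_sum//; congr (- _); apply: eq_Rint => x.
rewrite -mulr_sumr -mulr_sumr; congr (_ * (_ * _)).
rewrite sumrB sumr_const card_ord mulrBl; congr (_ - _); last by rewrite -mulr_natr; ring.
rewrite -mulr_sumr -mulr_suml mulrA; congr (_ * _ * _).
Qed.

Lemma ln_bell_sqr k al x : 0 < k -> ln (bell k al x ^+ 2) = 2 * (ln k - al * dotr x x).
Proof.
move=> k0; rewrite lnXn ?bell_gt0// -[LHS]mulr_natl; congr (_ * _).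
by rewrite lnM ?posrE ?gaus_gt0// /gaus expRK mulNr.
Qed.

Lemma dist2_le2 f f' : L2 f -> L2 f' -> dist2 f <= 2 * dist2 f' + 2 * \int[mu]_x (f x - f' x) ^+ 2.
Proof.
move=> f2 f2'; set e := \int[mu]_x _.
rewrite -lerBlDr -ler_pdivrMl//; apply: lb_le_inf; first by case: (dist2_has_inf f').
move=> _ [w Gw <-]; rewrite ler_pdivrMl// lerBlDr.
have w2 := L2_Gaussians Gw.
apply: (@le_trans _ _ (\int[mu]_x (f x - w x) ^+ 2)).
  by apply: ge_inf; [case: (dist2_has_inf f)|exists w].
rewrite addrC; apply: le_trans (Rint_sqD_le (L2B f2 f2') (L2B f2' w2)).
rewrite le_eqVlt; apply/orP; left; apply/eqP; apply: eq_Rint => x; ring.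
Qed.

(** The deficit as a real number, with the normalisation inside the logarithm split off. *)
Definition rdef f g : R := energy g - pi * \int[mu]_x sqln (f x)
  + pi * ((\int[mu]_x f x ^+ 2) * ln (\int[mu]_x f x ^+ 2)) - N%:R * pi * \int[mu]_x f x ^+ 2.

(** The conditions under which deficit, distance and quotient are all given by real numbers. *)
Definition admissible f g := [/\ has_grad f g, 0 < \int[mu]_x f x ^+ 2, 0 < dist2 f & L1 (fun x => sqln (f x))].

Lemma Rint_sqln_div f : L2 f -> 0 < \int[mu]_x f x ^+ 2 ->
  (L1 (fun x => sqln (f x)) <-> L1 (fun x => f x ^+ 2 * ln (f x ^+ 2 / \int[mu]_x f x ^+ 2))) /\
  (L1 (fun x => sqln (f x)) ->
    \int[mu]_x (f x ^+ 2 * ln (f x ^+ 2 / \int[mu]_x f x ^+ 2)) =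
    \int[mu]_x sqln (f x) - (\int[mu]_x f x ^+ 2) * ln (\int[mu]_x f x ^+ 2)).
Proof.
move=> f2; set M := \int[mu]_x f x ^+ 2 => M0.
have E x : f x ^+ 2 * ln (f x ^+ 2 / M) = sqln (f x) - ln M * f x ^+ 2.
  have [->|fx] := eqVneq (f x) 0; first by rewrite sqln0 expr0n/= !mul0r mulr0 subr0.
  rewrite ln_div ?posrE ?exprn_even_gt0//= /sqln; ring.
have IM := L1Z (ln M) (L2_sq f2).
split=> [|I]; last first.
  by rewrite (eq_Rint _ E) RintB// RintZ ?[ln _ * _]mulrC//; exact: L2_sq.
split=> I; first by apply: eq_L1 (L1B I IM) => x; rewrite E.
by apply: eq_L1 (L1D I IM) => x; rewrite E subrK.
Qed.

(** Mass and squared distance at most double when passing from [clip] to [u], up to twice the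
    excess; an excess of at most a quarter of each therefore keeps those of [clip] positive. The
    moments come from the Gaussian barrier. *)
Lemma admissible_clip u g k al : has_grad u g -> 0 < \int[mu]_x u x ^+ 2 -> 0 < dist2 u ->
  1 <= k -> 0 < al ->
  \int[mu]_x excess u (bell k al) x ^+ 2 <= (\int[mu]_x u x ^+ 2) / 4 ->
  \int[mu]_x excess u (bell k al) x ^+ 2 <= dist2 u / 4 ->
  admissible (clip u (bell k al)) (clip_grad u g (bell k al) (bell_grad k al)) /\
  forall i, L2 (fun x => x 0 i * clip u (bell k al) x).
Proof.
have aux3 (m s a : R) : m <= 2 * a + 2 * s -> a <= m / 4 -> 0 < m -> 0 < s by lra.
move=> ug M0 d0 k1 al0; have k0 : 0 < k by exact: lt_le_trans k1.
have [u2 g2 _] := ug; set a := \int[mu]_x excess _ _ x ^+ 2 => aM ad.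
pose phi := bell k al; pose dp := bell_grad k al.
have pg : has_grad phi dp := has_grad_bell k al0; have [p2 dp2 _] := pg.
have phi0 x : 0 < phi x by exact: bell_gt0.
pose f := clip u phi; have cg : has_grad f (clip_grad u g phi dp) := has_grad_clip ug pg.
have [f2 _ _] := cg.
have phik x : phi x <= k by rewrite ler_piMr ?gaus_le1// ltW.
have uf : \int[mu]_x (u x - f x) ^+ 2 = a.
  apply: eq_Rint => x; rewrite -[LHS]real_normK ?num_real//.
  by rewrite (sub_clip_norm u phi0).
have f0 : 0 < \int[mu]_x f x ^+ 2.
  have := Rint_sqD_le (L2B u2 f2) f2; under eq_Rint do rewrite subrK.
  by rewrite uf => /aux3; exact.
have df : 0 < dist2 f.
  by have := dist2_le2 u2 f2; rewrite uf addrC => /aux3; exact.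
have Iphi : L1 (fun x => phi x + phi x ^+ 3).
  have I1 : L1 phi by apply: L1Z; exact: L1_gaus.
  apply: L1D => //; apply: (L1_le _ (L1Z (k ^+ 2) I1)) => [|x].
    by apply: measurable_funX; exact: L1_meas I1.
  have h := ltW (phi0 x).
  rewrite ger0_norm ?exprn_ge0// exprSr ler_wpM2r// ler_pXn2r ?nnegrE//; exact: ltW.
have If : L1 (fun x => sqln (f x)) by exact: (L1_sqln_clip ug pg phi0 Iphi).
have xf i : L2 (fun x => x 0 i * f x).
  apply: (L2_le _ (L2Z k (L2_coord_gaus i al0))) => [|x].
    by apply: measurable_funM; [exact: measurable_coord|exact: L2_meas f2].
  rewrite (_ : k * _ = x 0 i * phi x); last by rewrite /phi /bell; ring.
  rewrite normrM [leRHS]normrM ler_wpM2l// (gtr0_norm (phi0 x)).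
  exact: clip_le_phi.
by split; [split|].
Qed.

Section minimizer.
Context (u : 'rV[R]_N -> R) (g : 'I_N -> 'rV[R]_N -> R) (Q : R).
Context (N0 : (0 < N)%N) (adm : admissible u g) (uQ : rdef u g = Q * dist2 u).
Context (minQ : forall f g', admissible f g' -> (forall i, L2 (fun x => x 0 i * f x)) ->
  Q * dist2 f <= rdef f g').

Let M := \int[mu]_x u x ^+ 2.

(** Minimality is used only against competitors with moments, here the truncation of [u]. The
    bracket on the right collects [2 Delta(phi) / phi], with its negative part dropped,
    [2 pi ln (phi^2)], and a constant for all errors of size [w * phi]. *)
Lemma clip_inequality : exists2 C : R, 0 <= C & exists2 a0 : R, 0 < a0 &
  forall k al, 1 <= k -> 0 < al -> al <= 1 / 2 ->
  let o := excess u (bell k al) in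
  0 < \int[mu]_x o x ^+ 2 -> \int[mu]_x o x ^+ 2 <= a0 ->
  energy (excess_grad u g (bell k al) (bell_grad k al)) / 2 + \int[mu]_x o x ^+ 2 <=
  \int[mu]_x (o x * bell k al x * (8 * al ^+ 2 * dotr x x + 4 * pi * (ln k - al * dotr x x) + C)).
Proof.
(* The bookkeeping is linear once integrals and products are variables; stating it for reals leaves
   it to [lra]. *)
have aux1 (e e' G J p S S' n Mu m a P d d' L q CT lM lm : R) :
    Q * d' <= e' - p * S' + p * (m * lm) - n * p * m ->
    e - p * S + p * (Mu * lM) - n * p * Mu = Q * d ->
    e = e' + G - J -> Mu = m + a + 2 * P -> p * (m * lm - Mu * lM) <= p * (L * (a + 2 * P)) ->
    Q * (d - d') <= q * ((a + 2 * P) + CT * (P + a)) ->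
    0 <= n * p * a -> 0 <= q * a -> 0 <= p * (L * a) ->
    0 <= - G + J + p * (S - S') + (2 * (p * L + n * p + q) + q * CT) * (a + P).
  by move=> h1 h2 h3 h4 h5 h6 h7 h8 h9; subst Mu e; lra.
have aux2 (G J1' J1 J2 p S Ce C a P la b : R) : 0 <= - G + J1' + p * S + C * (a + P) -> J1' <= J1 ->
    p * S <= G / 2 + p * (Ce * a + a * la + 4 * a + 4 * P + J2) ->
    a * (p * la + (p * Ce + 4 * p + C)) <= a * -1 ->
    G / 2 + a <= J1 + p * J2 + (4 * p + C) * P.
  by move=> h1 h2 h3 h4; lra.
have aux5 (p e c al a P J : R) : 0 < p -> p * ((2 * p)^-1 * e + c + (al + 4 * a + 4 * P + J)) =
    e / 2 + p * (c + al + 4 * a + 4 * P + J).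
  by move=> p0; field; exact: lt0r_neq0.
have aux4 (r s : R) : r <= 1 * - (s + 1) -> r + s <= -1 by lra.
have [ug M0 d0 Iu] := adm; have [u2 g2 _] := ug.
have p0 : 0 < pi :> R := pi_gt0 R.
(* With this factor, [pi] times the logarithmic Sobolev bound uses up exactly half of the energy of
   the excess. *)
have eta0 : 0 < (2 * pi)^-1 :> R by rewrite invr_gt0 mulr_gt0.
have [Ce Ce0 LS] := @log_sobolev R N _ N0 eta0.
have [CT CT0 HT] := gproj_diff u2.
pose C := 2 * (pi * `|ln M| + N%:R * pi + `|Q|) + `|Q| * CT.
have C0 : 0 <= C by rewrite addr_ge0 ?mulr_ge0// !addr_ge0// mulr_ge0// ltW.
pose C4 := pi * Ce + 4 * pi + C.
have pC : 0 <= pi * Ce by rewrite mulr_ge0// ltW.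
have p4 : 0 <= 4 * pi :> R by rewrite mulr_ge0// ltW.
have C40 : 0 <= C4 by exact: addr_ge0 (addr_ge0 pC p4) C0.
exists (4 * pi + C); first exact: addr_ge0.
(* The first bound makes [pi * ln a] negative enough to absorb every multiple of [a] and still leave
   [- a]; the other two are those of [admissible_clip]. *)
exists (Num.min (expR (- (C4 + 1))) (Num.min (M / 4) (dist2 u / 4))).
  by rewrite !lt_min expR_gt0 !divr_gt0.
move=> k al k1 al0 al2 o; have k0 : 0 < k by exact: lt_le_trans k1.
set a := \int[mu]_x o x ^+ 2 => a0; rewrite !le_min => /and3P[aC aM ad].
pose phi := bell k al; pose dp := bell_grad k al.
have pg : has_grad phi dp := has_grad_bell k al0; have [p2 dp2 _] := pg.
have phi0 x : 0 < phi x by exact: bell_gt0.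
have og : has_grad o (excess_grad u g phi dp) := has_grad_excess ug pg.
case: (og) => o2 og2 _.
pose f := clip u phi; have cg : has_grad f (clip_grad u g phi dp) := has_grad_clip ug pg.
have [f2 _ _] := cg.
set P := \int[mu]_x (o x * phi x).
have o0 x : 0 <= o x by exact: excess_ge0.
have P0 : 0 <= P by apply: Rint_ge0 => x; rewrite mulr_ge0// ltW.
have ME : M = \int[mu]_x f x ^+ 2 + a + 2 * P by exact: (Rint_clip_sqr ug pg phi0).
have [fadm xf] := admissible_clip ug M0 d0 k1 al0 aM ad; have [_ f0 df If] := fadm.
have Hmin := minQ fadm xf.
have gphi x : gaus (1 / 2) x <= phi x.
  apply: (@le_trans _ _ (gaus al x)); first exact: gaus_mono.
  by rewrite ler_peMl// ltW// gaus_gt0.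
have fu : \int[mu]_x f x ^+ 2 <= \int[mu]_x u x ^+ 2.
  by rewrite -/M ME -addrA lerDl addr_ge0 ?mulr_ge0// ltW.
have {HT} HT : `|gproj u - gproj f| <= CT * (P + a).
  by apply: HT => // x; rewrite (sub_clip_norm u phi0).
have HD : Q * (dist2 u - dist2 f) <= `|Q| * ((a + 2 * P) + CT * (P + a)).
  apply: (le_trans (ler_norm _)); rewrite normrM ler_wpM2l// !dist2E// -/M ME.
  rewrite (_ : _ - _ - _ = (a + 2 * P) - (gproj u - gproj f)); last by ring.
  apply: (le_trans (ler_normB _ _)); rewrite lerD// ger0_norm// addr_ge0 ?mulr_ge0//.
  exact: ltW.
(* Since [ln m <= ln M], the difference [m ln m - M ln M] is at most [- ln M * (M - m)]. *)
have HM : pi * ((\int[mu]_x f x ^+ 2) * ln (\int[mu]_x f x ^+ 2) - M * ln M) <= pi * (`|ln M| * (a + 2 * P)).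
  rewrite ler_pM2l//; set m := \int[mu]_x f x ^+ 2.
  have l1 : ln m <= ln M by rewrite ler_ln ?posrE.
  have aP : a + 2 * P = M - m by rewrite ME -/m; ring.
  have -> : m * ln m - M * ln M = (- ln M) * (a + 2 * P) - m * (ln M - ln m) by rewrite aP; ring.
  rewrite lerBlDr (@le_trans _ _ (`|ln M| * (a + 2 * P)))//.
    rewrite ler_wpM2r ?addr_ge0 ?mulr_ge0 ?(ltW a0)//.
    by rewrite -normrN ler_norm.
  by rewrite lerDl mulr_ge0 ?(ltW f0)// subr_ge0.
pose J1' := 2 * \int[mu]_x (o x * (k * ((4 * al ^+ 2 * dotr x x - 2 * al * N%:R) * gaus al x))).
have HE : energy g = energy (clip_grad u g phi dp) + energy (excess_grad u g phi dp) - J1'.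
  by rewrite (energy_clip ug pg phi0) (bell_ibp _ og al0) mulrN.
have H1 : 0 <= - energy (excess_grad u g phi dp) + J1' +
    pi * (\int[mu]_x sqln (u x) - \int[mu]_x sqln (f x)) + C * (a + P).
  apply: (aux1 _ _ _ _ _ _ _ _ _ _ _ _ _ _ _ _ _ _ _ Hmin uQ HE ME HM HD).
  - by rewrite mulr_ge0 ?mulr_ge0// ltW.
  - by rewrite mulr_ge0// ltW.
  - by rewrite mulr_ge0 ?(ltW p0)// mulr_ge0// ltW.
have rp2 : L2 (fun x => dotr x x * phi x).
  by apply: eq_L2 (L2Z k (L2_dotr_gaus al0)) => x; rewrite /phi /bell; ring.
have Iop := L2M o2 p2; have Iorp := L2M o2 rp2.
pose J1 := \int[mu]_x (8 * al ^+ 2 * (o x * (dotr x x * phi x))).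
have HJ1 : J1' <= J1.
  rewrite /J1' -RintZ; last first.
    apply: (L2M o2); apply: eq_L2 (L2B (L2Z (4 * al ^+ 2) rp2) (L2Z (2 * al * N%:R) p2)) => x.
    by rewrite /phi /bell; ring.
  apply: Rint_le => [||x]; last 1 first.
  - rewrite [leLHS](_ : _ = 8 * al ^+ 2 * (o x * (dotr x x * phi x)) - 4 * al * N%:R * (o x * phi x)).
      by rewrite gerBl; apply: mulr_ge0; apply: mulr_ge0 => //; [apply: mulr_ge0 => //|]; exact: ltW.
    by rewrite /phi /bell; ring.
  - apply: L1Z; apply: (L2M o2); apply: eq_L2 (L2B (L2Z (4 * al ^+ 2) rp2) (L2Z (2 * al * N%:R) p2)) => x.
    by rewrite /phi /bell; ring.
  - exact: L1Z.
pose J2 := \int[mu]_x (4 * ln k * (o x * phi x) - 4 * al * (o x * (dotr x x * phi x))).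
have IJ2 : L1 (fun x => 4 * ln k * (o x * phi x) - 4 * al * (o x * (dotr x x * phi x))).
  by apply: L1B; exact: L1Z.
have [ILS BLS] := LS o _ og a0; rewrite -/a in ILS BLS.
have HS : \int[mu]_x sqln (u x) - \int[mu]_x sqln (f x) <=
    (2 * pi)^-1 * energy (excess_grad u g phi dp) + Ce * a + (a * ln a + 4 * a + 4 * P + J2).
  rewrite -RintB//; have I2 := L2_sq o2.
  apply: (@le_trans _ _ (\int[mu]_x (o x ^+ 2 * ln (Num.max 1 (o x ^+ 2 / a)) +
     (ln a * o x ^+ 2 + (4 * o x ^+ 2 + (4 * (o x * phi x) +
     (4 * ln k * (o x * phi x) - 4 * al * (o x * (dotr x x * phi x)))))))));
    last first.
    rewrite RintD//; last by do 3 (apply: L1D; first exact: L1Z).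
    rewrite RintD//; [|exact: L1Z|by do 2 (apply: L1D; first exact: L1Z)].
    rewrite RintD//; [|exact: L1Z|by apply: L1D => //; exact: L1Z].
    rewrite RintD//; last exact: L1Z.
    rewrite !RintZ// -/a -/P -/J2 [ln a * a]mulrC !addrA lerD2r lerD2r lerD2r lerD2r.
    exact: BLS.
  apply: Rint_le => [||x]; first exact: L1B.
    by apply: L1D => //; do 3 (apply: L1D; first exact: L1Z).
  apply: (le_trans (sqln_clip u phi0 x)); rewrite -/(o x) ln_bell_sqr//.
  (* Splitting [ln o^2] into [ln (o^2 / a) + ln a] produces the term [a * ln a] that makes small
     excesses favourable. *)
  have h : sqln (o x) <= o x ^+ 2 * ln (Num.max 1 (o x ^+ 2 / a)) + ln a * o x ^+ 2.
    have [->|ox] := eqVneq (o x) 0; first by rewrite sqln0 expr0n/= mul0r mulr0 addr0.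
    have ox2 : 0 < o x ^+ 2 by rewrite exprn_even_gt0.
    rewrite (mulrC (ln a)) -mulrDr /sqln; apply: ler_wpM2l; first exact: ltW.
    rewrite -lerBlDr -ln_div ?posrE// ler_ln ?posrE ?lt_max ?ltr01 ?divr_gt0//.
    by rewrite le_max lexx orbT.
  move: h; move: (sqln (o x)) (o x ^+ 2 * ln _) => s1 s2 h.
  rewrite (_ : o x * phi x * _ = 4 * ln k * (o x * phi x) - 4 * al * (o x * (dotr x x * phi x))); last by ring.
  by rewrite !addrA !lerD2r.
have -> : \int[mu]_x (o x * bell k al x * (8 * al ^+ 2 * dotr x x + 4 * pi * (ln k - al * dotr x x) + (4 * pi + C))) =
    J1 + pi * J2 + (4 * pi + C) * P.
  rewrite /J1 /J2 /P -(RintZ pi IJ2) -(RintZ (4 * pi + C) Iop).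
  rewrite -RintD; [|exact: L1Z|exact: L1Z].
  rewrite -RintD; [|by apply: L1D; exact: L1Z|exact: L1Z].
  by apply: eq_Rint => x; rewrite -/(phi x); ring.
apply: (aux2 _ _ _ _ _ _ Ce _ _ _ (ln a) 0 H1 HJ1).
  have := ler_wpM2l (ltW p0) HS; move/le_trans; apply.
  rewrite le_eqVlt; apply/orP; left; apply/eqP.
  exact: aux5.
apply: ler_wpM2l; first exact: ltW.
have la : ln a <= - (C4 + 1) by rewrite -[leRHS]expRK ler_ln ?posrE ?expR_gt0.
have : pi * ln a <= 1 * - (C4 + 1).
  have p1 : 1 <= pi :> R by apply: le_trans (pi_ge2 R); rewrite ler1n.
  have h0 : - (C4 + 1) <= 0 by rewrite oppr_le0 addr_ge0.
  apply: (le_trans (ler_wpM2l (ltW p0) la)).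
  by rewrite ler_wnM2r.
exact: aux4.
Qed.

End minimizer.

End main_inequality.

(** * De Giorgi iteration *)

Section degiorgi.
Context {R : realType} (N : nat).
Local Notation mu := (@lebesgue_row R N).
Local Notation L1 f := (mu.-integrable [set: 'rV[R]_N] (EFin \o f)).
Local Notation L2 := (L2 mu).
Implicit Types (f w : 'rV[R]_N -> R) (x : 'rV[R]_N) (k al : R).

Definition above (c k al : R) : set 'rV[R]_N := [set x | c <= bell k al x].

Lemma measurable_bell k al : measurable_fun setT (@bell R N k al).
Proof. by apply: measurable_funM => //; exact: measurable_gaus. Qed.

Lemma measurable_above c k al : measurable (above c k al).
Proof.
have := measurable_bell k al measurableT (measurable_itv `[c, +oo[); rewrite setTI.
rewrite (_ : _ @^-1` _ = above c k al); first by apply.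
by apply/seteqP; split=> y; rewrite /above /= in_itv/= andbT.
Qed.

Lemma indic_aboveE c k al x : \1_(above c k al) x = (if c <= bell k al x then 1 else 0) :> R.
Proof.
rewrite indicE; case: ifPn => h; first by rewrite mem_set.
by rewrite memNset// /above /=; exact/negP.
Qed.

Lemma L1_above c k al f : L1 f -> L1 (fun x => \1_(above c k al) x * f x).
Proof.
move=> If; apply: (L1_bounded_mul (C := 1) If).
  by apply: measurable_indic; exact: measurable_above.
by move=> x; rewrite indic_aboveE; case: ifP; rewrite ?normr1 ?normr0.
Qed.

Section minimizer.
Context (u : 'rV[R]_N -> R) (g : 'I_N -> 'rV[R]_N -> R) (Q : R).
Context (N0 : (0 < N)%N) (adm : admissible u g) (uQ : rdef u g = Q * dist2 u).
Context (minQ : forall f g', admissible f g' -> (forall i, L2 (fun x => x 0 i * f x)) ->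
  Q * dist2 f <= rdef f g').

(** [Lam] bounds the bracket of [clip_inequality] from above, and [expR (- (C + 1))] is the height
    of the barrier below which the bracket is nonpositive. *)
Definition level_bound (C a0 : R) := forall k al Lam, 1 <= k -> 0 < al -> al <= 1 / 2 ->
  C + 4 * pi * ln k <= Lam -> 2 * al * Lam <= 1 ->
  let o := excess u (bell k al) in
  0 < \int[mu]_x o x ^+ 2 -> \int[mu]_x o x ^+ 2 <= a0 ->
  energy (excess_grad u g (bell k al) (bell_grad k al)) / 2 + \int[mu]_x o x ^+ 2 <=
  Lam * \int[mu]_x (\1_(above (expR (- (C + 1))) k al) x * (o x * bell k al x)).

Lemma level_inequality : exists2 C : R, 0 <= C & exists2 a0 : R, 0 < a0 & level_bound C a0.
Proof.
have aux1 (p al r C l Lam : R) : 2 <= p -> 0 < al -> al <= 1 / 2 -> 0 <= r -> C + 4 * p * l <= Lam ->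
    8 * al ^+ 2 * r + 4 * p * (l - al * r) + C <= Lam.
  move=> p2 al0 al1 r0 h; have ar : 0 <= al * r by rewrite mulr_ge0// ltW.
  have : al * (al * r) <= 1 / 2 * (al * r) by exact: ler_wpM2r.
  have : 2 * (al * r) <= p * (al * r) by exact: ler_wpM2r.
  by lra.
have aux2 (p al r C l Lam : R) : 2 <= p -> 0 < al -> al <= 1 / 2 -> 0 <= r -> C + 4 * p * l <= Lam ->
    2 * al * Lam <= 1 -> 0 <= C -> l - al * r <= - (C + 1) ->
    8 * al ^+ 2 * r + 4 * p * (l - al * r) + C <= 0.
  (* If the bracket were positive, then [4 al r <= Lam], so [8 al^2 r <= 2 al Lam <= 1]; but the
     logarithmic term is at most [- 8 (C + 1)]. *)
  move=> p2 al0 al1 r0 h aL C0 lC; rewrite leNgt; apply/negP => b0.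
  have ar : 0 <= al * r by rewrite mulr_ge0// ltW.
  have e1 : al * (al * r) <= 1 / 2 * (al * r) by exact: ler_wpM2r.
  have e2 : 2 * (al * r) <= p * (al * r) by exact: ler_wpM2r.
  have e3 : 4 * (al * r) <= Lam by lra.
  have e4 : al * (4 * (al * r)) <= al * Lam by apply: ler_wpM2l => //; exact: ltW.
  have e5 : p * (l - al * r) <= p * - (C + 1) by apply: ler_wpM2l => //; lra.
  have e6 : p * - (C + 1) <= 2 * - (C + 1).
    by rewrite !mulrN lerN2 ler_wpM2r// addr_ge0.
  by lra.
have [C C0 [a0 a00 H]] := clip_inequality N0 adm uQ minQ.
exists C => //; exists a0 => // k al Lam k1 al0 al2 CL aL o o0 oa.
have k0 : 0 < k by exact: lt_le_trans k1.
apply: le_trans (H k al k1 al0 al2 o0 oa) _; rewrite -/o.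
have [ug _ _ _] := adm; case: (has_grad_excess ug (has_grad_bell N k al0)) => o2 _ _.
have [p2 _ _] := has_grad_bell N k al0.
have Iop : L1 (fun x => o x * bell k al x) by exact: L2M.
have rp2 : L2 (fun x => dotr x x * bell k al x).
  by apply: eq_L2 (L2Z k (L2_dotr_gaus N al0)) => x; rewrite /bell; ring.
have Irp : L1 (fun x => o x * (dotr x x * bell k al x)) by exact: L2M.
rewrite -RintZ; last exact: L1_above.
apply: Rint_le => [||x]; last 1 first.
- rewrite indic_aboveE (mulrC (if _ then _ else _)) [leRHS]mulrCA.
  have op : 0 <= o x * bell k al x by rewrite mulr_ge0 ?excess_ge0// ltW// bell_gt0.
  have p2' := pi_ge2 R; have r0 := dotr_ge0 x.
  apply: ler_wpM2l => //.
  case: ifPn => [_|]; first by rewrite mulr1; exact: aux1.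
  rewrite mulr0 -ltNge => h; apply: (aux2 _ _ _ _ _ Lam) => //.
  have : ln (bell k al x) <= - (C + 1).
    by rewrite -[leRHS]expRK ler_ln ?posrE ?expR_gt0 ?bell_gt0// ltW.
  by rewrite lnM ?posrE ?gaus_gt0// /gaus expRK mulNr.
- apply: eq_L1 (L1D (L1Z (8 * al ^+ 2 - 4 * pi * al) Irp) (L1Z (4 * pi * ln k + C) Iop)) => x; ring.
- by apply: L1Z; exact: L1_above.
Qed.

Lemma excess_mono k k' al x : 0 < k -> k <= k' -> excess u (bell k' al) x <= excess u (bell k al) x.
Proof.
move=> k0 kk; have k0' := lt_le_trans k0 kk.
have h : bell k al x <= bell k' al x by rewrite ler_wpM2r// ltW// gaus_gt0.
rewrite !(excessE u (fun y => bell_gt0 al y _))// !pos_ifE.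
by do 2 case: ifPn => //; rewrite -?leNgt; lra.
Qed.

Lemma excess_sqr_mono k k' al : 0 < al -> 0 < k -> k <= k' ->
  \int[mu]_x excess u (bell k' al) x ^+ 2 <= \int[mu]_x excess u (bell k al) x ^+ 2.
Proof.
move=> al0 k0 kk; have [ug _ _ _] := adm.
case: (has_grad_excess ug (has_grad_bell N k al0)) => o2 _ _.
case: (has_grad_excess ug (has_grad_bell N k' al0)) => o2' _ _.
apply: Rint_le => [||x]; [exact: L2_sq|exact: L2_sq|].
by rewrite ler_pXn2r ?nnegrE ?excess_ge0// excess_mono.
Qed.

Lemma excess0_ae k k' al : 0 < al -> 0 < k -> k <= k' ->
  \int[mu]_x excess u (bell k al) x ^+ 2 = 0 ->
  {ae mu, forall x, `|u x| <= bell k' al x}.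
Proof.
move=> al0 k0 kk H; have [ug _ _ _] := adm.
case: (has_grad_excess ug (has_grad_bell N k al0)) => o2 _ _.
have := Rint_eq0_ae (L2_sq o2) (fun x => sqr_ge0 _) H.
apply: filterS => x /eqP; rewrite expf_eq0/= (excessE u (fun y => bell_gt0 al y k0)) => /eqP h.
apply: (@le_trans _ _ (bell k al x)); last by rewrite ler_wpM2r// ltW// gaus_gt0.
rewrite leNgt; apply/negP => h'; move: h; rewrite pos_ifE subr_gt0 h'.
by move/eqP; rewrite subr_eq0 => /eqP E; move: h'; rewrite E ltxx.
Qed.

(** Each step crosses two gaps between consecutive barriers. Across the first, [level_bound] and the
    gap bound the energy by the previous [z]; across the second, [weak_type] turns this energy into
    the next [z]. The gaps are comparable to the barrier, hence bounded below on the fixed set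
    [B]. *)
Lemma degiorgi (C a0 K al Lam : R) : level_bound C a0 -> 1 <= K -> 0 < al -> al <= 1 / 2 ->
  1 <= Lam -> C + 4 * pi * ln (2 * K) <= Lam -> 2 * al * Lam <= 1 ->
  let e0 := (2 ^+ 11 * 4 ^+ N * Lam)^-1 in
  \int[mu]_x excess u (bell K al) x ^+ 2 <= expR (- (C + 1)) ^+ 2 * e0 ^+ N / (2 ^+ 11 * Lam) ->
  \int[mu]_x excess u (bell K al) x ^+ 2 <= a0 ->
  {ae mu, forall x, `|u x| <= bell (2 * K) al x}.
Proof.
move=> LB K1 al0 al2 Lam1 CL aL e0; set c0 := expR _; set eta := _ / _ => y0 ya.
have c00 : 0 < c0 by exact: expR_gt0.
have K0 : 0 < K by exact: lt_le_trans K1.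
have Lam0 : 0 < Lam by exact: lt_le_trans Lam1.
have e00 : 0 < e0 by rewrite invr_gt0; apply: mulr_gt0 => //; apply: mulr_gt0; rewrite exprn_gt0.
have eta0 : 0 < eta.
  apply: divr_gt0; apply: mulr_gt0 => //; by rewrite exprn_gt0.
(* The heights increase from [K] at [m = 0] towards [2 K]. *)
pose k (m : nat) : R := K * (2 - 2^-1 ^+ m).
have hm (m : nat) : 0 < (2^-1 : R) ^+ m by rewrite exprn_gt0.
have hm1 (m : nat) : (2^-1 : R) ^+ m <= 1 by rewrite exprn_ile1//; lra.
have kK m : K <= k m by rewrite /k ler_peMr// ?(ltW K0)//; have := hm1 m; lra.
have k2K m : k m <= 2 * K by rewrite /k mulrC ler_wpM2r// ?(ltW K0)//; have := hm m; lra.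
have k0 m : 0 < k m by exact: lt_le_trans (kK m).
have kS m : k m.+1 - k m = K * 2^-1 ^+ m.+1 by rewrite /k exprS; field.
have kmono m : k m <= k m.+1 by rewrite -subr_ge0 kS mulr_ge0// ltW.
pose w m := excess u (bell (k m) al).
have w0 m x : 0 <= w m x by exact: excess_ge0.
have wS m x : w m.+1 x <= w m x by exact: excess_mono.
have wE m x : w m x = pos (`|u x| - bell (k m) al x) by exact: (excessE u (fun y => bell_gt0 al y (k0 m))).
have [ug _ _ _] := adm.
have w2 m : L2 (w m) by case: (has_grad_excess ug (has_grad_bell N (k m) al0)).
pose a m := \int[mu]_x w m x ^+ 2.
have [[m am]|na] := pselect (exists m, a m = 0); first exact: (excess0_ae al0 (k0 m)).
have a_gt0 m : 0 < a m.
  rewrite lt_neqAle Rint_ge0 ?andbT => [|x]; last exact: sqr_ge0.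
  by apply/negP => /eqP h; apply: na; exists m.
have a_le m : a m <= \int[mu]_x excess u (bell K al) x ^+ 2 by apply: excess_sqr_mono.
have gap m x : 0 < w m.+1 x -> K * 2^-1 ^+ m.+1 * gaus al x <= w m x.
  rewrite !wE !pos_ifE subr_gt0; case: ifPn => [h _|]; last by rewrite ltxx.
  have h2 : bell (k m) al x + K * 2^-1 ^+ m.+1 * gaus al x = bell (k m.+1) al x.
    by rewrite /bell -kS; ring.
  have h3 : 0 < K * 2^-1 ^+ m.+1 * gaus al x by rewrite !mulr_gt0 ?gaus_gt0.
  move: h2 h3 h; move: (bell (k m) al x) (bell (k m.+1) al x) (_ * gaus al x) `|u x| => b1 b2 d v.
  by move=> <- d0 h; rewrite ifT; lra.
pose B := above c0 (2 * K) al.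
(* Even levels only; the odd ones are the intermediate levels of the double step. *)
pose z n := \int[mu]_x (\1_B x * w n.*2 x ^+ 2).
have Iz m : L1 (fun x => \1_B x * w m x ^+ 2) by apply: L1_above; exact: L2_sq.
have z0 n : 0 <= z n.
  by apply: Rint_ge0 => x; rewrite mulr_ge0 ?sqr_ge0// indicE.
pose G m := energy (excess_grad u g (bell (k m) al) (bell_grad (k m) al)).
have G0 m : 0 <= G m by exact: energy_ge0.
pose h n : R := 2^-1 ^+ n.
have h0 n : 0 < h n by exact: hm.
have h4 n : 4 ^+ n.+1 * h n ^+ 2 = 4.
  by rewrite /h -exprM mulnC exprM exprS -mulrA -exprMn (_ : 4 * 2^-1 ^+ 2 = 1) ?expr1n ?mulr1//; field.
have hd n : 2^-1 ^+ n.*2 = h n ^+ 2 :> R by rewrite /h -exprM muln2.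
(* Where the excess at level [2 n + 1] is positive, the one at level [2 n] is at least [4^-(n + 1)]
   times the barrier; this turns [w * phi] into a square. *)
have stepA n : G n.*2.+1 / 2 + a n.*2.+1 <= Lam * (4 ^+ n.+1 * z n).
  set m := n.*2.+1; have CLm : C + 4 * pi * ln (k m) <= Lam.
    apply: le_trans CL; rewrite lerD2l ler_wpM2l ?mulr_ge0 ?pi_ge0//.
    by rewrite ler_ln ?posrE//; exact: mulr_gt0.
  have := LB (k m) al Lam (le_trans K1 (kK m)) al0 al2 CLm aL (a_gt0 m) (le_trans (a_le m) ya).
  move/le_trans; apply; apply: ler_wpM2l; first exact: ltW.
  rewrite /z -RintZ//; apply: Rint_le => [||x]; [|exact: L1Z|].
    by have [p2 _ _] := has_grad_bell N (k m) al0; apply: L1_above; exact: (L2M (w2 m) p2).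
  rewrite !indic_aboveE -/(w m).
  have gx := gaus_gt0 al x.
  have bb : bell (k m) al x <= bell (2 * K) al x by rewrite ler_wpM2r// ltW.
  have rhs0 : 0 <= 4 ^+ n.+1 * w n.*2 x ^+ 2 by rewrite mulr_ge0 ?exprn_ge0 ?sqr_ge0.
  case: ifPn => hB; last first.
    by rewrite mul0r mulr_ge0 ?exprn_ge0// mulr_ge0 ?sqr_ge0//; case: ifP.
  rewrite ifT ?(le_trans hB)// !mul1r.
  have [wm|wm] := ltP 0 (w m x); last first.
    by rewrite (_ : w m x = 0) ?mul0r//; apply/eqP; rewrite eq_le wm w0.
  have wg := gap n.*2 x wm.
  have b1 : bell (k m) al x <= 4 ^+ n.+1 * w n.*2 x.
    apply: (le_trans bb); apply: (@le_trans _ _ (4 ^+ n.+1 * (K * 2^-1 ^+ m * gaus al x))); last first.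
      by rewrite ler_wpM2l ?exprn_ge0.
    rewrite /bell (_ : 4 ^+ n.+1 * _ = (4 ^+ n.+1 * 2^-1 ^+ m) * (K * gaus al x)); last by ring.
    rewrite (_ : 4 ^+ n.+1 * 2^-1 ^+ m = 2); first by rewrite mulrA.
    by have E4 := h4 n; rewrite /m [2^-1 ^+ _]exprS hd mulrCA E4; field.
  apply: (@le_trans _ _ (w n.*2 x * (4 ^+ n.+1 * w n.*2 x))).
    apply: ler_pM => //; [apply: ltW; exact: bell_gt0|exact: wS].
  by rewrite mulrCA -expr2.
pose D : R := 2 ^+ N; have D0 : 0 < D by rewrite exprn_gt0.
have DD : 4 ^+ N = D ^+ 2 by rewrite /D -exprM mulnC exprM; congr (_ ^+ _); ring.
(* [e0] is chosen so that the gain of one step exactly matches the decrease by [2 ^+ 6 * 2 ^+ N] of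
   the bound asserted for [z]. *)
have eL : 2 ^+ 11 * D ^+ 2 * (Lam * e0) = 1.
  by rewrite mulrA -DD mulfV// !mulf_neq0// ?expf_neq0// lt0r_neq0.
have D1 : 1 <= D by rewrite /D -natrX ler1n expn_gt0.
have e01 : e0 <= 1.
  have P1 : 1 <= 2 ^+ 11 * 4 ^+ N * Lam.
    by apply: mulr_ege1 => //; apply: mulr_ege1; rewrite exprn_ege1// ler1n.
  by rewrite /e0 invf_le1// (lt_le_trans ltr01).
(* [eta] is chosen so that the condition of [weak_type] below is met with equality by the bound for
   [a m]. *)
have etaE : 8 * Lam * eta = c0 ^+ 2 / 16 ^+ 2 * e0 ^+ N.
  rewrite /eta (_ : 2 ^+ 11 = 8 * 16 ^+ 2 :> R); last by ring.
  by move: (e0 ^+ N) => E; field; exact: lt0r_neq0.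
(* The exponent is [6 + N]: [weak_type] asks for [h ^+ 4] from the threshold and [h ^+ N] from the
   scale, and the factor [4 ^+ n] of [stepA] costs [h ^+ 2] more. *)
have stepZ n : z n <= eta * (h n ^+ 6 * h n ^+ N) -> z n.+1 <= eta * (h n.+1 ^+ 6 * h n.+1 ^+ N).
  move=> zn; set m := n.*2.+1; have hn := h0 n; have An := stepA n; rewrite -/m in An.
  have Z1 : 4 ^+ n.+1 * z n * h n ^+ 2 = 4 * z n by rewrite mulrAC h4.
  (* Half of the lower bound for the gap on [B], so that [w m <= 2 * (w m - t)] wherever the next
     excess is positive there. *)
  pose t := c0 * h n ^+ 2 / 16; have t0 : 0 < t by rewrite divr_gt0// mulr_gt0// exprn_gt0.
  have en0 : 0 < e0 * h n by rewrite mulr_gt0.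
  have A2 : 2 * a m <= t ^+ 2 * (e0 * h n) ^+ N.
    have : a m <= Lam * (4 ^+ n.+1 * z n).
      by apply: le_trans An; rewrite lerDr divr_ge0.
    have : 4 ^+ n.+1 * z n <= 4 * eta * (h n ^+ 4 * h n ^+ N).
      rewrite -(ler_pM2r (exprn_gt0 2 hn)) Z1.
      rewrite (_ : 4 * eta * _ * _ = 4 * (eta * (h n ^+ 6 * h n ^+ N))); last by ring.
      by rewrite ler_pM2l.
    move/(ler_wpM2l (ltW Lam0)) => q1 q2; have q3 := le_trans q2 q1.
    rewrite (_ : t ^+ 2 * _ = 8 * Lam * eta * (h n ^+ 4 * h n ^+ N)); last first.
      by rewrite etaE /t (exprMn N e0 (h n)); move: (e0 ^+ N) (h n ^+ N) (h n) => E F r; field.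
    rewrite (_ : _ * _ = 2 * (Lam * (4 * eta * (h n ^+ 4 * h n ^+ N)))); last by ring.
    by rewrite ler_pM2l.
  have wg : has_grad (w m) (excess_grad u g (bell (k m) al) (bell_grad (k m) al)).
    exact: has_grad_excess ug (has_grad_bell N (k m) al0).
  have WT := weak_type wg t0 en0 A2; rewrite -/(G m) -/D in WT.
  have zW : z n.+1 <= 4 * \int[mu]_x pos (w m x - t) ^+ 2.
    have p2 := L2_pos (w2 m) (ltW t0).
    rewrite /z doubleS -RintZ; last exact: L2_sq.
    apply: Rint_le => [||x]; [exact: Iz|by apply: L1Z; exact: L2_sq|].
    have rhs0 : 0 <= 4 * pos (w m x - t) ^+ 2 by rewrite mulr_ge0 ?sqr_ge0.
    rewrite indic_aboveE; case: ifPn => hB; last by rewrite mul0r.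
    rewrite mul1r -/m; have [wm|wm] := ltP 0 (w m.+1 x); last first.
      by rewrite (_ : w m.+1 x = 0) ?expr0n//; apply/eqP; rewrite eq_le wm w0.
    have g1 := gap m x wm.
    have t2 : 2 * t <= w m x.
      apply: le_trans g1; rewrite /t /m !exprS hd.
      rewrite (_ : 2 * _ = c0 * (h n ^+ 2 / 8)); last by field.
      rewrite (_ : K * _ * _ = 2 * K * gaus al x * (h n ^+ 2 / 8)); last by field.
      by apply: ler_wpM2r => //; rewrite divr_ge0// sqr_ge0.
    rewrite (_ : 4 * _ = (2 * pos (w m x - t)) ^+ 2); last by rewrite exprMn; congr (_ * _); ring.
    have wmS := wS m x.
    rewrite ler_pXn2r ?nnegrE ?mulr_ge0 ?pos_ge0//.
    rewrite pos_ifE; move: (w m.+1 x) (w m x) t2 wmS => w1 w2' t2 wmS.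
    by rewrite ifT; lra.
  apply: (le_trans zW); apply: (@le_trans _ _ (4 * (D * ((e0 * h n) ^+ 2 * G m)))).
    by rewrite ler_pM2l.
  have GB : G m <= 2 * (Lam * (4 ^+ n.+1 * z n)).
    rewrite mulrC -ler_pdivrMr//; apply: le_trans An.
    by rewrite lerDl; exact: ltW.
  apply: (@le_trans _ _ (4 * (D * ((e0 * h n) ^+ 2 * (2 * (Lam * (4 ^+ n.+1 * z n))))))).
    by rewrite ler_pM2l// ler_pM2l// ler_pM2l// exprn_gt0.
  rewrite (_ : 4 * _ = e0 * (8 * D * (Lam * e0) * (4 ^+ n.+1 * z n * h n ^+ 2))); last by ring.
  rewrite Z1; apply: (@le_trans _ _ (1 * (8 * D * (Lam * e0) * (4 * z n)))).
    by apply: ler_wpM2r => //; rewrite !mulr_ge0// ltW.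
  rewrite mul1r (_ : h n.+1 ^+ 6 * h n.+1 ^+ N = (h n ^+ 6 * h n ^+ N) / (2 ^+ 6 * D)); last first.
    have -> : h n.+1 = h n / 2 by rewrite /h exprS mulrC.
    rewrite (exprMn N (h n)) exprVn -/D; have := lt0r_neq0 D0.
    by move=> D'0; move: (h n ^+ N) (h n) => F r; field.
  rewrite [leRHS]mulrA ler_pdivlMr; last by apply: mulr_gt0 => //; rewrite exprn_gt0.
  rewrite [leLHS](_ : _ = (2 ^+ 11 * D ^+ 2 * (Lam * e0)) * z n); last by ring.
  by rewrite eL mul1r.
have zn n : z n <= eta * (h n ^+ 6 * h n ^+ N).
  elim: n => [|n IH]; last exact: stepZ.
  rewrite /h expr0 !expr1n !mulr1; apply: le_trans y0; apply: le_trans (a_le 0%N).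
  apply: Rint_le => [||x]; [exact: Iz|exact: L2_sq|].
  by rewrite double0 indic_aboveE; case: ifP; rewrite ?mul1r ?mul0r ?sqr_ge0.
(* The excess at height [2 K] lies below all [w m], so it vanishes once the odd-level integrals tend
   to 0. *)
have an n : a n.*2.+1 <= 4 * Lam * eta * h n.
  have hn := h0 n; have : a n.*2.+1 <= Lam * (4 ^+ n.+1 * z n).
    by apply: le_trans (stepA n); rewrite lerDr divr_ge0.
  move/le_trans; apply; rewrite (_ : 4 * _ * _ * _ = Lam * (4 * eta * h n)); last by ring.
  rewrite ler_pM2l// -(ler_pM2r (exprn_gt0 2 hn)) mulrAC h4.
  rewrite (_ : 4 * eta * h n * h n ^+ 2 = 4 * (eta * h n ^+ 3)); last by ring.
  rewrite ler_pM2l//; apply: (le_trans (zn n)); rewrite ler_pM2l//.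
  have h1 : h n <= 1 by exact: hm1.
  rewrite (_ : h n ^+ 6 = h n ^+ 3 * h n ^+ 3); last by rewrite -exprD.
  rewrite -mulrA ger_pMr ?exprn_gt0//; apply: mulr_ile1; rewrite ?exprn_ge0 ?(ltW hn)//.
    by rewrite exprn_ile1// ltW.
  by rewrite exprn_ile1// ltW.
apply: (excess0_ae al0 (k := 2 * K)); [exact: mulr_gt0|by []|].
apply/eqP; rewrite eq_le; apply/andP; split; last by apply: Rint_ge0 => x; exact: sqr_ge0.
have cv : (fun n => 4 * Lam * eta * h n) @ \oo --> (0 : R).
  rewrite -(mulr0 (4 * Lam * eta)); apply: cvgMr; apply: cvg_expr.
  by rewrite ger0_norm; lra.
rewrite -(cvg_lim _ cv)//; apply: limr_ge; first by apply/cvg_ex; exists 0.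
apply: nearW => n; apply: le_trans (an n); apply: excess_sqr_mono => //.
Qed.

End minimizer.

End degiorgi.

(** * Decay of minimisers *)

Section decay.
Context {R : realType} (N : nat).
Local Notation mu := (@lebesgue_row R N).
Local Notation L1 f := (mu.-integrable [set: 'rV[R]_N] (EFin \o f)).
Local Notation L2 := (L2 mu).
Implicit Types (f u : 'rV[R]_N -> R) (g : 'I_N -> 'rV[R]_N -> R) (x : 'rV[R]_N) (k al : R).

(** [weak_type] for [u] and [- u] at scale [expR (- j)]. The level grows like [expR (j * N)], so the
    tail decays like the power [- 2 / N] of the level. *)
Lemma tail_bound u g (j : R) : has_grad u g -> 0 <= j ->
  \int[mu]_x pos (`|u x| - (2 * \int[mu]_x u x ^+ 2 + 2) * expR (j * N%:R)) ^+ 2 <= 2 * 2 ^+ N * energy g * expR (- j) ^+ 2.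
Proof.
move=> ug j0; set M := \int[mu]_x u x ^+ 2; set K := _ * expR _; have [u2 _ _] := ug.
have M0 : 0 <= M by apply: Rint_ge0 => x; exact: sqr_ge0.
have M2 : 0 < 2 * M + 2 by rewrite ltr_wpDl// mulr_ge0.
have K0 : 0 < K by rewrite mulr_gt0 ?expR_gt0.
have cond : 2 * M <= K ^+ 2 * expR (- j) ^+ N.
  have -> : expR (- j) ^+ N = (expR (j * N%:R))^-1 by rewrite -expRM_natr mulNr expRN.
  rewrite /K exprMn -mulrA (expr2 (expR _)) mulfK; last by rewrite gt_eqF// expR_gt0.
  have E1 : 1 <= expR (j * N%:R) by rewrite -expR0 ler_expR mulr_ge0.
  apply: (@le_trans _ _ ((2 * M + 2) ^+ 2 * 1)); last by rewrite ler_wpM2l ?sqr_ge0.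
  by rewrite mulr1; move: M M0 {M2 K K0 E1} => M' M0; nra.
have W1 := weak_type ug K0 (expR_gt0 (- j)) cond.
have cond' : 2 * \int[mu]_x (- u x) ^+ 2 <= K ^+ 2 * expR (- j) ^+ N.
  by rewrite (_ : \int[mu]_x _ = M)//; apply: eq_Rint => x; rewrite sqrrN.
have W2 := weak_type (has_gradN ug) K0 (expR_gt0 (- j)) cond'; rewrite energyN in W2.
have I1 := L2_sq (L2_pos u2 (ltW K0)); have I2 := L2_sq (L2_pos (L2N u2) (ltW K0)).
rewrite (_ : \int[mu]_x _ = \int[mu]_x (pos (u x - K) ^+ 2 + pos (- u x - K) ^+ 2)).
  rewrite RintD//; apply: (le_trans (lerD W1 W2)).
  by rewrite le_eqVlt; apply/orP; left; apply/eqP; ring.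
apply: eq_Rint => x; rewrite !pos_ifE !subr_gt0.
have [h|h] := leP 0 (u x).
  have -> : (K < - u x) = false.
    by apply/negbTE; rewrite -leNgt (@le_trans _ _ 0) ?oppr_le0// ltW.
  by rewrite ger0_norm// (expr0n R 2) addr0.
have -> : (K < u x) = false.
  by apply/negbTE; rewrite -leNgt (@le_trans _ _ 0)// ltW.
by rewrite ltr0_norm// (expr0n R 2) add0r.
Qed.

(** As the Gaussian barrier widens it converges pointwise to the constant [K], with [u ^+ 2] as a
    majorant. *)
Lemma excess_cvg u g K s : has_grad u g -> 0 < K -> 0 < s ->
  (fun n => \int[mu]_x excess u (bell K (s * n.+1%:R^-1)) x ^+ 2) @ \oo -->
  \int[mu]_x pos (`|u x| - K) ^+ 2.
Proof.
move=> ug K0 s0; have [u2 _ _] := ug; have mu' := L2_meas u2.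
pose al n : R := s * n.+1%:R^-1; have al0 n : 0 < al n by rewrite mulr_gt0// invr_gt0.
have E n x : excess u (bell K (al n)) x = pos (`|u x| - bell K (al n) x).
  by apply: (excessE u (fun y => bell_gt0 (al n) y K0)).
have mE n : measurable_fun setT (excess u (bell K (al n))).
  by case: (has_grad_excess ug (has_grad_bell N K (al0 n))) => /L2_meas.
have mP : measurable_fun setT (fun x => pos (`|u x| - K)).
  by apply: measurable_pos; exact: measurableT_comp.
have gcv x : (fun n => bell K (al n) x) @ \oo --> K.
  rewrite -[X in _ --> X]mulr1; apply: cvgMr.
  have c : (fun n => - al n * dotr x x) @ \oo --> (0 : R).
    rewrite -(mul0r (dotr x x)) -oppr0 -(mulr0 s); apply: cvgMl; apply: cvgN; apply: cvgMr.
    exact: cvg_harmonic.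
  rewrite -(@expR0 R); apply: (cvg_comp _ _ c); exact: continuous_expR.
have cv x : (fun n => excess u (bell K (al n)) x ^+ 2) @ \oo --> pos (`|u x| - K) ^+ 2.
  have c1 : (fun n => pos (`|u x| - bell K (al n) x)) @ \oo --> pos (`|u x| - K).
    apply: (@squeeze_cvgr _ _ _ _ (fun=> pos (`|u x| - K)) (fun n => pos (`|u x| - K) + (K - bell K (al n) x))).
    - apply: nearW => n; have : bell K (al n) x <= K by rewrite ler_piMr ?(ltW K0)// gaus_le1// ltW.
      move: (bell _ _ _) => b bK; rewrite !pos_ifE; move: `|u x| => v.
      by apply/andP; split; do 2 case: ifPn; rewrite -?leNgt; lra.
    - exact: cvg_cst.
    - have c2 : (fun n => K - bell K (al n) x) @ \oo --> (0 : R).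
        by rewrite -(subrr K); apply: cvgB; [exact: cvg_cst|exact: gcv].
      by rewrite -[X in _ --> X]addr0; apply: cvgD => //; exact: cvg_cst.
  under eq_fun do rewrite E expr2.
  by rewrite expr2; apply: cvgM.
have le n x : `|excess u (bell K (al n)) x ^+ 2| <= u x ^+ 2.
  rewrite ger0_norm ?sqr_ge0// E -[leRHS]real_normK ?num_real// ler_pXn2r ?nnegrE ?pos_ge0//.
  have : 0 < bell K (al n) x by exact: bell_gt0.
  by rewrite pos_ifE; case: ifPn => // _; lra.
by have [] := Rint_dct (fun n => measurable_funX 2 (mE n)) (measurable_funX 2 mP) cv (L2_sq u2) le.
Qed.

(** With [K] of order [expR (j * N)], [Lam] is affine in [j]. The required threshold is a negative
    power of [Lam], whereas the tail decays like [expR (- j) ^+ 2]. *)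
Lemma choose_level u g (C a0 : R) : has_grad u g -> 0 <= C -> 0 < a0 ->
  exists K al Lam : R, [/\ [/\ 1 <= K, 0 < al & al <= 1 / 2],
    [/\ 1 <= Lam, C + 4 * pi * ln (2 * K) <= Lam & 2 * al * Lam <= 1],
    \int[mu]_x excess u (bell K al) x ^+ 2 <=
      expR (- (C + 1)) ^+ 2 * (2 ^+ 11 * 4 ^+ N * Lam)^-1 ^+ N / (2 ^+ 11 * Lam) &
    \int[mu]_x excess u (bell K al) x ^+ 2 <= a0].
Proof.
have aux (A B j n : R) : 0 <= A -> 0 <= B -> 0 <= j -> 0 < n -> A + B * j <= (A + B * n) * (1 + j / n).
  move=> A0 B0 j0 n0; rewrite (_ : _ * (1 + _) = A + B * j + (A * (j / n) + B * n)).
    by rewrite lerDl addr_ge0// mulr_ge0// ?divr_ge0// ltW.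
  by field; exact: lt0r_neq0.
move=> ug C0 a00; set M := \int[mu]_x u x ^+ 2; set c0 := expR _.
have M0 : 0 <= M by apply: Rint_ge0 => x; exact: sqr_ge0.
have c00 : 0 < c0 by exact: expR_gt0.
have p0 : 0 < pi :> R := pi_gt0 R.
pose A := C + 1 + 4 * pi * ln (4 * M + 4).
have M4 : 1 <= 4 * M + 4 by rewrite (@le_trans _ _ 4) ?ler1n ?lerDr ?mulr_ge0.
have A1 : 1 <= A by rewrite /A -addrA addrCA lerDl addr_ge0// !mulr_ge0 ?(ltW p0)// ln_ge0.
pose B : R := 4 * pi * N%:R; have B0 : 0 <= B by rewrite !mulr_ge0 ?(ltW p0).
pose D := A + B * N.+1%:R.
have D0 : 0 < D by rewrite ltr_pwDl// ?(lt_le_trans ltr01)// mulr_ge0.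
pose V1 : R := 2 ^+ 11 * (2 ^+ 11 * 4 ^+ N) ^+ N.
have V10 : 0 < V1 by apply: mulr_gt0; rewrite exprn_gt0// mulr_gt0// exprn_gt0.
pose X := 2 * 2 ^+ N * energy g.
have X0 : 0 <= X by rewrite !mulr_ge0 ?exprn_ge0 ?energy_ge0.
(* One factor [expR (- j)] beats [Lam ^+ N.+1], the other the constants: [j1] serves the threshold
   of the iteration, [j2] serves [a0], and [j < expR j] concludes. *)
pose j1 := X * V1 * D ^+ N.+1 / c0 ^+ 2; pose j2 := X / a0; pose j := j1 + j2.
have j10 : 0 <= j1.
  by rewrite divr_ge0 ?sqr_ge0// mulr_ge0 ?exprn_ge0 ?(ltW D0)// mulr_ge0// ltW.
have j20 : 0 <= j2 by rewrite divr_ge0// ltW.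
have j0 : 0 <= j by rewrite addr_ge0.
have ej : j < expR j by apply: lt_le_trans (expR_ge1Dx j); rewrite ltrDr.
pose K := (2 * M + 2) * expR (j * N%:R).
have E1 : 1 <= expR (j * N%:R) by rewrite -expR0 ler_expR mulr_ge0.
have K1 : 1 <= K.
  apply: mulr_ege1 => //; rewrite (@le_trans _ _ 2) ?ler1n ?lerDr ?mulr_ge0//.
have K0 : 0 < K by exact: lt_le_trans K1.
pose Lam := A + B * j.
have Lam1 : 1 <= Lam by apply: (le_trans A1); rewrite lerDl mulr_ge0.
have Lam0 : 0 < Lam by exact: lt_le_trans Lam1.
have LamK : C + 4 * pi * ln (2 * K) <= Lam.
  rewrite /K mulrA lnM ?posrE ?expR_gt0//; last by rewrite mulr_gt0// ltr_wpDl// mulr_ge0.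
  rewrite expRK (_ : 2 * (2 * M + 2) = 4 * M + 4); last by ring.
  by rewrite /Lam /A /B; move: (ln _) => l; lra.
(* [Lam] is at most [D * (1 + j / N.+1)], hence at most [D * expR (j / N.+1)]. *)
have LamD : Lam ^+ N.+1 <= D ^+ N.+1 * expR j.
  have -> : expR j = expR (j / N.+1%:R) ^+ N.+1 by rewrite -expRM_natr divfK// pnatr_eq0.
  rewrite -exprMn ler_pXn2r ?nnegrE ?(ltW Lam0) ?mulr_ge0 ?(ltW D0) ?expR_ge0//.
  apply: (@le_trans _ _ (D * (1 + j / N.+1%:R))); last by rewrite ler_pM2l// expR_ge1Dx.
  by apply: aux => //; exact: le_trans A1.
have T := tail_bound ug j0; rewrite -/M -/K -/X in T.
have ej2 : expR (- j) ^+ 2 = (expR j * expR j)^-1 by rewrite expRN exprVn expr2.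
pose eta := c0 ^+ 2 * (2 ^+ 11 * 4 ^+ N * Lam)^-1 ^+ N / (2 ^+ 11 * Lam).
have etaE : eta = c0 ^+ 2 / (V1 * Lam ^+ N.+1).
  rewrite /eta /V1 exprVn exprMn [Lam ^+ N.+1]exprS.
  have := lt0r_neq0 (exprn_gt0 N Lam0); have : (2 ^+ 11 * 4 ^+ N) ^+ N != 0 :> R.
    by rewrite expf_neq0// mulf_neq0// expf_neq0// pnatr_eq0.
  move: (_ ^+ N) (Lam ^+ N) => F G F0 G0.
  by field; rewrite F0 G0 lt0r_neq0// expf_neq0.
have X1 : X * expR (- j) ^+ 2 < eta.
  rewrite ej2 ltr_pdivrMr ?mulr_gt0 ?expR_gt0// etaE mulrAC ltr_pdivlMr ?mulr_gt0 ?exprn_gt0//.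
  have h1 : X * (V1 * Lam ^+ N.+1) <= X * V1 * D ^+ N.+1 * expR j.
    rewrite mulrA -[leRHS]mulrA; apply: ler_wpM2l => //.
    by rewrite mulr_ge0// ltW.
  apply: (le_lt_trans h1); rewrite [ltRHS]mulrA ltr_pM2r ?expR_gt0//.
  rewrite -ltr_pdivrMl ?exprn_gt0// mulrC -/j1.
  by apply: le_lt_trans ej; rewrite /j lerDl.
have X2 : X * expR (- j) ^+ 2 < a0.
  rewrite ej2 ltr_pdivrMr ?mulr_gt0 ?expR_gt0// mulrC -ltr_pdivrMr// -/j2.
  apply: (@lt_le_trans _ _ (expR j)); first by apply: le_lt_trans ej; rewrite /j lerDr.
  by rewrite ler_peMl ?expR_ge0// -expR0 ler_expR.
(* The largest rate allowed by [2 * al * Lam <= 1]; the rates [s / n.+1] then go to 0 with [K] and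
   [Lam] fixed. *)
pose s := (2 * Lam)^-1; have s0 : 0 < s by rewrite invr_gt0 mulr_gt0.
have T1 : \int[mu]_x pos (`|u x| - K) ^+ 2 < Num.min eta a0.
  by rewrite lt_min !(le_lt_trans T).
have /= cv := excess_cvg ug K0 s0.
have [n _ Hn] := cvgr_lt _ cv _ T1.
have {Hn} := Hn n (leqnn n); rewrite /= lt_min => /andP[n1 n2].
have nn : 0 < n.+1%:R^-1 :> R by rewrite invr_gt0.
have nn1 : n.+1%:R^-1 <= 1 :> R by rewrite invf_le1// ler1n.
exists K, (s * n.+1%:R^-1), Lam; split; [split=> //|split=> //|exact: ltW|exact: ltW].
- exact: mulr_gt0.
- apply: (@le_trans _ _ s); first by rewrite ler_piMr// ltW.
  by rewrite /s invfM mulrC mul1r ler_piMl ?invr_ge0// invf_le1.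
- rewrite (_ : 2 * _ * _ = n.+1%:R^-1)// /s; move: (n.+1%:R^-1) => r.
  by field; exact: lt0r_neq0.
Qed.

(** Completing the square in [al s^2 - s + 1 / (4 al)], with [s] the Euclidean norm. *)
Lemma gaus_le_exp al x : 0 < al -> gaus al x <= expR (4 * al)^-1 * expR (- enorm x).
Proof.
move=> al0; rewrite /gaus -expRD ler_expR -enorm_sqr; move: (enorm x) => s.
rewrite -subr_ge0 (_ : _ - _ = (2 * al * s - 1) ^+ 2 / (4 * al)).
  by rewrite divr_ge0 ?sqr_ge0// mulr_ge0// ltW.
by field; exact: lt0r_neq0.
Qed.

Section minimizer.
Context (u : 'rV[R]_N -> R) (g : 'I_N -> 'rV[R]_N -> R) (Q : R).
Context (N0 : (0 < N)%N) (adm : admissible u g) (uQ : rdef u g = Q * dist2 u).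
Context (minQ : forall f g', admissible f g' -> (forall i, L2 (fun x => x 0 i * f x)) ->
  Q * dist2 f <= rdef f g').

Lemma minimizer_decay : exists k al : R, [/\ 1 <= k, 0 < al & {ae mu, forall x, `|u x| <= bell k al x}].
Proof.
have [C C0 [a0 a00 LB]] := level_inequality N0 adm uQ minQ.
have [ug _ _ _] := adm.
have [K [al [Lam [[K1 al0 al2] [Lam1 CL aL] y0 ya]]]] := choose_level ug C0 a00.
exists (2 * K), al; split=> //; first by apply: mulr_ege1 => //; rewrite ler1n.
exact: (degiorgi adm LB K1 al0 al2 Lam1 CL aL y0 ya).
Qed.

End minimizer.

(** Almost everywhere [u] equals its truncation, whose moments are bounded by those of the
    barrier. *)
Lemma L2_coord_of_decay u k al (i : 'I_N) : measurable_fun setT u -> 0 < k -> 0 < al ->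
  {ae mu, forall x, `|u x| <= bell k al x} -> L2 (fun x => x 0 i * u x).
Proof.
move=> mu' k0 al0 H; have p0 x : 0 < bell k al x by exact: bell_gt0.
pose f := clip u (bell k al).
have mf : measurable_fun setT f.
  have mb := @measurable_bell R N k al.
  have m1 : measurable_fun setT (fun x => pos (u x - bell k al x)).
    by apply: measurable_maxr => //; exact: measurable_funB.
  have m2 : measurable_fun setT (fun x => pos (- u x - bell k al x)).
    by apply: measurable_maxr => //; apply: measurable_funB => //; exact: measurable_funN.
  by apply: measurable_funD => //; exact: measurable_funB.
have xf : L2 (fun x => x 0 i * f x).
  apply: (L2_le _ (L2Z k (L2_coord_gaus i al0))) => [|x].
    by apply: measurable_funM; [exact: measurable_coord|].
  rewrite (_ : k * _ = x 0 i * bell k al x); last by rewrite /bell; ring.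
  by rewrite normrM [leRHS]normrM ler_wpM2l// (gtr0_norm (p0 x)) clip_le_phi.
have mxu : measurable_fun setT (fun x => x 0 i * u x).
  by apply: measurable_funM; [exact: measurable_coord|].
split=> //; apply: (L1_ae (measurable_funX 2 mxu) (L2_sq xf)).
apply: filterS H => x Hx; congr ((_ * _) ^+ 2).
by case: (clip_cases u p0 x) => -[h _ //]; have := ler_norm (u x); have := ler_norm (- u x); rewrite normrN; lra.
Qed.

End decay.

(** * Proof of the theorem *)

Section assembly.
Context {R : realType} (N : nat).
Local Notation mu := (@lebesgue_row R N).
Local Notation nu := (@gauss_measure R N).
Local Notation L1 f := (mu.-integrable [set: 'rV[R]_N] (EFin \o f)).
Local Notation L2 := (L2 mu).
Implicit Types (f u : 'rV[R]_N -> R) (g : 'I_N -> 'rV[R]_N -> R) (x : 'rV[R]_N).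

Lemma H1_has_grad u : H1 mu u -> exists g, has_grad u g.
Proof.
move=> [/Lfun2P u2 [G /weak_gradientP[_ uG] G2]]; exists (fun i x => G x 0 i).
by split=> // i; exact/Lfun2P.
Qed.

Lemma admissible_sqln_div f g : admissible f g ->
  L1 (fun x => f x ^+ 2 * ln (f x ^+ 2 / \int[mu]_x f x ^+ 2)) /\
  energy g - pi * \int[mu]_x (f x ^+ 2 * ln (f x ^+ 2 / \int[mu]_x f x ^+ 2))
    - N%:R * pi * \int[mu]_x f x ^+ 2 = rdef f g.
Proof.
move=> [[f2 _ _] f0 _ If]; have [E1 E2] := Rint_sqln_div f2 f0.
by split; [exact/E1|rewrite E2// /rdef; ring].
Qed.

Lemma div_EFin (r d : R) : 0 < d -> (r%:E / d%:E)%E = (r / d)%:E.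
Proof. by move=> d0; rewrite inver gt_eqF. Qed.

Lemma stab_quotientE u g : admissible u g -> stab_quotient u = (rdef u g / dist2 u)%:E.
Proof.
move=> adm; have [I E] := admissible_sqln_div adm; have [ug _ d0 _] := adm.
have [u2 _ _] := ug.
by rewrite /stab_quotient (deficitE ug I) E L2dist_sqr// div_EFin.
Qed.

(** For functions with moments the two settings have the same quotient; almost everywhere equality
    with an exponential is excluded by [0 < dist2 f]. *)
Lemma admissible_gaussian f g : admissible f g -> (forall i, L2 (fun x => x 0 i * f x)) ->
  let v := fun x => f x / gam x in
  [/\ H1 nu v, ~ ae_in nu (@Exponentials R N) v & gstab_quotient v = (rdef f g / dist2 f)%:E].
Proof.
move=> adm xf v; have [I E] := admissible_sqln_div adm; have [fg f0 d0 _] := adm.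
have [f2 _ _] := fg; split; first exact: gauss_H1 fg xf.
  move=> /ae_in_gauss[w Gw fw]; move: d0; rewrite ltNge => /negP; apply.
  rewrite -(Rint_zero mu); apply: (@le_trans _ _ (\int[mu]_x (f x - w x) ^+ 2)).
    by apply: ge_inf; [case: (dist2_has_inf f)|exists w].
  rewrite le_eqVlt; apply/orP; left; apply/eqP; apply: Rint_ae => //.
    apply: measurable_funX; apply: measurable_funB; first exact: L2_meas f2.
    exact: measurable_Gaussians.
  by apply: filterS fw => x /(_ Logic.I) ->; rewrite subrr expr0n.
by rewrite /gstab_quotient (gdeficitE fg xf f0 I) E (L2dist_gauss (L2_meas f2)) L2dist_sqr// div_EFin.
Qed.

Lemma sharp_constant_le f g : admissible f g -> (forall i, L2 (fun x => x 0 i * f x)) ->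
  (sharp_constant R N <= (rdef f g / dist2 f)%:E)%E.
Proof.
move=> adm xf; have [Hv nv <-] := admissible_gaussian adm xf.
by apply: ereal_inf_lbound; exists (fun x => f x / gam x).
Qed.

(** A truncation of [u] itself, at a level where little is cut off, is a competitor with finite
    quotient. *)
Lemma sharp_constant_lty u g : has_grad u g -> 0 < dist2 u -> 0 < \int[mu]_x u x ^+ 2 ->
  (sharp_constant R N < +oo)%E.
Proof.
move=> ug d0 M0.
have a00 : 0 < Num.min ((\int[mu]_x u x ^+ 2) / 4) (dist2 u / 4) by rewrite lt_min !divr_gt0.
have [K [al [Lam [[K1 al0 al2] _ _ ya]]]] := choose_level ug (lexx 0) a00.
move: ya; rewrite le_min => /andP[y1 y2].
have [adm xf] := admissible_clip ug M0 d0 K1 al0 y1 y2.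
by apply: le_lt_trans (sharp_constant_le adm xf) _; rewrite ltry.
Qed.

(* A divergent entropy would make the quotient infinite, whereas the positive
   part of the entropy is controlled by the logarithmic Sobolev inequality. *)
Lemma entropy_integrable u g : (0 < N)%N -> has_grad u g -> 0 < dist2 u ->
  0 < \int[mu]_x u x ^+ 2 -> (stab_quotient u < +oo)%E ->
  L1 (fun x => u x ^+ 2 * ln (u x ^+ 2 / \int[mu]_x u x ^+ 2)).
Proof.
move=> N0 ug d0; set M := \int[mu]_x u x ^+ 2 => M0; have [u2 g2 uG] := ug.
set h := fun x => _.
have mh : measurable_fun setT h.
  have m2 := measurable_funX 2 (L2_meas u2); apply: measurable_funM => //.
  by apply: measurableT_comp => //; exact: measurable_funM.
have [C _ LS] := @log_sobolev R N 1 N0 ltr01; have [I _] := LS u g ug M0.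
have Ip : L1 (fun x => Num.max (h x) 0).
  apply: (L1_le _ I) => [|x]; first exact: measurable_maxr.
  rewrite ger0_norm ?le_max ?lexx ?orbT// ge_max; apply/andP; split; last first.
    by rewrite mulr_ge0 ?sqr_ge0// ln_ge0// le_max lexx.
  rewrite /h; have [->|ux] := eqVneq (u x) 0; first by rewrite expr0n/= !mul0r.
  have ux2 : 0 < u x ^+ 2 by rewrite exprn_even_gt0.
  rewrite ler_pM2l// ler_ln ?posrE ?lt_max ?ltr01 ?divr_gt0//.
  by rewrite le_max lexx orbT.
have mn : measurable_fun setT (fun x => Num.max (- h x) 0).
  by apply: measurable_maxr => //; exact: measurable_funN.
have nn x : 0 <= Num.max (- h x) 0 by rewrite le_max lexx orbT.
have [In|nIn] := pselect (L1 (fun x => Num.max (- h x) 0)).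
  move=> _; apply: eq_L1 (L1B Ip In) => x.
  by rewrite /Num.max; case: ltP => h1; case: ltP => h2; lra.
have entN : entropy mu u = -oo%E.
  rewrite /entropy Lnorm2E//= sqr_sqrtr ?(ltW M0)// integralE.
  have -> : (\int[mu]_x ((fun x => (h x)%:E)^\- x) = +oo)%E.
    have -> : (\int[mu]_x ((fun x => (h x)%:E)^\- x) = \int[mu]_x (Num.max (- h x) 0)%:E)%E.
      by apply: eq_integral => x _; rewrite funenegE -EFinN -EFin_max.
    by apply/eqP; rewrite -leye_eq leNgt; apply/negP => /(L1_ge0P _ mn nn).
  have -> : (\int[mu]_x ((fun x => (h x)%:E)^\+ x) = (\int[mu]_x Num.max (h x) 0)%:E)%E.
    by rewrite EFin_Rint//; apply: eq_integral => x _; rewrite funeposE -EFin_max.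
  by [].
rewrite /stab_quotient L2dist_sqr// /deficit entN.
rewrite (dirichletE (g := g))//; last exact: L2_locint.
rewrite gt0_muleNy ?lte_fin ?pi_gt0// -EFin_Rint; last exact: L2_sq.
by rewrite inver gt_eqF//= gt0_mulye ?ltxx// lte_fin invr_gt0.
Qed.

End assembly.

Theorem theorem1p2 (R : realType) (N : nat) (u : 'rV[R]_N -> R) :
  (1 <= N)%N ->
  H1 (lebesgue_row N) u ->
  ~ ae_in (lebesgue_row N) (@Gaussians R N) u ->
  stab_quotient u = sharp_constant R N ->
  let v := fun x => u x / gam x in
  (exists2 C : R, 0 < C &
     {ae lebesgue_row N, forall x, `|u x| <= C * expR (- enorm x)}) /\
  [/\ H1 (@gauss_measure R N) v,
      ~ ae_in (@gauss_measure R N) (@Exponentials R N) v &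
      gstab_quotient v = sharp_constant R N].
Proof.
move=> N0 /H1_has_grad[g ug] nG uS v; have [u2 _ _] := ug.
have d0 := dist2_gt0 u2 nG.
have M0 : 0 < \int[lebesgue_row N]_x u x ^+ 2.
  by apply: lt_le_trans d0 _; rewrite dist2E// gerBl gproj_ge0.
(* Finiteness of the infimum passes to the quotient of [u], which makes the entropy of [u]
   integrable. *)
have Sy := sharp_constant_lty ug d0 M0.
have Ih : stab_quotient u != +oo%E by rewrite uS lt_eqF.
have I : (stab_quotient u < +oo)%E by rewrite uS.
have Iu := entropy_integrable N0 ug d0 M0 I.
have adm : admissible u g.
  by split=> //; apply/(Rint_sqln_div u2 M0).1.
have SE := uS; rewrite (stab_quotientE adm) in SE.
(* The quotient of [u] takes the role of the real constant [Q]; by [SE] it is the Gaussian infimum,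
   which provides minimality. *)
have uQ : rdef u g = rdef u g / dist2 u * dist2 u by rewrite divfK// gt_eqF.
have [k [al [k1 al0 decay]]] : exists k al : R, [/\ 1 <= k, 0 < al &
    {ae lebesgue_row N, forall x, `|u x| <= bell k al x}].
  apply: (minimizer_decay N0 adm uQ) => f g' fadm xf; have [_ _ df _] := fadm.
  by rewrite -ler_pdivlMr// -lee_fin SE; exact: sharp_constant_le.
have k0 : 0 < k by exact: lt_le_trans k1.
split.
  exists (k * expR (4 * al)^-1); first by rewrite mulr_gt0 ?expR_gt0.
  apply: filterS decay => x /le_trans; apply.
  by rewrite -mulrA ler_pM2l// gaus_le_exp.
have xu i : L2 (lebesgue_row N) (fun x => x 0 i * u x).
  exact: L2_coord_of_decay (L2_meas u2) k0 al0 decay.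
by have [h1 h2 h3] := admissible_gaussian adm xu; split=> //; rewrite h3.
Qed.
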